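(* For $x\ge 2$, $$\sum_{p\le x}\ \sum_{\substack{r,s\ge 1,\ r \text{ odd}\\ r^2+s^2=p}} \Big(\frac{s}{r}\Big) \ll x^{76/77},$$ where $p$ runs over primes, $r,s$ run over positive integers with $r$ odd, $\big(\frac{s}{r}\big)$ is the Jacobi symbol, and the implied constant is absolute. *)

(* Defs.v *)
From mathcomp Require Import all_boot all_order all_algebra.
From mathcomp Require Import reals exp.

Set Implicit Arguments.
Unset Strict Implicit.
Unset Printing Implicit Defensive.

Import Order.TTheory GRing.Theory Num.Theory.

Local Open Scope ring_scope.

(* Meaningful only when p is an odd prime. *)
Definition legendre (a : int) (p : nat) : int :=
  if (p%:Z %| a)%Z then 0
  else if [exists x : 'I_p, ((x%:Z ^+ 2 == a %[mod p%:Z])%Z)] then 1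
  else -1.

(* The Jacobi symbol (a / n), meaningful only when n is odd and positive;
   the product is empty, so equal to 1, for n = 1. *)
Definition jacobi (a : int) (n : nat) : int :=
  \prod_(p <- primes n) legendre a p ^+ logn p n.

(* A solution of r ^ 2 + s ^ 2 = p has r <= p and s <= p, so these ranges
   lose no pair of positive integers. *)
Definition spin_at (p : nat) : int :=
  \sum_(1 <= r < p.+1 | odd r)
    \sum_(1 <= s < p.+1 | (r ^ 2 + s ^ 2 == p)%N) jacobi s%:Z r.

(* For x >= 0 and p : nat, p < (Num.truncn x).+1 is equivalent to p%:R <= x. *)
Definition spin_sum (R : realType) (x : R) : int :=
  \sum_(0 <= p < (Num.truncn x).+1 | prime p) spin_at p.

(* Main.v *)
(** Write [t = r + s i]. For [a] odd and positive, the symbol of [z w], with [z = a + b i], is the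
    product of the symbols of [z] and [w], of a character [chi z w] modulo the norm of [z] and of
    a sign depending on residues modulo 4. Hence bilinear sums over [z] and [w] are bilinear forms
    in [chi]: on small cells of [z] (where the condition on the norm of [z w] is that for a
    corner), Hoelder's and Cauchy's inequalities reduce them to sums of [chi z * chi z'] over
    boxes, which cancel unless the product of the norms is a square. Sums over [t] whose norm is
    divisible by [d] run, for fixed [r], over an arithmetic progression in [s]; averaging over
    shifts and dilations bounds them unless [r] has a large square factor. Vaughan's identity
    over the rational integers, applied to the norm, combines both bounds into one for the sum
    weighted by the von Mangoldt function, and partial summation removes the weight.

    All parameters are powers of an integer [y] with [y ^ (70 g) <= x < y ^ (70 g + 1)], and the
    divisor function is bounded by [y]; the total saving is [y ^ g], up to a bounded power of
    [y]. *)
Require Import Defs.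
From mathcomp Require Import all_boot all_order all_algebra.
From mathcomp Require Import finfield.
From mathcomp Require Import reals exp.
From mathcomp Require Import zify ring lra.
Set Implicit Arguments.
Unset Strict Implicit.
Unset Printing Implicit Defensive.
Import Order.TTheory GRing.Theory Num.Theory.
Local Open Scope ring_scope.

(** * Quadratic reciprocity and the Jacobi symbol *)

(** An identity over the rational integers is usable because, for primitive [t] of odd norm, each
    divisor [m] of the norm comes from exactly one factorization of [t] whose left factor is
    normalized of norm [m]; other [t] of odd norm have symbol 0.

    The bilinear sum must be bounded for norms of [z] from [y ^ (7 g)] up to about the square root
    of [x]. For [k = 1] the variable [w] has to outrun the modulus [gabs2 z * gabs2 z'], which fails
    beyond about [y ^ (11 g)]. The [k]-th power lengthens [w] to norms up to [Q ^ k], but its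
    diagonal asks for norms of [z] of at least [y ^ ((4 + 2 * k) g)]; [k = 1, 2, 6] together cover
    the range.

    Both cuts of Vaughan's identity are at [y ^ (7 g)], just above the 6 that [k = 1] asks for.
    Moduli [d] then reach [y ^ (14 g)], and the shifts in the progression sums cost [d ^ 2 u ^ 2 X0]
    with [u = y ^ (2 g)] and [X0] about the square root of [x]: in units of [g], 28 + 4 + 35 = 67,
    below the 69 that is wanted. *)

Lemma Fp_intr_eq0 (p : nat) (a : int) : prime p ->
  (a%:~R == 0 :> 'F_p) = (p%:Z %| a)%Z.
Proof.
move=> pp.
have hn (n : nat) : ((n%:R : 'F_p) == 0) = (p %| n)%N.
  by rewrite -(dvdn_pcharf (pchar_Fp pp)).
case: a => n; first by rewrite (_ : n%:Z%:~R = n%:R :> 'F_p) // hn dvdzE.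
by rewrite NegzE rmorphN oppr_eq0 /= (_ : n.+1%:Z%:~R = n.+1%:R :> 'F_p) // hn dvdzE abszN.
Qed.

Lemma Fp_intr_eq (p : nat) (a b : int) : prime p ->
  (a%:~R == b%:~R :> 'F_p) = (a == b %[mod p%:Z])%Z.
Proof.
by move=> pp; rewrite -subr_eq0 -rmorphB /= Fp_intr_eq0 // eqz_mod_dvd.
Qed.

Lemma legendre_sqr (p : nat) (a : int) : prime p ->
  [exists x : 'I_p, (x%:Z ^+ 2 == a %[mod p%:Z])%Z] =
  [exists x : 'F_p, x ^+ 2 == a%:~R].
Proof.
move=> pp; apply/existsP/existsP => -[x /eqP hx].
  exists ((x : nat)%:R); apply/eqP.
  rewrite (_ : x%:R = x%:Z%:~R :> 'F_p) // -rmorphXn /=; apply/eqP.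
  by rewrite Fp_intr_eq // hx.
have xp : (val x < p)%N.
  by have := ltn_ord x; rewrite [X in (_ < X)%N](Fp_cast pp).
exists (Ordinal xp) => /=; rewrite -Fp_intr_eq // rmorphXn /=.
by rewrite (_ : (val x)%:Z%:~R = (val x)%:R :> 'F_p) // natr_Zp hx.
Qed.

Lemma Fp_expr_pred (p : nat) (x : 'F_p) : prime p -> x != 0 -> x ^+ p.-1 = 1.
Proof.
move=> pp x0; have := expf_card x; rewrite card_Fp //.
by move=> h; apply: (mulfI x0); rewrite -exprS (prednK (prime_gt0 pp)) h mulr1.
Qed.

Lemma euler_criterion (p : nat) (a : int) : prime p -> odd p ->
  (legendre a p)%:~R = (a%:~R : 'F_p) ^+ p.-1./2.
Proof.
move=> pp op; rewrite /legendre legendre_sqr //.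
have p2 := prime_gt1 pp.
have hh : (p.-1./2 * 2 = p.-1)%N by lia.
have h0 : (0 < p.-1./2)%N by have := odd_prime_gt2 op pp; lia.
rewrite -Fp_intr_eq0 //; case: ifP => [/eqP az|/negbT a0]; first rewrite az.
  by rewrite expr0n gtn_eqF.
set h := p.-1./2 in hh h0 *.
have sq1 (x : 'F_p) : x != 0 -> (x ^+ 2) ^+ h = 1.
  by move=> x0; rewrite -exprM mulnC hh Fp_expr_pred.
case: ifP => [/existsP [x /eqP hx]|/negbT hno].
  rewrite -hx sq1 //; apply: contraNneq a0 => x0.
  by rewrite -hx x0 expr0n.
have pm : (a%:~R : 'F_p) ^+ h = 1 \/ (a%:~R : 'F_p) ^+ h = -1.
  have : ((a%:~R : 'F_p) ^+ h) ^+ 2 = 1 by rewrite -exprM hh Fp_expr_pred.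
  by move/eqP; rewrite sqrf_eq1 => /orP [] /eqP; auto.
case: pm => a1; last by rewrite a1 mulrN1z.
exfalso.
(* A nonresidue [a] with [a ^ h = 1] would join the [h] distinct nonzero squares as a root of
   [X ^ h - 1], which has at most [h] roots. *)
pose sq := [seq (i.+1%:R : 'F_p) ^+ 2 | i <- iota 0 h].
have nz (n : nat) : (0 < n < p)%N -> (n%:R : 'F_p) != 0.
  case/andP=> n0 np; rewrite -(dvdn_pcharf (pchar_Fp pp)).
  by apply: contraTN np => /dvdn_leq; rewrite -leqNgt; apply.
have usq : uniq sq.
  rewrite map_inj_in_uniq ?iota_uniq // => i j.
  rewrite !mem_iota add0n /= => hi hj /eqP; rewrite eqf_sqr => /orP [].
    case: (ltngtP i j) => // lij.
      rewrite eq_sym -subr_eq0 -natrB; last by lia.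
      by move=> hz; have := nz (j.+1 - i.+1)%N; rewrite hz => /(_ _)/negP []//; lia.
    rewrite -subr_eq0 -natrB; last by lia.
    by move=> hz; have := nz (i.+1 - j.+1)%N; rewrite hz => /(_ _)/negP []//; lia.
  rewrite -subr_eq0 opprK -natrD => hz.
  by have := nz (i.+1 + j.+1)%N; rewrite hz => /(_ _)/negP []//; lia.
have := @max_poly_roots _ ('X^h - 1 : {poly 'F_p}) (a%:~R :: sq).
rewrite -size_poly_gt0 size_XnsubC //= size_map size_iota ltnn => /(_ isT).
have rt (x : 'F_p) : x ^+ h = 1 -> root ('X^h - 1) x.
  by move=> hx; rewrite rootE !hornerE hx subrr.
case/(_ _ _)/Bool.diff_false_true => //.
  rewrite rt //=; apply/allP => x /mapP [i]; rewrite mem_iota => hi ->.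
  by apply: rt; rewrite sq1 // nz //; lia.
rewrite usq andbT; apply: contraNN hno => /mapP [i _ ->].
by apply/existsP; exists i.+1%:R.
Qed.

Lemma legendre_norm (a : int) p : `|legendre a p| <= 1.
Proof. by rewrite /legendre; case: ifP => // _; case: ifP. Qed.

Lemma legendre_eq0 (a : int) p : (legendre a p == 0) = (p%:Z %| a)%Z.
Proof. by rewrite /legendre; case: ifP => // _; case: ifP. Qed.

(** An odd prime separates -1, 0 and 1, so identities between symbols can be proved in the field
    with [p] elements, where Euler's criterion applies. *)
Lemma Fp_intr_small_inj (p : nat) (x y : int) : prime p -> odd p ->
  `|x| <= 1 -> `|y| <= 1 -> x%:~R = y%:~R :> 'F_p -> x = y.
Proof.
move=> pp op hx hy /eqP; rewrite Fp_intr_eq // eqz_mod_dvd => /dvdzP [k hk].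
have p3 := odd_prime_gt2 op pp; case: (eqVneq k 0) hk => [->|k0] hk; first by lia.
by nia.
Qed.

Lemma legendreM (p : nat) (a b : int) : prime p -> odd p ->
  legendre (a * b) p = legendre a p * legendre b p.
Proof.
move=> pp op; apply: (@Fp_intr_small_inj p) => //.
- exact: legendre_norm.
- by rewrite normrM mulr_ile1 ?legendre_norm.
by rewrite !rmorphM /= !euler_criterion // rmorphM exprMn.
Qed.

Lemma legendre_mod (p : nat) (a b : int) : (a = b %[mod p%:Z])%Z ->
  legendre a p = legendre b p.
Proof.
move=> h; rewrite /legendre.
have -> : (p%:Z %| a)%Z = (p%:Z %| b)%Z.
  by apply/dvdz_mod0P/dvdz_mod0P; rewrite h.
case: ifP => // _; congr (if _ then _ else _); apply: eq_existsb => x.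
by rewrite h.
Qed.

Lemma legendreN1 (p : nat) : prime p -> odd p ->
  legendre (-1) p = (-1) ^+ p.-1./2.
Proof.
move=> pp op; apply: (@Fp_intr_small_inj p) => //.
- exact: legendre_norm.
- by rewrite normrX normrN1 expr1n.
by rewrite euler_criterion // rmorphXn.
Qed.

Definition gauss_cnt (a p : nat) : nat :=
  count (fun i => p.-1./2 < (a * i) %% p)%N (index_iota 1 (p.-1./2).+1).

(** Two indices with the same folded residue satisfy [a i = a j] or [a i = - a j] modulo [p]; then
    [p] divides [i - j] or [i + j], both too small unless [i = j]. *)
Lemma gauss_perm (a p : nat) : prime p -> odd p -> coprime a p ->
  perm_eq [seq (let r := (a * i) %% p in if p.-1./2 < r then p - r else r)%N
     | i <- index_iota 1 (p.-1./2).+1] (index_iota 1 (p.-1./2).+1).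
Proof.
move=> pp op cap; set h := p.-1./2.
have hp : (h * 2).+1 = p by rewrite /h; have := odd_prime_gt2 op pp; lia.
set f := fun i => _.
have fr i : (0 < i <= h)%N -> (0 < (a * i) %% p < p)%N.
  move=> hi; rewrite ltn_mod lt0n; apply/andP; split; last by lia.
  rewrite -/(p %| a * i)%N Gauss_dvdr; last by rewrite coprime_sym.
  by apply/negP => /dvdn_leq; lia.
have fin i : (0 < i <= h)%N -> (0 < f i <= h)%N.
  by move=> hi; have := fr i hi; rewrite /f; case: ifP; lia.
have finj : {in index_iota 1 h.+1 &, injective f}.
  move=> i j; rewrite !mem_index_iota => hi hj.
  have ri := fr i ltac:(lia); have rj := fr j ltac:(lia).
  have key (s : bool) : ((a * i) %% p = if s then (a * j) %% p else p - (a * j) %% p)%N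
      -> i = j.
    case: s => e.
      wlog lij : i j hi hj ri rj e / (i <= j)%N.
        by move=> W; case: (leqP i j) => [|/ltnW] l; [exact: W|symmetry; exact: W].
      have : (p %| a * j - a * i)%N.
        by rewrite -(@eqn_mod_dvd p) ?leq_mul2l ?lij ?orbT // e.
      rewrite -mulnBr Gauss_dvdr; last by rewrite coprime_sym.
      case: (posnP (j - i)) => [|h0 /dvdn_leq]; lia.
    have : (p %| a * i + a * j)%N.
      by rewrite /dvdn -modnDm e subnK ?modnn; lia.
    rewrite -mulnDr Gauss_dvdr; last by rewrite coprime_sym.
    by move/dvdn_leq; lia.
  rewrite /f; case: ifP => h1; case: ifP => h2 e.
  - by apply: (key true); lia.
  - by apply: (key false); lia.
  - by apply: (key false); lia.
  - by apply: (key true); lia.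
apply: uniq_perm; rewrite ?map_inj_in_uniq ?iota_uniq //.
have sub : {subset [seq f i | i <- index_iota 1 h.+1] <= index_iota 1 h.+1}.
  move=> x /mapP [i]; rewrite !mem_index_iota => hi ->.
  by have := fin i ltac:(lia); lia.
have us : uniq [seq f i | i <- index_iota 1 h.+1].
  by rewrite map_inj_in_uniq ?iota_uniq.
by have [|_] := uniq_min_size us sub; rewrite ?size_map.
Qed.

(** With [h = (p - 1) / 2], the product of the [a i] is [a ^ h] times the factorial of [h], while by
    [gauss_perm] it is that factorial with one sign for each residue that is folded. *)
Lemma gauss_lemma (a p : nat) : prime p -> odd p -> coprime a p ->
  legendre a%:Z p = (-1) ^+ gauss_cnt a p.
Proof.
move=> pp op cap; apply: (@Fp_intr_small_inj p) => //.
- exact: legendre_norm.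
- by rewrite normrX normrN1 expr1n.
rewrite euler_criterion // rmorphXn /=.
have := gauss_perm pp op cap; set h := p.-1./2 => hperm.
have hp : (h * 2).+1 = p by rewrite /h; have := odd_prime_gt2 op pp; lia.
have nz : \prod_(1 <= i < h.+1) (i%:R : 'F_p) != 0.
  rewrite GRing.prodf_seq_neq0; apply/allP => i; rewrite mem_index_iota /= => hi.
  rewrite -(dvdn_pcharf (pchar_Fp pp)).
  by apply/negP => /dvdn_leq; lia.
apply: (mulIf nz); rewrite -[in RHS](perm_big _ hperm) big_map /=.
have -> : (a%:~R : 'F_p) ^+ h = \prod_(1 <= i < h.+1) (a%:R).
  by rewrite prodr_const_nat subSS subn0.
have -> : (-1 : 'F_p) ^+ gauss_cnt a p =
    \prod_(1 <= i < h.+1) (if (h < (a * i) %% p)%N then -1 else 1).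
  by rewrite -big_mkcond big_const_seq iter_mulr_1.
rewrite -!big_split /=; apply: eq_bigr => i _.
have pr (n : nat) : ((n %% p)%N%:R : 'F_p) = n%:R.
  by rewrite {2}(divn_eq n p) natrD natrM pchar_Fp_0 // mulr0 add0r.
case: ifP => _; last by rewrite mul1r pr natrM.
rewrite natrB; last by rewrite ltnW // ltn_mod; lia.
by rewrite pr pchar_Fp_0 // sub0r mulrNN mul1r natrM.
Qed.

Lemma count_gt_double (h : nat) :
  count (fun i => h < 2 * i)%N (index_iota 1 h.+1) = (h - h./2)%N.
Proof.
have e : (index_iota 1 h.+1 = index_iota 1 (h./2).+1 ++ index_iota (h./2).+1 h.+1)%N.
  rewrite /index_iota -[X in _ ++ iota X _](_ : 1 + h./2 = _)%N //.
  by rewrite (_ : (h./2).+1 - 1 = h./2)%N -?iotaD; [congr iota|]; lia.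
rewrite e count_cat (_ : count _ (index_iota 1 _) = 0%N); last first.
  apply/eqP; rewrite -leqn0 leqNgt -has_count; apply/hasPn => i.
  by rewrite mem_index_iota; lia.
rewrite add0n (_ : count _ _ = size (index_iota (h./2).+1 h.+1)); first by rewrite size_iota; lia.
by apply/eqP; rewrite -all_count; apply/allP => i; rewrite mem_index_iota; lia.
Qed.

Lemma legendre2 (p : nat) : prime p -> odd p ->
  legendre 2 p = (-1) ^+ (p.-1./2 - p.-1./2./2).
Proof.
move=> pp op; rewrite (@gauss_lemma 2) //; last first.
  by rewrite coprime2n.
congr (_ ^+ _); rewrite -count_gt_double; apply: eq_in_count => i.
rewrite mem_index_iota => hi; congr (_ < _)%N; apply: modn_small.
by have := prime_gt1 pp; lia.
Qed.

(** Modulo 2, folding [r] into [p - r] adds 1, since [p] is odd. By [gauss_perm] the residues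
    therefore sum to the sum of the [i] plus the count, and in [a i = p q + r] the odd factors [a]
    and [p] drop out. *)
Lemma odd_gauss_cnt (a p : nat) : prime p -> odd p -> coprime a p -> odd a ->
  odd (gauss_cnt a p) = odd (\sum_(1 <= i < (p.-1./2).+1) (a * i) %/ p)%N.
Proof.
move=> pp op cap oa.
have := gauss_perm pp op cap; rewrite /gauss_cnt; set h := p.-1./2 => hperm.
have e1 : (\sum_(1 <= i < h.+1) (a * i) =
    \sum_(1 <= i < h.+1) (a * i) %/ p * p + \sum_(1 <= i < h.+1) (a * i) %% p)%N.
  by rewrite -big_split; apply: eq_bigr => i _; apply: divn_eq.
have e2 : odd (\sum_(1 <= i < h.+1) (a * i) %% p +
     \sum_(1 <= i < h.+1) i +
     count (fun i => h < (a * i) %% p)%N (index_iota 1 h.+1))%N = false.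
  rewrite -[X in (_ + X + _)%N](perm_big _ hperm) big_map -sum1_count.
  rewrite [X in (_ + X)%N]big_mkcond -!big_split /=.
  apply: (big_rec (fun x => odd x = false)) => // i x _; rewrite oddD => ->.
  have : ((a * i) %% p < p)%N by rewrite ltn_mod; lia.
  by case: ifP; lia.
move: e1 e2; rewrite -big_distrr -big_distrl /=.
move/(congr1 odd); rewrite !oddD !oddM oa op.
by case: odd; case: odd; case: odd; case: odd.
Qed.

Lemma sum_leq_mul (n p k : nat) : (0 < p)%N -> (n %/ p <= k)%N ->
  (\sum_(1 <= j < k.+1) (p * j <= n) = n %/ p)%N.
Proof.
move=> p0 hk; have -> : (n %/ p = \sum_(1 <= j < (n %/ p).+1) 1)%N.
  by rewrite sum_nat_const_nat subn1 muln1.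
rewrite [RHS](big_nat_widen _ _ k.+1) // [RHS]big_mkcond /=.
by apply: eq_bigr => j _; rewrite ltnS leq_divRL // mulnC; case: leq.
Qed.

(** Eisenstein's lattice count: the two sums of quotients count the points of a rectangle with sides
    [(p - 1) / 2] and [(q - 1) / 2] on either side of the line [q i = p j], which contains none of
    them. *)
Lemma quadratic_reciprocity (p q : nat) :
  prime p -> odd p -> prime q -> odd q -> p != q ->
  legendre p q * legendre q p = (-1) ^+ (p.-1./2 * q.-1./2).
Proof.
move=> pp op pq oq npq.
have cpq : coprime p q by rewrite prime_coprime // dvdn_prime2.
have cqp : coprime q p by rewrite coprime_sym.
rewrite !gauss_lemma // -exprD -[LHS]signr_odd -[RHS]signr_odd.
suff -> : odd (gauss_cnt p q + gauss_cnt q p) = odd (p.-1./2 * q.-1./2) by [].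
rewrite oddD !odd_gauss_cnt // -oddD.
set h := p.-1./2; set k := q.-1./2; congr odd.
have hp : (h * 2).+1 = p by rewrite /h; have := odd_prime_gt2 op pp; lia.
have hq : (k * 2).+1 = q by rewrite /k; have := odd_prime_gt2 oq pq; lia.
have -> : (\sum_(1 <= i < h.+1) (q * i %/ p) =
   \sum_(1 <= i < h.+1) \sum_(1 <= j < k.+1) (p * j <= q * i))%N.
  apply: eq_big_nat => i hi; rewrite sum_leq_mul //; first by lia.
  by rewrite -ltnS ltn_divLR; nia.
have -> : (\sum_(1 <= j < k.+1) (p * j %/ q) =
   \sum_(1 <= i < h.+1) \sum_(1 <= j < k.+1) (q * i <= p * j))%N.
  rewrite exchange_big /=.
  apply: eq_big_nat => i hi; rewrite sum_leq_mul //; first by lia.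
  by rewrite -ltnS ltn_divLR; nia.
rewrite -big_split /= (eq_big_nat _ _ (F2 := fun _ => k)).
  by rewrite sum_nat_const_nat; lia.
move=> i hi; rewrite -big_split /= (eq_big_nat _ _ (F2 := fun _ => 1%N)).
  by rewrite sum_nat_const_nat; lia.
move=> j hj; case: (ltngtP (q * i) (p * j)) => //= e.
have : (p %| q * i)%N by rewrite e dvdn_mulr.
by rewrite Gauss_dvdr // => /dvdn_leq; lia.
Qed.

(** * The Jacobi symbol and its reciprocity law *)

Lemma odd_prime_ind (P : nat -> Prop) :
  P 1%N -> (forall p m, prime p -> odd p -> odd m -> P m -> P (p * m)%N) ->
  forall n, odd n -> P n.
Proof.
move=> P1 Pm n; elim/ltn_ind: n => n IH on.
case: (ltngtP n 1) on => [|n1 on|-> //]; first by case: n IH => //.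
have pp := pdiv_prime n1; have /dvdnP [m e] := pdiv_dvd n.
have : odd (m * pdiv n) by rewrite -e.
rewrite oddM => /andP [om op].
by rewrite e mulnC; apply: Pm => //; apply: IH => //; have := prime_gt1 pp; nia.
Qed.

(** Taking the product over all primes up to a common bound lets the symbols for [m], [n] and [m n]
    be compared factor by factor. *)
Lemma jacobi_prod (a : int) (n N : nat) : (0 < n <= N)%N ->
  jacobi a n = \prod_(0 <= p < N.+1 | prime p) legendre a p ^+ logn p n.
Proof.
move=> hn; rewrite /jacobi.
have pe : perm_eq (primes n) [seq p <- index_iota 0 N.+1 | p \in primes n].
  apply: uniq_perm; rewrite ?filter_uniq ?iota_uniq ?primes_uniq // => p.
  rewrite mem_filter mem_index_iota /=; case: (boolP (p \in primes n)) => //=.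
  by rewrite mem_primes => /and3P [_ n0 /dvdn_leq]; lia.
rewrite (perm_big _ pe) big_filter big_mkcond [RHS]big_mkcond /=.
apply: eq_bigr => p _; rewrite mem_primes.
case: (boolP (prime p)) => //= pp; case: ifP => // hf.
suff -> : logn p n = 0%N by rewrite expr0.
by apply/eqP; rewrite -leqn0 leqNgt logn_gt0 mem_primes pp hf.
Qed.

Lemma jacobi1 a : jacobi a 1 = 1.
Proof. by rewrite /jacobi big_nil. Qed.

Lemma jacobiMr a m n : (0 < m)%N -> (0 < n)%N ->
  jacobi a (m * n) = jacobi a m * jacobi a n.
Proof.
move=> m0 n0; rewrite !(@jacobi_prod a _ (m * n)); [|nia..].
by rewrite -big_split /=; apply: eq_bigr => p _; rewrite lognM // exprD.
Qed.

Lemma jacobi_prime a p : prime p -> jacobi a p = legendre a p.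
Proof. by move=> pp; rewrite /jacobi primes_prime // big_seq1 logn_prime // eqxx. Qed.

Lemma jacobi_mod (a b : int) n : (a = b %[mod n%:Z])%Z -> jacobi a n = jacobi b n.
Proof.
move=> h; rewrite /jacobi; apply: eq_big_seq => p; rewrite mem_primes => /and3P [_ _ pn].
congr (_ ^+ _); apply: legendre_mod; apply/eqP; rewrite eqz_mod_dvd.
have /dvdz_trans : (p%:Z %| n%:Z)%Z by rewrite dvdzE.
by apply; rewrite -eqz_mod_dvd h.
Qed.

Lemma odd_dvdn m n : (m %| n)%N -> odd n -> odd m.
Proof. by move=> /dvdnP [k ->]; rewrite oddM => /andP []. Qed.

Lemma jacobiMl (a b : int) n : odd n -> jacobi (a * b) n = jacobi a n * jacobi b n.
Proof.
move=> on; rewrite /jacobi -big_split; apply: eq_big_seq => p /=.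
rewrite mem_primes => /and3P [pp _ pn].
by rewrite legendreM ?exprMn // (odd_dvdn pn).
Qed.

Lemma jacobi_norm a n : `|jacobi a n| <= 1.
Proof.
rewrite /jacobi; apply: (big_rec (fun x => `|x| <= 1)) => [|p x _ hx]; first by rewrite normr1.
by rewrite normrM mulr_ile1 // normrX exprn_ile1 // legendre_norm.
Qed.

Lemma jacobi_eq0 (a : int) n : (0 < n)%N -> (jacobi a n == 0) = ~~ coprime `|a| n.
Proof.
move=> n0; rewrite /jacobi GRing.prodf_seq_eq0.
apply/hasP/idP => [[p]|].
  rewrite mem_primes => /and3P [pp _ pn] /=; rewrite expf_eq0 legendre_eq0 => /andP [_].
  rewrite dvdzE /= => pa; apply/negP => /eqP g1.
  have : (p %| gcdn `|a| n)%N by rewrite dvdn_gcd pa.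
  by rewrite g1 dvdn1 => /eqP p1; rewrite p1 in pp.
rewrite /coprime => g1.
have g0 : (0 < gcdn `|a| n)%N by rewrite gcdn_gt0 n0 orbT.
have pp : prime (pdiv (gcdn `|a| n)) by apply: pdiv_prime; lia.
have := pdiv_dvd (gcdn `|a| n); rewrite dvdn_gcd => /andP [pa pn].
have pin : pdiv (gcdn `|a| n) \in primes n by rewrite mem_primes pp n0.
exists (pdiv (gcdn `|a| n)) => //=.
by rewrite expf_eq0 legendre_eq0 dvdzE /= pa logn_gt0 pin.
Qed.

Lemma norm_le1_sqr (x : int) : `|x| <= 1 -> x != 0 -> x ^+ 2 = 1.
Proof.
move=> h x0; suff /orP [/eqP->|/eqP->] : (x == 1) || (x == -1) by [].
by lia.
Qed.

Lemma jacobi_sqr (a : int) n : (0 < n)%N -> coprime `|a| n -> jacobi a n ^+ 2 = 1.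
Proof.
by move=> n0 c; apply: norm_le1_sqr; rewrite ?jacobi_norm // jacobi_eq0 // c.
Qed.

Lemma jacobi1l n : odd n -> jacobi 1 n = 1.
Proof.
move=> on; have := jacobiMl 1 1 on; rewrite mulr1.
have : jacobi 1 n != 0 by rewrite jacobi_eq0 ?coprime1n //; case: n on.
by move=> j0 h; apply: (mulfI j0); rewrite mulr1 -h.
Qed.

Lemma sign_bool (b : nat) (c : bool) : odd b = c -> (-1) ^+ b = (-1) ^+ c :> int.
Proof. by move=> <-; rewrite signr_odd. Qed.

Lemma jacobiN1 n : odd n -> jacobi (-1) n = (-1) ^+ (n %% 4 == 3)%N.
Proof.
move: n; apply: odd_prime_ind => [|p m pp op om IH]; first by rewrite jacobi1.
have m0 : (0 < m)%N by lia.
rewrite (jacobiMr _ (prime_gt0 pp)) // IH.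
rewrite jacobi_prime // legendreN1 // -exprD; apply: sign_bool.
have : (m %% 4 = 1 \/ m %% 4 = 3)%N by lia.
have : (p %% 4 = 1 \/ p %% 4 = 3)%N by lia.
by rewrite oddD -modnMm => -[] hp [] hm; rewrite hp hm /=; lia.
Qed.

Lemma jacobi2 n : odd n -> jacobi 2 n = (-1) ^+ ((n %% 8 == 3) || (n %% 8 == 5))%N.
Proof.
move: n; apply: odd_prime_ind => [|p m pp op om IH]; first by rewrite jacobi1.
have m0 : (0 < m)%N by lia.
rewrite (jacobiMr _ (prime_gt0 pp)) // IH.
rewrite jacobi_prime // legendre2 // -exprD; apply: sign_bool.
have : (m %% 8 = 1 \/ m %% 8 = 3 \/ m %% 8 = 5 \/ m %% 8 = 7)%N by lia.
have : (p %% 8 = 1 \/ p %% 8 = 3 \/ p %% 8 = 5 \/ p %% 8 = 7)%N by lia.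
rewrite oddD -modnMm => -[|[|[]]] hp [|[|[]]] hm; rewrite hp hm /=; lia.
Qed.

Definition recsign (a b : nat) : int := (-1) ^+ ((a %% 4 == 3) && (b %% 4 == 3))%N.

Lemma recsignC a b : recsign a b = recsign b a.
Proof. by rewrite /recsign andbC. Qed.

Lemma recsignMl a b c : odd a -> odd b -> recsign (a * b) c = recsign a c * recsign b c.
Proof.
rewrite /recsign -exprD => oa ob; apply/esym/sign_bool; rewrite oddD.
have : (a %% 4 = 1 \/ a %% 4 = 3)%N by lia.
have : (b %% 4 = 1 \/ b %% 4 = 3)%N by lia.
by rewrite -modnMm => -[] hp [] hm; rewrite hp hm /=; case: (c %% 4 == 3)%N.
Qed.

(** Both sides are multiplicative in each argument, so induction on the prime factors of [b], then
    of [a], leaves two primes; if they coincide, both symbols vanish. *)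
Lemma jacobi_reciprocity a b : odd a -> odd b ->
  jacobi a%:Z b = jacobi b%:Z a * recsign a b.
Proof.
move=> oa; move: b; apply: odd_prime_ind => [|q m pq oq om IH].
  by rewrite jacobi1 /recsign andbF jacobi1l // mulr1.
have m0 : (0 < m)%N by lia.
rewrite (jacobiMr _ (prime_gt0 pq)) // IH PoszM jacobiMl // (recsignC a (q * m)%N) recsignMl //.
rewrite [recsign m a]recsignC; suff -> : jacobi a q = jacobi q a * recsign a q.
  by rewrite (recsignC q a); ring.
move: a oa {IH}; apply: odd_prime_ind => [|p n pp op on IH].
  by rewrite jacobi1 /recsign /= jacobi1l // mulr1.
have n0 : (0 < n)%N by lia.
rewrite (jacobiMr _ (prime_gt0 pp)) // PoszM jacobiMl // IH recsignMl //.
suff -> : jacobi p q = jacobi q p * recsign p q by ring.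
rewrite !jacobi_prime //; case: (eqVneq p q) => [->|npq].
  have /eqP -> : legendre q q == 0 by rewrite legendre_eq0.
  by rewrite mul0r.
have h := quadratic_reciprocity pp op pq oq npq.
have e2 : legendre q p ^+ 2 = 1.
  apply: norm_le1_sqr; first exact: legendre_norm.
  by rewrite legendre_eq0 dvdzE /= dvdn_prime2.
have -> : recsign p q = (-1) ^+ (p.-1./2 * q.-1./2).
  by apply/esym/sign_bool; rewrite oddM; lia.
by rewrite -h mulrCA -expr2 e2 mulr1.
Qed.

Lemma pow2_odd_decomp (n : nat) : (0 < n)%N -> exists j m, odd m /\ n = (2 ^ j * m)%N.
Proof.
elim/ltn_ind: n => n IH n0; case: (boolP (odd n)) => on.
  by exists 0%N, n; rewrite expn0 mul1n.
have [||j [m [om e]]] := IH n./2; [lia|lia|].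
by exists j.+1, m; split=> //; rewrite expnS -mulnA -e; lia.
Qed.

Lemma jacobi_mod_sub (a b c : int) n : a - b = n%:Z * c -> jacobi a n = jacobi b n.
Proof.
by move=> e; apply: jacobi_mod; apply/eqP; rewrite eqz_mod_dvd e dvdz_mulr.
Qed.

Lemma jacobi_sqrl (w : int) n : odd n -> coprime `|w| n -> jacobi (w ^+ 2) n = 1.
Proof.
by move=> on c; rewrite expr2 jacobiMl // -expr2 jacobi_sqr //; lia.
Qed.

(* The value of [(v / n)] when [n] is, up to sign, close to a square modulo [2 v]. *)
Lemma jacobi_near_square (n : nat) (s : bool) (v w b : int) :
  v != 0 -> (2 %| v)%Z -> (2 %| b)%Z -> ~~ (2 %| w)%Z -> coprime `|w| `|v| ->
  n%:Z = (-1) ^+ s * (w * (w - b * v)) ->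
  jacobi v n = (-1) ^+ ((s && (v < 0)) + ((b %% 4 == 2)%Z && (v %% 4 == 2)%Z)).
Proof.
move=> v0 ev eb ow cwv en.
have nv0 : (0 < `|v|)%N by lia.
have [j [v1 [ov1 ej]]] := pow2_odd_decomp nv0.
have /dvdzP [b1 eb1] := eb; have /dvdzP [v2 ev2] := ev.
have [w1 ew1] : exists w1, w = 2 * w1 + 1.
  by exists (w %/ 2)%Z; lia.
have j0 : (0 < j)%N by case: (j) ej => //; lia.
have [q eq] : exists q, w * (w - b * v) = 1 + 4 * q.
  exists (w1 ^+ 2 + w1 - w * b1 * v2); rewrite ew1 eb1 ev2; ring.
have on : odd n by case: (s) en; rewrite ?expr0 ?expr1 eq; lia.
have vE : v = (-1) ^+ (v < 0)%R * (2 ^+ j * v1%:Z).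
  transitivity ((-1) ^+ (v < 0)%R * `|v|%N%:Z); first exact: intEsign.
  by rewrite ej PoszM -natz natrX.
have nE (k : int) (m : nat) : w ^+ 2 - n%:Z * (-1) ^+ s = w * b * v.
  by rewrite en; case: (s); rewrite ?expr0 ?expr1; ring.
have cwv1 : coprime `|w| v1.
  by move: cwv; rewrite ej coprimeMr => /andP [].
have c1n (k : int) : jacobi ((-1) ^+ s) n = (-1) ^+ s.
  case: (s) en => en; last by rewrite expr0 jacobi1l.
  by rewrite expr1 jacobiN1 //; move: en; rewrite eq expr1; case: eqP => //; lia.
have jX (x : int) k : jacobi (x ^+ k) n = jacobi x n ^+ k.
  elim: k => [|k IH]; first by rewrite !expr0 jacobi1l.
  by rewrite !exprS jacobiMl // IH.
have E1 : jacobi ((-1) ^+ (v < 0)%R) n = (-1) ^+ (s && (v < 0)).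
  case: (v < 0)%R; rewrite ?andbT ?andbF; last by rewrite jacobi1l.
  rewrite expr1 jacobiN1 //; congr (_ ^+ _).
  by move: en; rewrite eq; case: (s); rewrite ?expr0 ?expr1; case: eqP => //=; lia.
(* Modulo [v1], [n] is [(-1) ^ s * w ^ 2], and the reciprocity sign is the symbol of [(-1) ^ s]
   modulo [v1]; the two signs cancel. *)
have E2 : jacobi v1 n = 1.
  rewrite jacobi_reciprocity //.
  have -> : recsign v1 n = jacobi ((-1) ^+ s) v1.
    rewrite /recsign; move: en; rewrite eq; case: (s) => en.
      rewrite expr1 jacobiN1 //; congr (_ ^+ (nat_of_bool _)).
      have -> : (n %% 4 = 3)%N by rewrite expr1 in en; lia.
      by rewrite andbT.
    have -> : (n %% 4 = 1)%N by rewrite expr0 in en; lia.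
    by rewrite andbF jacobi1l.
  rewrite -jacobiMl // -[RHS](jacobi_sqrl ov1 cwv1) //.
  symmetry; apply: (@jacobi_mod_sub _ _ (w * b * ((-1) ^+ (v < 0)%R * 2 ^+ j))).
  by rewrite nE // {1}vE; ring.
(* If [j >= 2], then 8 divides [b v] and [n] is 1 or -1 modulo 8. If [j = 1], then [w v] is 2 modulo
   4, so [n] is [1 - 2 b] up to sign modulo 8, which is 3 or 5 exactly when [b] is 2 modulo 4. *)
have E3 : jacobi 2 n ^+ j = (-1) ^+ ((b %% 4 == 2)%Z && (v %% 4 == 2)%Z).
  have v1o : exists t, v1%:Z = 2 * t + 1 by exists (v1./2)%:Z; lia.
  rewrite jacobi2 //.
  case: j j0 ej vE {jX E1 E2} => // -[|j] _ ej vE.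
    rewrite expr1; congr (_ ^+ _).
    have -> : (v %% 4 == 2)%Z by move: ej; rewrite expn1; lia.
    rewrite andbT.
    have [t et] : exists t, w * v = 2 + 4 * t.
      have [t1 e1] : exists t1, v = 2 + 4 * t1 by exists (v %/ 4)%Z; move: ej; rewrite expn1; lia.
      by exists (w * t1 + w1); rewrite e1 ew1; ring.
    have [r er] : exists r, w ^+ 2 = 1 + 8 * r.
      exists ((w1 * (w1 + 1)) %/ 2)%Z.
      have : (2 %| w1 * (w1 + 1))%Z.
        by have /orP [/dvdz_mulr ->|/dvdz_mull ->] : (2 %| w1)%Z || (2 %| w1 + 1)%Z by lia.
      by move=> /dvdzP [z ez]; rewrite ez mulzK // ew1; nia.
    have en2 : n%:Z = (-1) ^+ s * (1 + 8 * r - 2 * b - 8 * b1 * t).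
      rewrite en -er; congr (_ * _).
      have -> : w * (w - b * v) = w ^+ 2 - b * (w * v) by ring.
      by rewrite et eb1; ring.
    set bt := b1 * t; have ebt : b1 * t = bt by [].
    rewrite -mulrA ebt in en2.
    by case: (s) en2; rewrite ?expr0 ?expr1; lia.
  have -> : (v %% 4 == 2)%Z = false.
    have : (4 %| v)%Z.
      by rewrite vE !exprS; apply/dvdzP; exists ((-1) ^+ (v < 0)%R * 2 ^+ j * v1%:Z); ring.
    by lia.
  rewrite andbF expr0.
  suff -> : ((n %% 8 == 3) || (n %% 8 == 5))%N = false by rewrite expr1n.
  have [z ez] : exists z, v = 4 * z.
    by exists ((-1) ^+ (v < 0)%R * 2 ^+ j * v1%:Z); rewrite {1}vE !exprS; ring.
  have [r er] : exists r, w ^+ 2 = 1 + 8 * r.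
      exists ((w1 * (w1 + 1)) %/ 2)%Z.
      have : (2 %| w1 * (w1 + 1))%Z.
        by have /orP [/dvdz_mulr ->|/dvdz_mull ->] : (2 %| w1)%Z || (2 %| w1 + 1)%Z by lia.
      by move=> /dvdzP [z' ez']; rewrite ez' mulzK // ew1; nia.
  have : n%:Z = (-1) ^+ s * (1 + 8 * (r - w * b1 * z)).
    by rewrite en (_ : w * _ = w ^+ 2 - w * b * v); [rewrite er eb1 ez|]; ring.
  by case: (s); rewrite ?expr0 ?expr1; move: (r - _) => zz; lia.
by rewrite {1}vE !jacobiMl // E1 E2 jX E3 mulr1 -exprD.
Qed.

Lemma coprime_absP (a b : int) : reflect (forall p, prime p -> (p%:Z %| a)%Z -> (p%:Z %| b)%Z -> False)
  (coprime `|a| `|b|).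
Proof.
apply: (iffP idP) => [c p pp pa pb|h].
  have : (p %| gcdn `|a| `|b|)%N by rewrite dvdn_gcd; move: pa pb; rewrite !dvdzE /= => -> ->.
  by rewrite (eqP c) dvdn1 => /eqP p1; rewrite p1 in pp.
rewrite /coprime; apply/negPn/negP => g1.
have [g0|g0] := posnP (gcdn `|a| `|b|).
  have := gcdn_gt0 `|a| `|b|; rewrite g0 /= => /esym/negbT.
  rewrite negb_or -!leqNgt !leqn0 !absz_eq0 => /andP [/eqP a0 /eqP b0].
  by apply: (h 2%N); rewrite // ?a0 ?b0.
have pp : prime (pdiv (gcdn `|a| `|b|)) by apply: pdiv_prime; lia.
have := pdiv_dvd (gcdn `|a| `|b|); rewrite dvdn_gcd => /andP [pa pb].
by apply: (h _ pp); rewrite dvdzE.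
Qed.

Lemma jacobi_eq0_prime (a : int) (n p : nat) : (0 < n)%N -> prime p ->
  (p%:Z %| a)%Z -> (p %| n)%N -> jacobi a n = 0.
Proof.
move=> n0 pp pa pn; apply/eqP; rewrite jacobi_eq0 //; apply/negP => c.
by apply: (@coprime_absP a n%:Z c p pp).
Qed.

(** * The symbol of a product of Gaussian integers *)

Lemma odd_mod4_mul (a b : nat) : odd a -> odd b ->
  ((a * b) %% 4 == 3)%N = (a %% 4 == 3)%N (+) (b %% 4 == 3)%N.
Proof.
move=> oa ob; rewrite -modnMm.
have ha : (a %% 4 = 1 \/ a %% 4 = 3)%N by lia.
have hb : (b %% 4 = 1 \/ b %% 4 = 3)%N by lia.
by case: ha => ->; case: hb => ->.
Qed.

Lemma odd_mod4_mulz (a R : nat) (u t : int) : odd a -> odd `|u| ->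
  R%:Z = a%:Z * u + 4 * t -> (R %% 4 == 3)%N = (a %% 4 == 3)%N (+) (u %% 4 == 3)%Z.
Proof.
move=> oa ou eR.
have [k [r [ea -> hr]]] : exists k r, [/\ a%:Z = 4 * k + r%:Z, (a %% 4)%N = r & r = 1%N \/ r = 3%N].
  by exists (a %/ 4)%N%:Z, (a %% 4)%N; split; lia.
have [l [q [eu -> hq]]] : exists l q, [/\ u = 4 * l + q%:Z, (u %% 4)%Z = q & q = 1%N \/ q = 3%N].
  by exists (u %/ 4)%Z, `|(u %% 4)%Z|%N; split; lia.
have : R%:Z = 4 * (4 * k * l + r%:Z * l + k * q%:Z + t) + r%:Z * q%:Z.
  by rewrite eR ea eu; ring.
move: (_ + t) => w; clear -hr hq.
by case: hr => ->; case: hq => -> /=; lia.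
Qed.

(* [gcd (u, v) = 1] and [gcd (a, b) = 1]; the common factor [g] of [a] and [v] is split off,
   since only [a / g] is invertible modulo [(a * u - b * v) / g]. *)
Lemma spin_mul_coprime (g a b v : nat) (sb sv : bool) (u : int) (R : nat) :
  let bb : int := (-1) ^+ sb * b%:Z in
  let vv : int := (-1) ^+ sv * v%:Z in
  odd g -> odd a -> ~~ odd b -> odd `|u| -> ~~ odd v -> (0 < v)%N ->
  coprime (g * a) b -> coprime `|u| (g * v) -> coprime a v ->
  R%:Z = a%:Z * u - bb * vv ->
  jacobi (g%:Z ^+ 2 * a%:Z * vv + bb * u) (g * R) =
  jacobi bb (g * a) * jacobi (g%:Z * vv) `|u| *
    jacobi (g * R) ((g * a) ^ 2 + b ^ 2) *
  (-1) ^+ (((g * a) %% 4 == 3)%N && (u %% 4 == 3)%Z) *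
  (-1) ^+ (((u < 0) && (vv < 0)) + ((bb %% 4 == 2)%Z && (vv %% 4 == 2)%Z)).
Proof.
move=> bb vv og oa eb ou ev v0 cgab cugv cav eR.
have g0 : (0 < g)%N by lia.
have a0 : (0 < a)%N by lia.
have absb : `|bb|%N = b by rewrite /bb abszMsign absz_nat.
have absv : `|vv|%N = v by rewrite /vv abszMsign absz_nat.
have e2b : (2 %| bb)%Z by rewrite -absb in eb; lia.
have e2v : (2 %| vv)%Z by rewrite -absv in ev; lia.
have /dvdzP [b1 eb1] := e2b; have /dvdzP [v1 ev1] := e2v.
have R4 : exists t, R%:Z = a%:Z * u + 4 * t.
  by exists (- (b1 * v1)); rewrite eR eb1 ev1; ring.
have [cgb cab] : coprime g b /\ coprime a b by move: cgab; rewrite coprimeMl => /andP.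
have [cug cuv] : coprime `|u| g /\ coprime `|u| v by move: cugv; rewrite coprimeMr => /andP.
have oau : odd `|a%:Z * u| by rewrite abszM oddM oa ou.
have oR : odd R by case: R4 => t et; lia.
have R0 : (0 < R)%N by lia.
set m := ((g * a) ^ 2 + b ^ 2)%N.
have mE : m%:Z = (g%:Z * a%:Z) ^+ 2 + bb ^+ 2.
  have -> : bb ^+ 2 = b%:Z ^+ 2 by rewrite /bb exprMn sqrr_sign mul1r.
  by rewrite /m -!mulnn PoszD !PoszM; ring.
have om : odd m by rewrite /m oddD !oddX /= oddM og oa (negbTE eb).
have m0 : (0 < m)%N by lia.
have m1 : (m %% 4 = 1)%N.
  have oga : odd (g * a) by rewrite oddM og oa.
  rewrite /m; move: (g * a)%N oga => ga oga.
  have -> : (ga ^ 2 + b ^ 2 = (ga./2 * ga./2 + ga./2 + b./2 * b./2) * 4 + 1)%N.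
    have e1 : ga = (ga./2 * 2 + 1)%N by clear -oga; lia.
    have e2 : b = (b./2 * 2)%N by clear -eb; lia.
    by rewrite {1}e1 {1}e2 -!mulnn; ring.
  by rewrite modnMDl.
have caR : coprime `|a%:Z| `|R%:Z|.
  apply/coprime_absP => p pp pa; rewrite eR dvdzE /= => pR.
  have : (p%:Z %| bb * vv)%Z.
    have -> : bb * vv = a%:Z * u - (a%:Z * u - bb * vv) by ring.
    by rewrite rpredB ?dvdz_mulr // dvdzE.
  rewrite dvdzE abszM absb absv /= Euclid_dvdM // => /orP [pb|pv].
    by apply: (@coprime_absP a%:Z b%:Z cab p).
  by apply: (@coprime_absP a%:Z v%:Z cav p).
have cwv : coprime `|a%:Z * u| `|vv|.
  by rewrite abszM absv /= coprimeMl cav cuv.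
(* [R] itself need not be near a square, but up to the sign of [u] its product with [N] is
   [(a u) (a u - bb vv)], the shape that [jacobi_near_square] asks for. *)
pose N := (a * `|u|)%N.
have oN : odd N by rewrite /N oddM oa ou.
pose s := (u < 0)%R.
have uE : u = (-1) ^+ s * `|u|%:Z by exact: intEsign.
have K := @jacobi_near_square (R * N) s vv (a%:Z * u) bb _ e2v e2b _ cwv _.
have {K}K : jacobi vv (R * N) =
   (-1) ^+ ((s && (vv < 0)) + ((bb %% 4 == 2)%Z && (vv %% 4 == 2)%Z)).
  apply: K; [by rewrite -absz_gt0 absv|by lia|].
  rewrite /N !PoszM eR {3}uE.
  have : ((-1) ^+ s) ^+ 2 = 1 :> int by rewrite sqrr_sign.
  move: ((-1) ^+ s) => sg hs.
  by transitivity (sg * sg * ((a%:Z * u - bb * vv) * (a%:Z * `|u|%:Z)) ); [rewrite -expr2 hs mul1r|ring].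
have u0 : (0 < `|u|)%N by clear -ou; lia.
rewrite jacobiMr // in K; last by rewrite /N; lia.
rewrite [jacobi vv N]jacobiMr // in K.
set V := jacobi vv R in K; set Va := jacobi vv a in K; set Vu := jacobi vv `|u| in K.
have Va2 : Va ^+ 2 = 1 by rewrite jacobi_sqr // absv coprime_sym.
have Vu2 : Vu ^+ 2 = 1 by rewrite jacobi_sqr // absv coprime_sym.
have VE : V = (-1) ^+ ((s && (vv < 0)) + ((bb %% 4 == 2)%Z && (vv %% 4 == 2)%Z)) * Va * Vu.
  rewrite -K; transitivity (V * (Va ^+ 2) * (Vu ^+ 2)); first by rewrite Va2 Vu2 !mulr1.
  by ring.
have Sg : jacobi (g%:Z ^+ 2 * a%:Z * vv + bb * u) g = jacobi bb g * jacobi u g.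
  rewrite -jacobiMl //; apply: (@jacobi_mod_sub _ _ (g%:Z * a%:Z * vv)); ring.
have aR2 : jacobi a R ^+ 2 = 1 by rewrite jacobi_sqr.
(* Multiplied by [a], the numerator is congruent to [m * vv] modulo [R]. *)
have SR : jacobi (g%:Z ^+ 2 * a%:Z * vv + bb * u) R = jacobi a R * (jacobi m R * V).
  rewrite -[LHS]mul1r -aR2 expr2 -mulrA; congr (_ * _).
  rewrite -!jacobiMl //; apply: (@jacobi_mod_sub _ _ bb); rewrite mE eR; ring.
have aR : jacobi a R = jacobi (-1) a * jacobi bb a * Va * recsign a R.
  rewrite jacobi_reciprocity //; congr (_ * _).
  rewrite -!jacobiMl //; apply: (@jacobi_mod_sub _ _ u); rewrite eR; ring.
have recm n : odd n -> recsign m n = 1 by rewrite /recsign m1.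
have mR : jacobi m R = jacobi R m by rewrite jacobi_reciprocity // recm // mulr1.
have gm : jacobi g m = 1.
  rewrite jacobi_reciprocity // recsignC recm // mulr1.
  rewrite -(@jacobi_sqrl bb g) ?absb //; last by rewrite coprime_sym.
  by apply: (@jacobi_mod_sub _ _ (g%:Z * a%:Z ^+ 2)); rewrite mE; ring.
set U := jacobi `|u| g.
have uU : jacobi u g = jacobi ((-1) ^+ s) g * U by rewrite -jacobiMl // -uE.
have gU : jacobi g `|u| = U * recsign g `|u| by rewrite jacobi_reciprocity.
rewrite jacobiMr // Sg SR aR mR VE uU [jacobi bb (g * a)]jacobiMr //.
rewrite jacobiMl // gU PoszM [jacobi (g%:Z * R%:Z) m]jacobiMl // gm mul1r -/Vu -/s.
have sgn : jacobi ((-1) ^+ s) g * jacobi (-1) a * recsign a R =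
    recsign g `|u| * (-1) ^+ (((g * a) %% 4 == 3)%N && (u %% 4 == 3)%Z).
  have -> : jacobi ((-1) ^+ s) g = (-1) ^+ (s && (g %% 4 == 3)%N).
    by case: (s); rewrite ?expr0 ?jacobi1l // expr1 jacobiN1.
  rewrite jacobiN1 // /recsign odd_mod4_mul //.
  have -> : (R %% 4 == 3)%N = (a %% 4 == 3)%N (+) (u %% 4 == 3)%Z.
    by case: R4 => t; apply: odd_mod4_mulz.
  have -> : (`|u| %% 4 == 3)%N = s (+) (u %% 4 == 3)%Z.
    by rewrite /s; clear -ou; case: ltP; lia.
  by case: (g %% 4 == 3)%N; case: (a %% 4 == 3)%N; case: (u %% 4 == 3)%Z; case: (s).
set k := (-1) ^+ (_ + _).
transitivity (jacobi bb g * U * jacobi bb a * jacobi (R%:Z) m * k * Vu *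
   (jacobi ((-1) ^+ s) g * jacobi (-1) a * recsign a R) * Va ^+ 2); first by ring.
by rewrite sgn Va2; ring.
Qed.

Lemma not_coprime_prime (a b : int) : ~~ coprime `|a| `|b| ->
  exists p, [/\ prime p, (p%:Z %| a)%Z & (p%:Z %| b)%Z].
Proof.
move=> nc; case: (posnP (gcdn `|a| `|b|)) => [g0|g0].
  exists 2%N; have := gcdn_gt0 `|a| `|b|; rewrite g0 /= => /esym/negbT.
  rewrite negb_or -!leqNgt !leqn0 !absz_eq0 => /andP [/eqP -> /eqP ->].
  by rewrite !dvdz0.
have pp : prime (pdiv (gcdn `|a| `|b|)) by apply: pdiv_prime; rewrite /coprime in nc; lia.
have := pdiv_dvd (gcdn `|a| `|b|); rewrite dvdn_gcd => /andP [pa pb].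
by exists (pdiv (gcdn `|a| `|b|)); rewrite !dvdzE.
Qed.

(* The sign by which the symbol of [(a + b i) (u + v i)] differs from the product of the symbols
   of the factors and of the character of [u + v i] modulo [a + b i]. *)
Definition spin_sign (a b u v : int) : int :=
  (-1) ^+ ((a %% 4 == 3)%Z && (u %% 4 == 3)%Z) *
  (-1) ^+ ((b %% 4 == 2)%Z && (v %% 4 == 2)%Z) * (-1) ^+ ((u < 0) && (v < 0)).

(** A prime dividing both [a] and [b], or both [u] and [v], makes both sides vanish. If [v = 0],
    coprimality and positivity force [u = 1]. Otherwise [spin_mul_coprime] applies with [g] the gcd
    of [a] and [v]. *)
Lemma spin_mul (a b u v : int) :
  0 < a -> odd `|a| -> ~~ odd `|b| -> odd `|u| -> ~~ odd `|v| -> 0 < a * u - b * v ->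
  jacobi (a * v + b * u) `|(a * u - b * v)%R| =
  jacobi b `|a| * jacobi v `|u| * jacobi (a * u - b * v) `|(a ^+ 2 + b ^+ 2)%R| *
    spin_sign a b u v.
Proof.
move=> a0 oa eb ou ev R0.
have [cab|/not_coprime_prime [p [pp pa pb]]] := boolP (coprime `|a| `|b|); last first.
  rewrite (@jacobi_eq0_prime _ _ p) //.
  - by rewrite (@jacobi_eq0_prime b _ p) ?mul0r //; lia.
  - by lia.
  - by rewrite rpredD ?dvdz_mulr.
  - by have : (p%:Z %| a * u - b * v)%Z by rewrite rpredB ?dvdz_mulr.
have [cuv|/not_coprime_prime [p [pp pu pv]]] := boolP (coprime `|u| `|v|); last first.
  rewrite (@jacobi_eq0_prime _ _ p) //.
  - by rewrite (@jacobi_eq0_prime v _ p) ?mulr0 ?mul0r //; lia.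
  - by lia.
  - by rewrite rpredD ?dvdz_mull.
  - by have : (p%:Z %| a * u - b * v)%Z by rewrite rpredB ?dvdz_mull.
have [v0|v0] := eqVneq v 0.
  have u1 : u = 1.
    have : (`|u| = 1)%N by move: cuv; rewrite v0 /coprime absz0 gcdn0 => /eqP.
    by move=> h; move: R0; rewrite v0 mulr0 subr0; nia.
  have s1 : spin_sign a b 1 0 = 1 by rewrite /spin_sign ltxx !andbF.
  rewrite v0 u1 s1 !(mulr0, mulr1, subr0, add0r) jacobi1 mulr1; suff -> : jacobi a `|(a ^+ 2 + b ^+ 2)%R| = 1 by rewrite mulr1.
  have aE : `|a|%N%:Z = a by lia.
  have [k ek] : exists k, b = 2 * k by exists (b %/ 2)%Z; lia.
  have [l el] : exists l, a = 2 * l + 1 by exists (a %/ 2)%Z; lia.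
  have m4 : exists t, a ^+ 2 + b ^+ 2 = 4 * t + 1.
    by exists (l ^+ 2 + l + k ^+ 2); rewrite ek el; ring.
  have m0 : 0 <= a ^+ 2 + b ^+ 2 by rewrite addr_ge0 ?sqr_ge0.
  have om : odd `|(a ^+ 2 + b ^+ 2)%R| by case: m4 => t; lia.
  rewrite -{1}aE jacobi_reciprocity // /recsign.
  have -> : (`|(a ^+ 2 + b ^+ 2)%R| %% 4 = 1)%N by case: m4 => t; lia.
  rewrite andbF mulr1; transitivity (jacobi (b ^+ 2) `|a|); last first.
    by apply: jacobi_sqrl; rewrite // coprime_sym.
  apply: (@jacobi_mod_sub _ _ a); rewrite aE gez0_abs //; ring.
have vv0 : (0 < `|v|)%N by lia.
have aa0 : (0 < `|a|)%N by lia.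
pose g := gcdn `|a| `|v|.
have g0 : (0 < g)%N by rewrite gcdn_gt0 aa0.
have [a' ea] : exists a', `|a|%N = (g * a')%N.
  by have /dvdnP [k ->] := dvdn_gcdl `|a| `|v|; exists k; rewrite mulnC.
have [v' ev'] : exists v', `|v|%N = (g * v')%N.
  by have /dvdnP [k ->] := dvdn_gcdr `|a| `|v|; exists k; rewrite mulnC.
have cav : coprime a' v'.
  by rewrite /coprime -(eqn_pmul2l g0) muln_gcdr -ea -ev' muln1.
have aE : a = g%:Z * a'%:Z by rewrite -PoszM -ea; lia.
have vE : v = g%:Z * ((-1) ^+ (v < 0)%R * v'%:Z).
  rewrite mulrCA -PoszM -ev'; exact: intEsign.
have bE : b = (-1) ^+ (b < 0)%R * `|b|%N%:Z by exact: intEsign.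
have [og oa'] : odd g /\ odd a' by move: oa; rewrite ea oddM => /andP.
have ev2 : ~~ odd v' by move: ev; rewrite ev' oddM og.
pose R := `|(a'%:Z * u - b * ((-1) ^+ (v < 0)%R * v'%:Z))%R|%N.
have RE : a * u - b * v = g%:Z * (a'%:Z * u - b * ((-1) ^+ (v < 0)%R * v'%:Z)).
  by rewrite {1}aE {1}vE; ring.
have R'0 : 0 < a'%:Z * u - b * ((-1) ^+ (v < 0)%R * v'%:Z).
  by move: R0; rewrite RE pmulr_rgt0 // ltz_nat.
have RE' : R%:Z = a'%:Z * u - b * ((-1) ^+ (v < 0)%R * v'%:Z) by rewrite /R; lia.
have := @spin_mul_coprime g a' `|b| v' (b < 0) (v < 0) u R og oa' eb ou ev2.
rewrite -bE -ea -ev' => /(_ _ cab cuv cav RE').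
have absR : `|(a * u - b * v)%R|%N = (g * R)%N by rewrite RE abszM.
have -> : (`|a| ^ 2 + `|b| ^ 2 = `|(a ^+ 2 + b ^+ 2)%R|)%N.
  rewrite -!abszX; have := sqr_ge0 a; have := sqr_ge0 b.
  by move: (a ^+ 2) (b ^+ 2) => x y; lia.
rewrite absR -PoszM => h; rewrite (_ : a * v + b * u =
   g%:Z ^+ 2 * a'%:Z * ((-1) ^+ (v < 0)%R * v'%:Z) + b * u); last first.
  by rewrite {1}aE {1}vE; ring.
rewrite h; last by lia.
rewrite -vE RE -RE' -PoszM -!mulrA; do 3 congr (_ * _).
rewrite /spin_sign -mulrA exprD [in RHS]mulrC -!mulrA.
have -> : (`|a| %% 4 == 3)%N = (a %% 4 == 3)%Z by clear -a0; lia.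
set v1 := (-1) ^+ (v < 0)%R * v'%:Z in vE *.
have gp : 0 < g%:Z by rewrite ltz_nat.
have -> : (v < 0) = (v1 < 0) by rewrite {1}vE (pmulr_rlt0 _ gp).
have e2v : (2 %| v1)%Z.
  rewrite /v1 dvdz_mull // dvdzE; clear -ev2; lia.
have -> : (v1 %% 4 == 2)%Z = (v %% 4 == 2)%Z.
  have [t et] : exists t, v1 = 2 * t by exists (v1 %/ 2)%Z; clear -e2v; lia.
  have [t' et'] : exists t, g%:Z = 2 * t + 1 by exists (g./2)%:Z; clear -og; lia.
  have : v = 4 * (t' * t) + v1 by rewrite {1}vE et' et; ring.
  by move: (t' * t) => tt; clear -e2v; lia.
set x := (-1) ^+ _; set y := (-1) ^+ _; set z := (-1) ^+ (_ && _).
by move: x y z => x y z; rewrite (mulrCA z) (mulrC z) mulrCA.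
Qed.

(** * Gaussian integers *)
Notation gint := (int * int)%type.

Definition gmul (z w : gint) : gint := (z.1 * w.1 - z.2 * w.2, z.1 * w.2 + z.2 * w.1).
Definition gabs2 (z : gint) : nat := `|(z.1 ^+ 2 + z.2 ^+ 2)%R|%N.
Definition gprim (z : gint) : bool := coprime `|z.1| `|z.2|.
(* Every Gaussian integer of odd norm has exactly one associate of this shape. *)
Definition gnormal (z : gint) : bool := [&& 0 < z.1, odd `|z.1| & ~~ odd `|z.2|].

Lemma gabs2E z : (gabs2 z)%:Z = z.1 ^+ 2 + z.2 ^+ 2.
Proof. by rewrite /gabs2 gez0_abs // addr_ge0 ?sqr_ge0. Qed.

Lemma gabs2M z w : gabs2 (gmul z w) = (gabs2 z * gabs2 w)%N.
Proof. by apply/eqP; rewrite -eqz_nat PoszM !gabs2E /=; apply/eqP; ring. Qed.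

Lemma gmulC z w : gmul z w = gmul w z.
Proof. by rewrite /gmul; congr pair; ring. Qed.

Lemma gprimP z : reflect (forall p, prime p -> (p%:Z %| z.1)%Z -> (p%:Z %| z.2)%Z -> False)
  (gprim z).
Proof. exact: coprime_absP. Qed.

Lemma gprimMl z w : gprim (gmul z w) -> gprim z.
Proof.
move=> /gprimP h; apply/gprimP => p pp p1 p2; apply: (h p pp) => /=.
  by rewrite rpredB ?dvdz_mulr.
by rewrite rpredD ?dvdz_mulr.
Qed.

Lemma gprimMr z w : gprim (gmul z w) -> gprim w.
Proof. by rewrite gmulC; apply: gprimMl. Qed.

Lemma gprim_gabs2_gt0 z : gprim z -> (0 < gabs2 z)%N.
Proof.
move=> /gprimP h; rewrite lt0n; apply/eqP => n0.
have := gabs2E z; rewrite n0 => /esym /eqP; rewrite paddr_eq0 ?sqr_ge0 // !sqrf_eq0.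
by move=> /andP [/eqP h1 /eqP h2]; apply: (h 2%N); rewrite // ?h1 ?h2.
Qed.

Lemma gprim_prime_dvd1 z p : gprim z -> prime p -> (p %| gabs2 z)%N -> ~~ (p%:Z %| z.1)%Z.
Proof.
move=> /gprimP h pp pn; apply/negP => p1; apply: (h p pp p1).
have : (p%:Z %| z.2 ^+ 2)%Z.
  have -> : z.2 ^+ 2 = (gabs2 z)%:Z - z.1 * z.1 by rewrite gabs2E; ring.
  by rewrite rpredB ?dvdz_mulr // dvdzE.
by rewrite !dvdzE abszX /= Euclid_dvdX // andbT.
Qed.

Lemma gprim_coprime_gabs2 z : gprim z -> coprime `|z.1| (gabs2 z).
Proof.
move=> h; apply/negPn/negP => /(@not_coprime_prime z.1 (gabs2 z)) [p [pp p1 pn]].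
by rewrite dvdzE /= in pn; have := gprim_prime_dvd1 h pp pn; rewrite p1.
Qed.

Lemma dvdz_lincomb (d a b x y : int) : (d %| x)%Z -> (d %| y)%Z -> (d %| a * x + b * y)%Z.
Proof. by move=> hx hy; rewrite rpredD ?dvdz_mull. Qed.

(** Fermat's descent. The two divisibilities say that [m] divides [(R + S i) (a - b i)], that is,
    that [a + b i], of norm [m], divides [R + S i]. *)
Lemma gauss_descent (m : nat) (R S : int) : (0 < m)%N ->
  (forall p, prime p -> (p %| m)%N -> (p%:Z %| R)%Z -> (p%:Z %| S)%Z -> False) ->
  (m%:Z %| R ^+ 2 + S ^+ 2)%Z ->
  exists a b : int, [/\ a ^+ 2 + b ^+ 2 = m%:Z, (m%:Z %| R * a + S * b)%Z
    & (m%:Z %| S * a - R * b)%Z].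
Proof.
elim/ltn_ind: m R S => m IH R S m0 hc hm.
have [m1|m1] := eqVneq m 1%N.
  by exists 1, 0; rewrite m1 !dvd1z; split=> //; ring.
(* Residues of least absolute value give [R1 ^ 2 + S1 ^ 2 <= m ^ 2 / 2], so the cofactor [m2] to
   which the induction applies is at most [m / 2]. *)
pose red (x : int) := let r := (x %% m%:Z)%Z in if (2 * r <= m%:Z)%R then r else r - m%:Z.
have redP x : exists k, x = red x + m%:Z * k.
  rewrite /red; have := divz_eq x m%:Z; move: (x %/ m%:Z)%Z (x %% m%:Z)%Z => q r e.
  by case: ifP => _; [exists q|exists (q + 1)]; rewrite e; ring.
have redB x : 4 * (red x) ^+ 2 <= m%:Z ^+ 2.
  have m0' : m%:Z != 0 by lia.
  have := modz_ge0 x m0'; have := ltz_mod x m0'.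
  by rewrite /red; move: (x %% m%:Z)%Z => r; case: ifP; nia.
have [k ek] := redP R; have [l el] := redP S.
have := redB R; have := redB S; move: (red R) (red S) ek el => R1 S1 ek el bS bR.
have : (m%:Z %| R1 ^+ 2 + S1 ^+ 2)%Z.
  have -> : R1 ^+ 2 + S1 ^+ 2 = (R ^+ 2 + S ^+ 2) - m%:Z * (k * (R + R1) + l * (S + S1)).
    by rewrite ek el; ring.
  by rewrite rpredB ?dvdz_mulr.
case/dvdzP => m1' em1.
have sq0 : 0 <= R1 ^+ 2 + S1 ^+ 2 by rewrite addr_ge0 ?sqr_ge0.
pose g := gcdn `|R1| `|S1|.
have cgm : coprime g m.
  apply/negPn/negP => /(@not_coprime_prime g m) [p [pp pg pm]].
  apply: (hc p pp); first by move: pm; rewrite dvdzE.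
    rewrite ek rpredD ?dvdz_mulr // dvdzE; apply: dvdn_trans (dvdn_gcdl _ `|S1|).
    by move: pg; rewrite dvdzE.
  rewrite el rpredD ?dvdz_mulr // dvdzE; apply: dvdn_trans (dvdn_gcdr `|R1| _).
  by move: pg; rewrite dvdzE.
have g0 : (0 < g)%N.
  rewrite lt0n; apply/eqP => g0; move: cgm; rewrite g0 /coprime gcd0n.
  by move=> /eqP; lia.
have [R2 eR2] : exists R2, R1 = R2 * g%:Z.
  by apply/dvdzP; rewrite dvdzE dvdn_gcdl.
have [S2 eS2] : exists S2, S1 = S2 * g%:Z.
  by apply/dvdzP; rewrite dvdzE dvdn_gcdr.
have cRS : coprime `|R2| `|S2|.
  have : (g * gcdn `|R2| `|S2| = g * 1)%N.
    rewrite muln_gcdr muln1; transitivity (gcdn `|R1| `|S1|); last by [].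
    by rewrite eR2 eS2 !abszM !absz_nat ![(_ * g)%N]mulnC.
  by move/eqP; rewrite eqn_pmul2l.
have : (m%:Z %| R2 ^+ 2 + S2 ^+ 2)%Z.
  have : (m%:Z %| (R2 ^+ 2 + S2 ^+ 2) * (g%:Z * g%:Z))%Z.
    by apply/dvdzP; exists m1'; rewrite -em1 eR2 eS2; ring.
  rewrite dvdzE [in X in is_true X -> _]abszM Gauss_dvdl ?dvdzE //.
  by rewrite abszM /= coprimeMr coprime_sym cgm.
case/dvdzP => m2 em2.
have sq2 : 0 < R2 ^+ 2 + S2 ^+ 2.
  have := @gprim_gabs2_gt0 (R2, S2) cRS.
  by rewrite -ltz_nat gabs2E.
have m2_gt0 : 0 < m2 by move: sq2; rewrite em2 pmulr_lgt0 // ltz_nat.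
have m2_lt : m2 < m%:Z.
  have mp : 0 < m%:Z by rewrite ltz_nat.
  have h : m2 <= m1'.
    rewrite -(ler_pM2r mp) -em1 -em2 eR2 eS2 !exprMn -mulrDl ler_peMr ?(ltW sq2) //.
    by apply: exprn_ege1; rewrite lez_nat.
  have h2 : 2 * m1' <= m%:Z.
    rewrite -(ler_pM2r mp) -mulrA -em1 -expr2; move: bS bR.
    by move: (R1 ^+ 2) (S1 ^+ 2) (m%:Z ^+ 2) => x y w; clear; lia.
  by clear -h h2 m2_gt0; lia.
have m2E : `|m2|%N%:Z = m2 by clear -m2_gt0; lia.
have hlt : (`|m2| < m)%N by rewrite -ltz_nat m2E.
have hpos : (0 < `|m2|)%N by rewrite -ltz_nat m2E.
have hdiv : (`|m2|%N%:Z %| R2 ^+ 2 + S2 ^+ 2)%Z by rewrite em2 m2E dvdz_mulr.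
have [a [b []]] := IH _ hlt R2 S2 hpos (fun p pp _ => coprime_absP _ _ cRS p pp) hdiv.
rewrite m2E => eab; case/dvdzP => c ec; case/dvdzP => e ee.
have m2n : m2 != 0 by lia.
(* [c + e i] is the quotient of [R2 + S2 i], of norm [m * m2], by its divisor [a + b i] of norm
   [m2]. *)
exists c, e; split.
- apply: (mulIf m2n); apply: (mulIf m2n).
  transitivity ((c * m2) ^+ 2 + (e * m2) ^+ 2); first by ring.
  rewrite -ec -ee; transitivity ((R2 ^+ 2 + S2 ^+ 2) * (a ^+ 2 + b ^+ 2)); first by ring.
  by rewrite em2 eab; ring.
- apply/dvdzP; exists (a * g%:Z + k * c + l * e); apply: (mulIf m2n).
  have -> : (R * c + S * e) * m2 = R * (c * m2) + S * (e * m2) by ring.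
  rewrite -ec -ee ek el eR2 eS2.
  transitivity (g%:Z * a * (R2 ^+ 2 + S2 ^+ 2) + m%:Z * (k * (R2 * a + S2 * b) + l * (S2 * a - R2 * b))); first by ring.
  by rewrite em2 ec ee; ring.
apply/dvdzP; exists (b * g%:Z + l * c - k * e); apply: (mulIf m2n).
have -> : (S * c - R * e) * m2 = S * (c * m2) - R * (e * m2) by ring.
rewrite -ec -ee ek el eR2 eS2.
transitivity (g%:Z * b * (R2 ^+ 2 + S2 ^+ 2) + m%:Z * (l * (R2 * a + S2 * b) - k * (S2 * a - R2 * b))); first by ring.
by rewrite em2 ec ee; ring.
Qed.

Lemma odd_abszD (x y : int) : odd `|(x + y)%R| = odd `|x| (+) odd `|y|.
Proof. by lia. Qed.

(** Descent gives a factor of norm [m]. As [m] is odd, exactly one of its coordinates is odd, and a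
    unit moves that coordinate to the first place and makes it positive. *)
Lemma gfactor_exists (t : gint) (m n : nat) : gprim t -> gabs2 t = (m * n)%N ->
  odd m ->
  exists z w, [/\ gnormal z, gabs2 z = m, gabs2 w = n & gmul z w = t].
Proof.
move=> pt nt om; have n0 := gprim_gabs2_gt0 pt.
have m0 : (0 < m)%N by move: n0; rewrite nt muln_gt0 => /andP [].
have [|a0 [b0 [e0 d1 d2]]] := @gauss_descent m t.1 t.2 m0 (fun p pp _ => gprimP _ pt p pp).
  by rewrite -gabs2E nt PoszM dvdz_mulr.
have [a [b [ea oa eb d3 d4]]] : exists a b : int,
   [/\ a ^+ 2 + b ^+ 2 = m%:Z, odd `|a|, ~~ odd `|b|,
     (m%:Z %| t.1 * a + t.2 * b)%Z & (m%:Z %| t.2 * a - t.1 * b)%Z].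
  have par : odd `|a0| (+) odd `|b0|.
    have : odd `|(a0 ^+ 2 + b0 ^+ 2)%R| by rewrite e0.
    by rewrite odd_abszD !abszX !oddX.
  case: (boolP (odd `|a0|)) par => oa ob; first by exists a0, b0; split.
  exists b0, (- a0); split.
  - by rewrite sqrrN addrC.
  - by [].
  - by rewrite abszN.
  - by rewrite (_ : _ + _ = - (t.2 * a0 - t.1 * b0)) ?rpredN //; ring.
  - by rewrite (_ : _ - _ = t.1 * a0 + t.2 * b0) //; ring.
pose s : int := (-1) ^+ (a < 0)%R.
have s2 : s ^+ 2 = 1 by rewrite sqrr_sign.
have aN0 : a != 0 by case: eqP oa => // ->.
case/dvdzP: d3 => u eu; case/dvdzP: d4 => v ev.
have mn0 : m%:Z != 0 by lia.
have tE : gmul (a, b) (u, v) = t.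
  rewrite [RHS]surjective_pairing /gmul /=; congr pair; apply: (mulIf mn0).
    transitivity (a * (u * m%:Z) - b * (v * m%:Z)); first by ring.
    by rewrite -eu -ev -ea; ring.
  transitivity (a * (v * m%:Z) + b * (u * m%:Z)); first by ring.
  by rewrite -eu -ev -ea; ring.
have nz : gabs2 (s * a, s * b) = m.
  by apply/eqP; rewrite -eqz_nat gabs2E /= !exprMn s2 !mul1r ea.
exists (s * a, s * b), (s * u, s * v); split=> //.
- rewrite /gnormal /= !abszMsign oa eb !andbT /s -normrEsign.
  by rewrite normr_gt0.
- apply/eqP; rewrite -(eqn_pmul2l m0) -nt -tE -{1}nz -gabs2M; apply/eqP; congr gabs2.
  rewrite /gmul /=; congr pair.
    by transitivity (s ^+ 2 * (a * u - b * v)); [ring | rewrite s2 mul1r].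
  by transitivity (s ^+ 2 * (a * v + b * u)); [ring | rewrite s2 mul1r].
rewrite -tE /gmul /=; congr pair.
  by transitivity (s ^+ 2 * (a * u - b * v)); [ring | rewrite s2 mul1r].
by transitivity (s ^+ 2 * (a * v + b * u)); [ring | rewrite s2 mul1r].
Qed.

(* Two primitive normalized Gaussian integers of norm [m] generate the same ideal as soon as
   [m] divides the determinant, since the determinant is even and at most [m]. *)
Lemma gnormal_eq (z z' : gint) : gnormal z -> gnormal z' -> gabs2 z = gabs2 z' ->
  odd (gabs2 z) -> ((gabs2 z)%:Z %| z.1 * z'.2 - z'.1 * z.2)%Z -> z = z'.
Proof.
case: z z' => a b [a' b'] /and3P [/= a0 oa eb] /and3P [/= a0' oa' eb'] en on.
case/dvdzP => k ek.
have e1 := gabs2E (a, b); have e2 := gabs2E (a', b'); rewrite -en /= in e2.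
move: (gabs2 _) on e1 e2 ek => m om /= e1 e2 ek.
have E : (k * m%:Z) ^+ 2 + (a * a' + b * b') ^+ 2 = m%:Z ^+ 2.
  transitivity ((a ^+ 2 + b ^+ 2) * (a' ^+ 2 + b' ^+ 2)); first by rewrite -ek; ring.
  by rewrite -e1 -e2 expr2.
have mp : 0 < m%:Z by clear -om; lia.
have k0 : k = 0.
  have : (2 %| k * m%:Z)%Z.
    by rewrite -ek rpredB // ?dvdz_mull // dvdzE /=; lia.
  rewrite dvdzE abszM /= dvdn2 oddM om andbT => ek2.
  have : k ^+ 2 <= 1.
    rewrite -(ler_pM2r (x := m%:Z ^+ 2)); last by rewrite exprn_gt0.
    rewrite mul1r -exprMn -E lerDl sqr_ge0 //.
  by clear -ek2; nia.
rewrite k0 mul0r in ek E.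
have aa0 : 0 < a * a' by rewrite mulr_gt0.
have det : a * b' = a' * b by apply/eqP; rewrite -subr_eq0 ek.
have [c ec] : exists c, a * a' + b * b' = c * m%:Z /\ (c = 1 \/ c = -1).
  have : (a * a' + b * b' - m%:Z) * (a * a' + b * b' + m%:Z) = 0.
    by rewrite -subr_sqr -E; ring.
  move/eqP; rewrite mulf_eq0 => /orP [/eqP h|/eqP h].
    by exists 1; split; [lra|left].
  by exists (-1); split; [lra|right].
have m0 : m%:Z != 0 by rewrite gt_eqF.
have h1 : a' = c * a.
  apply: (mulIf m0); rewrite {1}e1; transitivity (a * (a * a' + b * b')).
    by transitivity (a * a * a' + b * (a' * b)); [ring | rewrite -det; ring].
  by case: ec => -> _; ring.
have h2 : b' = c * b.
  apply: (mulIf m0); rewrite {1}e1; transitivity (b * (a * a' + b * b')).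
    by transitivity (a * (a * b') + b * b * b'); [ring | rewrite det; ring].
  by case: ec => -> _; ring.
case: ec => _ [c1|c1]; first by rewrite h1 h2 c1 !mul1r.
by move: a0'; rewrite h1 c1; clear -a0; lia.
Qed.

Lemma gfactor_dvd (z w t : gint) : gmul z w = t ->
  ((gabs2 z)%:Z %| t.2 * z.1 - t.1 * z.2)%Z.
Proof. by move=> <-; apply/dvdzP; exists w.2; rewrite gabs2E /=; ring. Qed.

(** Eliminating [t.2] from the two congruences shows that the norm divides [t.1] times the
    determinant of [z] and [z']; since [t] is primitive, [t.1] is invertible modulo the norm. *)
Lemma lattice_uniq z z' t : gnormal z -> gnormal z' -> gprim t -> odd (gabs2 z) ->
  gabs2 z = gabs2 z' -> (gabs2 z %| gabs2 t)%N ->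
  ((gabs2 z)%:Z %| t.2 * z.1 - t.1 * z.2)%Z -> ((gabs2 z)%:Z %| t.2 * z'.1 - t.1 * z'.2)%Z -> z = z'.
Proof.
move=> nz nz' pt on en dt d1 d2; apply: gnormal_eq => //.
set D := z.1 * z'.2 - z'.1 * z.2.
have h1 : ((gabs2 z)%:Z %| t.1 * D)%Z.
  have -> : t.1 * D = z'.1 * (t.2 * z.1 - t.1 * z.2) + (- z.1) * (t.2 * z'.1 - t.1 * z'.2).
    by rewrite /D; ring.
  exact: dvdz_lincomb.
rewrite dvdzE abszM Gauss_dvdr // in h1.
by rewrite coprime_sym; apply: (coprime_dvdr dt); apply: gprim_coprime_gabs2.
Qed.

Lemma gfactor_uniq (z z' w w' t : gint) : gnormal z -> gnormal z' -> gprim t ->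
  gabs2 z = gabs2 z' -> odd (gabs2 z) -> gmul z w = t -> gmul z' w' = t -> z = z'.
Proof.
move=> nz nz' pt en on e1 e2; apply: (lattice_uniq nz nz' pt on en).
- by rewrite -e1 gabs2M dvdn_mulr.
- exact: gfactor_dvd e1.
- by rewrite en; apply: gfactor_dvd e2.
Qed.

Lemma gmul_inj (z w w' : gint) : gnormal z -> gmul z w = gmul z w' -> w = w'.
Proof.
move=> /and3P [z0 _ _] [e1 e2]; have n0 : z.1 ^+ 2 + z.2 ^+ 2 != 0.
  by rewrite gt_eqF // ltr_pwDl ?exprn_gt0 ?sqr_ge0.
rewrite [w]surjective_pairing [w']surjective_pairing; congr pair; apply: (mulfI n0).
  transitivity (z.1 * (z.1 * w.1 - z.2 * w.2) + z.2 * (z.1 * w.2 + z.2 * w.1)); first by ring.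
  by rewrite e1 e2; ring.
transitivity (z.1 * (z.1 * w.2 + z.2 * w.1) - z.2 * (z.1 * w.1 - z.2 * w.2)); first by ring.
by rewrite e1 e2; ring.
Qed.

Definition tau (n : nat) : nat := size (divisors n).

Lemma uniq_map_size (T : eqType) (f : T -> nat) (s : seq T) (n : nat) : (0 < n)%N -> uniq s ->
  {in s &, injective f} -> (forall x, x \in s -> f x %| n)%N -> (size s <= tau n)%N.
Proof.
move=> n0 us inj hd; rewrite -(size_map f) /tau; apply: uniq_leq_size.
  by rewrite map_inj_in_uniq.
by move=> _ /mapP [x xs ->]; rewrite -dvdn_divisors // hd.
Qed.

(** By [gfactor_uniq], distinct normalized divisors of a primitive [t] have distinct norms, and
    these divide the norm of [t]. *)
Lemma gfactor_count (s : seq gint) (t : gint) : gprim t -> odd (gabs2 t) -> uniq s ->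
  (forall z, z \in s -> gnormal z /\ exists w, gmul z w = t) -> (size s <= tau (gabs2 t))%N.
Proof.
move=> pt on us h; apply: (uniq_map_size (f := gabs2)) => //.
- exact: gprim_gabs2_gt0.
- move=> z z' /h [nz [w e]] /h [nz' [w' e']] en; apply: (gfactor_uniq _ _ pt en _ e e') => //.
  by move: on; rewrite -e gabs2M oddM => /andP [].
- by move=> z /h [_ [w <-]]; rewrite gabs2M dvdn_mulr.
Qed.

(** Compare with one fixed [z0] of norm [n]. Here [n] divides [d z * d' z], and the gcd [e] of [d z]
    and [n] is coprime to [n / e], so [e] divides [d z] and [n / e] divides [d' z]. By the Chinese
    remainder theorem [e] determines the ratio of the coordinates of [z] modulo [n], hence [z]. *)
Lemma gabs2_count (s : seq gint) (n : nat) : odd n -> uniq s ->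
  (forall z, z \in s -> [/\ gnormal z, gprim z & gabs2 z = n]) -> (size s <= tau n)%N.
Proof.
case: s => [//|z0 s'] on us h; have n0 : (0 < n)%N by lia.
have [nz0 pz0 ez0] := h z0 (mem_head _ _).
set s := z0 :: s' in us h *.
pose d (z : gint) := z.1 * z0.2 - z0.1 * z.2; pose d' (z : gint) := z.1 * z0.2 + z0.1 * z.2.
apply: (uniq_map_size (f := fun z => gcdn `|d z| n)) => //; last by move=> z _; rewrite dvdn_gcdr.
move=> z z' /h [nz pz ez] /h [nz' pz' ez'] /= eg.
apply: gnormal_eq; rewrite ?ez ?ez' //.
have dd x : gabs2 x = n -> (n%:Z %| d x * d' x)%Z.
  move=> ex; have e0 := gabs2E z0; have e1 := gabs2E x; rewrite ez0 in e0; rewrite ex in e1.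
  apply/dvdzP; exists (x.1 ^+ 2 - z0.1 ^+ 2).
  transitivity (x.1 ^+ 2 * (z0.1 ^+ 2 + z0.2 ^+ 2) - z0.1 ^+ 2 * (x.1 ^+ 2 + x.2 ^+ 2)).
    by rewrite /d /d'; ring.
  by rewrite -e0 -e1; ring.
set e := gcdn `|d z| n in eg; set D := z.1 * z'.2 - z'.1 * z.2.
have e_n : (e %| n)%N by rewrite dvdn_gcdr.
have e0 : (0 < e)%N by rewrite gcdn_gt0 n0 orbT.
have [f ef] : exists f, n = (e * f)%N by case/dvdnP: e_n => f ->; exists f; rewrite mulnC.
have codd x p : gabs2 x = n -> gprim x -> prime p -> (p %| n)%N -> ~~ (p %| `|x.1|)%N /\ ~~ (p %| `|x.2|)%N.
  move=> ex px pp pn; split; first by apply: (gprim_prime_dvd1 px pp); rewrite ex.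
  have := @gprim_prime_dvd1 (x.2, x.1) p; rewrite /gprim /= coprime_sym /gabs2 /= addrC.
  by rewrite -/(gabs2 x) ex; apply.
have cef : coprime e f.
  apply/negPn/negP => /(@not_coprime_prime e f) [p [pp]]; rewrite !dvdzE /= => pe pf.
  have pn : (p %| n)%N by rewrite ef dvdn_mulr.
  have pd : (p %| `|d z|)%N by apply: dvdn_trans pe (dvdn_gcdl _ _).
  have pd' : (p %| `|d' z|)%N.
    have hdiv : (e * f %| `|d z| * `|d' z|)%N.
      by have := dd z ez; rewrite dvdzE abszM -ef.
    have eq1 : (`|d z| = e * (`|d z| %/ e))%N by rewrite mulnC divnK // dvdn_gcdl.
    rewrite eq1 -mulnA dvdn_pmul2l // Gauss_dvdr in hdiv.
      exact: dvdn_trans pf hdiv.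
    have : (e * gcdn f (`|d z| %/ e) = e * 1)%N.
      by rewrite muln_gcdr -ef -eq1 gcdnC muln1.
    by move/eqP; rewrite eqn_pmul2l.
  have p2 : ~~ (p %| 2)%N.
    by rewrite dvdn_prime2 //; apply/eqP => p2; move: (odd_dvdn pn on); rewrite p2.
  have : (p%:Z %| 2 * (z.1 * z0.2))%Z.
    have -> : 2 * (z.1 * z0.2) = d z + d' z by rewrite /d /d'; ring.
    by rewrite rpredD // dvdzE.
  rewrite dvdzE !abszM !Euclid_dvdM // (negbTE p2) /=.
  have [/negbTE -> _] := codd z p ez pz pp pn.
  by have [_ /negbTE ->] := codd z0 p ez0 pz0 pp pn.
have cz0 : coprime n `|z0.1| by rewrite coprime_sym -ez0; apply: gprim_coprime_gabs2.
have fd' x : gabs2 x = n -> gcdn `|d x| n = e -> (f%:Z %| d' x)%Z.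
  move=> ex gx; have hdiv : (e * f %| `|d x| * `|d' x|)%N.
    by have := dd x ex; rewrite dvdzE abszM -ef.
  have eq1 : (`|d x| = e * (`|d x| %/ e))%N by rewrite mulnC divnK // -gx dvdn_gcdl.
  rewrite eq1 -mulnA dvdn_pmul2l // Gauss_dvdr in hdiv => //.
  have : (e * gcdn f (`|d x| %/ e) = e * 1)%N.
    by rewrite muln_gcdr -ef -eq1 gcdnC gx muln1.
  by move/eqP; rewrite eqn_pmul2l.
have ed x : gcdn `|d x| n = e -> (e%:Z %| d x)%Z by move=> <-; rewrite dvdzE dvdn_gcdl.
rewrite ef PoszM.
have hz0 : (e%:Z * f%:Z %| z0.1 * D)%Z.
  rewrite dvdzE abszM /= Gauss_dvd //; apply/andP; split.
    have -> : z0.1 * D = z'.1 * d z + (- z.1) * d z' by rewrite /D /d; ring.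
    have := @dvdz_lincomb e%:Z z'.1 (- z.1) (d z) (d z') (ed z erefl) (ed z' (esym eg)).
    by rewrite dvdzE.
  have -> : z0.1 * D = (- z'.1) * d' z + z.1 * d' z' by rewrite /D /d'; ring.
  have := @dvdz_lincomb f%:Z (- z'.1) z.1 (d' z) (d' z') (fd' z ez erefl) (fd' z' ez' (esym eg)).
  by rewrite dvdzE.
by move: hz0; rewrite -PoszM -ef dvdzE abszM Gauss_dvdr.
Qed.

(** * The divisor function *)
Lemma tau_gt0 n : (0 < tau n)%N.
Proof. by rewrite /tau; have := divisor1 n; case: (divisors n). Qed.

(** A divisor of [m n] is recovered from its gcd with [m] and the remaining cofactor, which divides
    [n]. *)
Lemma tauM_leq m n : (0 < m)%N -> (0 < n)%N -> (tau (m * n) <= tau m * tau n)%N.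
Proof.
move=> m0 n0; rewrite /tau.
have mn0 : (0 < m * n)%N by rewrite muln_gt0 m0.
set f := fun d => (gcdn d m, d %/ gcdn d m)%N.
rewrite -(size_allpairs (fun x y => (x, y))) -(size_map f).
apply: uniq_leq_size.
  rewrite map_inj_in_uniq ?divisors_uniq // => d d' _ _ [e1 e2].
  by rewrite -(divnK (dvdn_gcdl d m)) -(divnK (dvdn_gcdl d' m)) e2 e1.
move=> _ /mapP [d dmn ->]; apply: allpairs_f; rewrite -dvdn_divisors ?dvdn_gcdr //.
rewrite -dvdn_divisors // in dmn.
have g0 : (0 < gcdn d m)%N by rewrite gcdn_gt0 m0 orbT.
rewrite -(dvdn_pmul2l g0) mulnC divnK ?dvdn_gcdl //.
have : (d %| gcdn (d * n) (m * n))%N by rewrite dvdn_gcd dvdn_mulr.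
by rewrite -muln_gcdl.
Qed.

Lemma tau_pfactor p e : prime p -> (tau (p ^ e) <= e.+1)%N.
Proof.
move=> pp; rewrite /tau -(size_iota 0 e.+1) -(size_map (fun i => p ^ i)%N (iota _ _)).
apply: uniq_leq_size; first exact: divisors_uniq.
move=> d; rewrite -dvdn_divisors ?expn_gt0 ?prime_gt0 // => /(dvdn_pfactor _ _ pp) [i hi ->].
by apply: map_f; rewrite mem_iota.
Qed.

Lemma exp_le_exp2 k e : (e.+1 ^ k <= k ^ k * 2 ^ e)%N.
Proof.
case: k => [|k]; first by rewrite !expn0 mul1n expn_gt0.
have h : (e.+1 <= k.+1 * 2 ^ (e %/ k.+1))%N.
  apply: (@leq_trans (k.+1 * (e %/ k.+1).+1)); last by rewrite leq_mul2l ltn_expl.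
  by rewrite mulnC -ltn_divLR.
apply: (@leq_trans ((k.+1 * 2 ^ (e %/ k.+1)) ^ k.+1)); first by rewrite leq_exp2r.
by rewrite expnMn leq_mul2l -expnM leq_exp2l // leq_trunc_div orbT.
Qed.

(** A prime power [p ^ e] exactly dividing [n] contributes [(e + 1) ^ k]. If [p >= 2 ^ k] this is at
    most [2 ^ (e k) <= p ^ e]; only primes below [2 ^ k] cost a factor [k ^ k]. *)
Lemma tau_exp_bound_primes k n : (0 < n)%N ->
  (tau n ^ k <= (k ^ k) ^ count (fun p => p < 2 ^ k)%N (primes n) * n)%N.
Proof.
elim/ltn_ind: n => n IH n0.
case: (leqP n 1) => n1.
  by have -> : n = 1%N by [lia]; rewrite exp1n.
set c := (k ^ k)%N.
have c0 : (0 < c)%N by rewrite /c; case: (k) => // k'; rewrite expn_gt0.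
have pp := pdiv_prime n1; set p := pdiv n in pp.
have [m pm en] := pfactor_coprime pp n0; set e := logn p n in en.
have m0 : (0 < m)%N by move: n0; rewrite en muln_gt0 => /andP [].
have pe0 : (0 < p ^ e)%N by rewrite expn_gt0 prime_gt0.
have e0 : (0 < e)%N by rewrite logn_gt0 pi_pdiv.
have mn : (m < n)%N by rewrite en ltn_Pmulr // -(exp1n e) ltn_exp2r ?prime_gt1.
have pe : perm_eq (primes n) (p :: primes m).
  apply: uniq_perm; rewrite /= ?primes_uniq //.
    by rewrite andbT mem_primes pp m0 /= -prime_coprime.
  move=> q; rewrite inE en primesM // primesX //.
  by rewrite orbC (primes_prime pp) inE.
rewrite (permP pe) /= {1}en.
apply: (@leq_trans (tau m ^ k * e.+1 ^ k)).
  rewrite -expnMn; case: (k) => // k'; rewrite leq_exp2r //.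
  apply: (leq_trans (tauM_leq m0 pe0)); by rewrite leq_mul2l tau_pfactor // orbT.
apply: (@leq_trans (c ^ count (fun p => p < 2 ^ k)%N (primes m) * m * (c ^ (p < 2 ^ k) * p ^ e))).
  apply: leq_mul; first exact: IH.
  case: ltnP => hp.
    rewrite expn1; apply: (leq_trans (exp_le_exp2 k e)).
    by rewrite leq_mul2l leq_exp2r ?prime_gt1 ?orbT.
  rewrite expn0 mul1n.
  apply: (@leq_trans ((2 ^ e) ^ k)); last by rewrite -expnM mulnC expnM leq_exp2r.
  by case: (k) => // k'; rewrite leq_exp2r // ltn_expl.
rewrite [X in (_ <= _ * X)%N]en expnD; apply: eq_leq.
by move: (c ^ _)%N (c ^ _)%N (p ^ e)%N => x y z; ring.
Qed.

(** Used with [k = 500 g + 1]: as soon as [y >= C], it gives [tau n <= y] for all positive [n] up to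
    [y ^ (500 g)]. *)
Lemma divisor_bound k : exists C, (0 < C)%N /\ forall n, (0 < n)%N -> (tau n ^ k <= C * n)%N.
Proof.
set c := (k ^ k)%N.
have c0 : (0 < c)%N by rewrite /c; case: (k) => // k'; rewrite expn_gt0.
exists (c ^ (2 ^ k))%N; split; first by rewrite expn_gt0 c0.
move=> n n0; apply: (leq_trans (tau_exp_bound_primes k n0)).
rewrite leq_mul2r leq_pexp2l ?orbT // -size_filter -[X in (_ <= X)%N](size_iota 0).
apply: uniq_leq_size; first by rewrite filter_uniq ?primes_uniq.
by move=> p; rewrite mem_filter mem_iota => /andP [].
Qed.

Lemma tau_mul_pfactor m p e : prime p -> coprime p m -> (0 < m)%N -> (0 < e)%N ->
  (2 * tau m <= tau (m * p ^ e))%N.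
Proof.
move=> pp cpm m0 e0; rewrite /tau.
have n0 : (0 < m * p ^ e)%N by rewrite muln_gt0 m0 expn_gt0 prime_gt0.
have -> : (2 * size (divisors m) = size (divisors m ++ [seq p * d | d <- divisors m]))%N.
  by rewrite size_cat size_map mul2n addnn.
apply: uniq_leq_size.
  rewrite cat_uniq divisors_uniq map_inj_uniq ?divisors_uniq ?andbT /=; last first.
    by move=> x y /eqP; rewrite eqn_pmul2l ?prime_gt0 // => /eqP.
  apply/hasPn => _ /mapP [d _ ->]; rewrite -dvdn_divisors //.
  apply/negP => h; move: cpm; rewrite prime_coprime // => /negP; apply.
  exact: dvdn_trans (dvdn_mulr _ (dvdnn p)) h.
move=> d hd; rewrite -dvdn_divisors //; move: hd; rewrite mem_cat => /orP [|/mapP [d']].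
  by rewrite -dvdn_divisors // => h; apply: dvdn_mulr.
rewrite -dvdn_divisors // => h ->; rewrite (mulnC p); apply: dvdn_mul => //.
by rewrite -(prednK e0) expnS dvdn_mulr.
Qed.

(** At each prime, [p <= 2 (p - 1)] while [tau] at least doubles. This serves as the lower bound for
    the totient when a sum over units is compared with one over all residues. *)
Lemma leq_totient_tau n : (0 < n)%N -> (n <= totient n * tau n)%N.
Proof.
elim/ltn_ind: n => n IH n0.
case: (leqP n 1) => n1.
  have -> : n = 1%N by lia.
  by have := tau_gt0 1; case: (tau 1).
have pp := pdiv_prime n1; set p := pdiv n in pp.
have [m pm en] := pfactor_coprime pp n0; set e := logn p n in en.
have m0 : (0 < m)%N by move: n0; rewrite en muln_gt0 => /andP [].
have e0 : (0 < e)%N by rewrite logn_gt0 pi_pdiv.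
have mn : (m < n)%N by rewrite en ltn_Pmulr // -(exp1n e) ltn_exp2r ?prime_gt1.
rewrite en totient_coprime; last by rewrite coprime_sym coprimeXl.
rewrite totient_pfactor //.
have h1 := IH m mn m0; have h2 := tau_mul_pfactor pp pm m0 e0.
have p2 : (p <= 2 * p.-1)%N by have := prime_gt1 pp; lia.
apply: (@leq_trans (totient m * (p.-1 * p ^ e.-1) * (2 * tau m))); last by rewrite leq_mul2l h2 orbT.
rewrite -{1}(prednK e0) expnS.
apply: (@leq_trans ((totient m * tau m) * ((2 * p.-1) * p ^ e.-1))).
  by apply: leq_mul => //; rewrite leq_mul2r p2 orbT.
by apply: eq_leq; ring.
Qed.

(** * Vaughan's identity *)
(* The Moebius function; [mu 0 = 1] is a junk value. *)
Definition mu (n : nat) : int :=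
  if all (fun p => logn p n == 1)%N (primes n) then (-1) ^+ size (primes n) else 0.

Lemma mu_norm n : `|mu n| <= 1.
Proof. by rewrite /mu; case: ifP => _; rewrite ?normrX ?normrN1 ?expr1n ?normr0. Qed.

Lemma perm_primesM p d : prime p -> (0 < d)%N -> ~~ (p %| d)%N ->
  perm_eq (primes (p * d)) (p :: primes d).
Proof.
move=> pp d0 pd; apply: uniq_perm; rewrite /= ?primes_uniq ?andbT //.
  by rewrite mem_primes pp d0.
have p0 := prime_gt0 pp.
by move=> q; rewrite inE primesM // (primes_prime pp) inE.
Qed.

Lemma mu_prime_mul p d : prime p -> (0 < d)%N -> ~~ (p %| d)%N -> mu (p * d) = - mu d.
Proof.
move=> pp d0 pd; have pe := perm_primesM pp d0 pd.
rewrite /mu (perm_all _ pe) (perm_size pe) /=.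
have lpd : logn p d = 0%N by apply/eqP; rewrite -leqn0 leqNgt logn_gt0 mem_primes pp d0.
have p0 := prime_gt0 pp.
rewrite lognM // (logn_prime _ pp) eqxx lpd addn0 eqxx /=.
have -> : all (fun q => logn q (p * d) == 1)%N (primes d) = all (fun q => logn q d == 1)%N (primes d).
  apply: eq_in_all => q; rewrite mem_primes => /and3P [pq _ qd].
  rewrite lognM // (logn_prime _ pp) (_ : (q == p) = false) //.
  by apply/eqP => qp; rewrite -qp qd in pd.
by case: ifP => _; rewrite ?oppr0 // exprS mulN1r.
Qed.

Lemma mu_sqr_dvd p d : prime p -> (0 < d)%N -> (p ^ 2 %| d)%N -> mu d = 0.
Proof.
move=> pp d0 h; rewrite /mu; case: allP => // /(_ p).
rewrite mem_primes pp d0 (dvdn_trans (dvdn_mulr p (dvdnn p)) h) => /(_ isT) /eqP l1.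
by have := h; rewrite (pfactor_dvdn _ pp d0) l1.
Qed.

Lemma perm_divisors n N : (0 < n <= N)%N ->
  perm_eq (divisors n) [seq d <- index_iota 1 N.+1 | d %| n]%N.
Proof.
move=> hn; have n0 : (0 < n)%N by lia.
apply: uniq_perm; rewrite ?divisors_uniq ?filter_uniq ?iota_uniq // => d.
rewrite mem_filter mem_index_iota -dvdn_divisors //.
case: (boolP (d %| n)%N) => //= h; have := dvdn_leq n0 h; have := dvdn_gt0 n0 h; lia.
Qed.

Lemma sum_divisors (V : zmodType) (F : nat -> V) n N : (0 < n <= N)%N ->
  \sum_(d <- divisors n) F d = \sum_(1 <= d < N.+1 | (d %| n)%N) F d.
Proof. by move=> hn; rewrite (perm_big _ (perm_divisors hn)) big_filter. Qed.

(** Fix a prime [p] dividing [n]. The divisors not divisible by [p ^ 2] pair off as [d] and [p d]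
    with opposite values, and the others contribute 0. *)
Lemma sum_mu_divisors n : (0 < n)%N -> \sum_(d <- divisors n) mu d = (n == 1)%N%:R.
Proof.
move=> n0; case: (leqP n 1) => n1.
  have -> : n = 1%N by lia.
  by rewrite (_ : divisors 1 = [:: 1%N]) // big_seq1.
rewrite gtn_eqF //.
have pp := pdiv_prime n1; set p := pdiv n in pp.
have p0 := prime_gt0 pp.
have [m pm en] := pfactor_coprime pp n0; set e := logn p n in en.
have m0 : (0 < m)%N by move: n0; rewrite en muln_gt0 => /andP [].
have e0 : (0 < e)%N by rewrite logn_gt0 pi_pdiv.
rewrite (bigID (fun d => p ^ 2 %| d)%N) /= big_seq_cond big1 ?add0r; last first.
  move=> d /andP []; rewrite -dvdn_divisors // => dn; apply: mu_sqr_dvd => //.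
  exact: dvdn_gt0 dn.
have cpd d : (d %| m)%N -> ~~ (p %| d)%N.
  move=> dm; apply/negP => pd; move: pm; rewrite prime_coprime // => /negP; apply.
  exact: dvdn_trans dm.
have pe : perm_eq [seq d <- divisors n | ~~ (p ^ 2 %| d)%N]
    (divisors m ++ [seq p * d | d <- divisors m])%N.
  apply: uniq_perm; first by rewrite filter_uniq ?divisors_uniq.
    rewrite cat_uniq divisors_uniq map_inj_uniq ?divisors_uniq ?andbT /=; last first.
      by move=> x y /eqP; rewrite eqn_pmul2l // => /eqP.
    apply/hasPn => _ /mapP [d _ ->]; rewrite -dvdn_divisors //.
    by apply/negP => /cpd; rewrite dvdn_mulr.
  move=> d; rewrite mem_filter mem_cat -!dvdn_divisors //.
  apply/idP/idP => [/andP [np2 dn]|/orP [dm|/mapP [d']]].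
  - have d0 := dvdn_gt0 n0 dn; have [pd|pd] := boolP (p %| d)%N.
      case/dvdnP: pd => d' ed; apply/orP; right; apply/mapP; exists d'; last by rewrite ed mulnC.
      rewrite -dvdn_divisors //; move: dn; rewrite en => dn.
      have cd : coprime d' (p ^ e).
        rewrite coprimeXr // coprime_sym prime_coprime //; apply/negP => pd'.
        by move: np2; rewrite ed dvdn_mul.
      by rewrite -(Gauss_dvdl _ cd); apply: dvdn_trans dn; rewrite ed dvdn_mulr.
    have cd : coprime d (p ^ e) by rewrite coprimeXr // coprime_sym prime_coprime.
    by rewrite -(Gauss_dvdl _ cd) -en dn.
  - rewrite en dvdn_mulr // andbT; apply/negP => h.
    by move: (cpd _ dm); rewrite (dvdn_trans _ h) // dvdn_mulr.
  - rewrite -dvdn_divisors // => dm ->; rewrite en mulnC; apply/andP; split.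
      by rewrite mulnC dvdn_pmul2l // cpd.
    by rewrite dvdn_mul // -(prednK e0) expnS dvdn_mulr.
rewrite -big_filter (perm_big _ pe) big_cat big_map /= -big_split /= big_seq big1 // => d.
rewrite -dvdn_divisors // => dm; rewrite mu_prime_mul ?subrr ?cpd //.
exact: dvdn_gt0 dm.
Qed.

Section Vaughan.
Variable R : realType.

(* The von Mangoldt function: [primes n] is a singleton exactly for prime powers. *)
Definition Lam (n : nat) : R :=
  if primes n is [:: p] then ln p%:R else 0.

Lemma ln_nat_ge0 n : 0 <= ln (n%:R : R).
Proof. by case: n => [|n]; [rewrite ln0 | apply: ln_ge0; rewrite ler1n]. Qed.

Lemma ln_nat_le m n : (0 < m <= n)%N -> ln (m%:R : R) <= ln n%:R.
Proof.
by case/andP => m0 mn; rewrite ler_ln ?posrE ?ltr0n ?ler_nat // (leq_trans m0).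
Qed.

Lemma ln_natM m n : (0 < m)%N -> (0 < n)%N -> ln ((m * n)%:R : R) = ln m%:R + ln n%:R.
Proof. by move=> m0 n0; rewrite natrM lnM ?posrE ?ltr0n. Qed.

Lemma Lam_ge0 n : 0 <= Lam n.
Proof. by rewrite /Lam; case: (primes n) => [|p [|]] //; apply: ln_nat_ge0. Qed.

Lemma Lam_le n : (0 < n)%N -> Lam n <= ln n%:R.
Proof.
move=> n0; rewrite /Lam; case e: (primes n) => [|p [|]]; try exact: ln_nat_ge0.
have : p \in primes n by rewrite e mem_head.
rewrite mem_primes => /and3P [pp _ pn]; apply: ln_nat_le.
by rewrite prime_gt0 // dvdn_leq.
Qed.

Lemma Lam_prime p : prime p -> Lam p = ln p%:R.
Proof. by move=> pp; rewrite /Lam primes_prime. Qed.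

Lemma Lam_pfactor n : (0 < n)%N -> Lam n != 0 ->
  exists p e, [/\ prime p, (0 < e)%N & n = (p ^ e)%N].
Proof.
move=> n0; rewrite /Lam; case e: (primes n) => [|p [|]]; rewrite ?eqxx // => _.
have : p \in primes n by rewrite e mem_head.
rewrite mem_primes => /and3P [pp _ pn].
exists p, (logn p n); rewrite logn_gt0 e mem_head; split=> //.
rewrite {1}(prod_prime_decomp n0) prime_decompE e big_map big_seq1 //.
Qed.

Lemma Lam_primeX p e : prime p -> (0 < e)%N -> Lam (p ^ e) = ln p%:R.
Proof. by move=> pp e0; rewrite /Lam primesX // primes_prime. Qed.

(** Write [n = p m]. Among the divisors of [n] that do not divide [m], only the full power of [p] in
    [n] carries weight, namely [ln p]. *)
Lemma sum_Lam_divisors n : (0 < n)%N -> \sum_(d <- divisors n) Lam d = ln n%:R.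
Proof.
elim/ltn_ind: n => n IH n0; case: (leqP n 1) => n1.
  have -> : n = 1%N by lia.
  by rewrite (_ : divisors 1 = [:: 1%N]) // big_seq1 ln1 /Lam.
have pp := pdiv_prime n1; set p := pdiv n in pp.
have p0 := prime_gt0 pp.
have [m en] : exists m, n = (p * m)%N.
  by have /dvdnP [m e] := pdiv_dvd n; exists m; rewrite mulnC.
have m0 : (0 < m)%N by move: n0; rewrite en muln_gt0 => /andP [].
have mn : (m < n)%N by rewrite en ltn_Pmull ?prime_gt1.
rewrite (@sum_divisors _ _ n n) ?n0 ?leqnn //.
rewrite (bigID (fun d => d %| m)%N) /= [X in _ = ln X%:R]en ln_natM // addrC; congr (_ + _); last first.
  rewrite -IH // (@sum_divisors _ _ m n) ?m0 ?(ltnW mn) //.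
  by apply: eq_bigl => d; rewrite andbC en; case: (boolP (d %| m)%N) => //= h; rewrite dvdn_mull.
set q := (p ^ (logn p m).+1)%N.
have qn : (q %| n)%N by rewrite /q en expnS dvdn_pmul2l // pfactor_dvdnn.
have nqm : ~~ (q %| m)%N by rewrite /q pfactor_dvdn // ltnn.
have q0 : (0 < q)%N by rewrite /q expn_gt0 p0.
rewrite big_mkcond (bigD1_seq q) ?iota_uniq //=; last first.
  by rewrite mem_index_iota q0 ltnS dvdn_leq.
rewrite qn nqm /= {1}/q Lam_primeX // big1 ?addr0 // => d dq.
case: ifP => // /andP [dn ndm].
have d0 := dvdn_gt0 n0 dn.
apply/eqP/negPn/negP => /(Lam_pfactor d0) [r [e [pr e0 ed]]].
have [rp|rp] := eqVneq r p; last first.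
  have cdp : coprime d p by rewrite ed coprimeXl // prime_coprime // dvdn_prime2.
  by move: dn ndm; rewrite en Gauss_dvdr // => ->.
move: dn ndm; rewrite ed rp !pfactor_dvdn // en lognM // (logn_prime _ pp) eqxx.
rewrite -ltnNge add1n => h1 h2; move: dq; rewrite ed rp /q.
have -> : e = (logn p m).+1 by lia.
by rewrite eqxx.
Qed.

Lemma sum_dvd_exchange (V : zmodType) (F : nat -> nat -> V) n : (0 < n)%N ->
  \sum_(a <- divisors n) \sum_(b <- divisors (n %/ a)) F a b =
  \sum_(b <- divisors n) \sum_(a <- divisors (n %/ b)) F a b.
Proof.
move=> n0.
have E (G : nat -> nat -> V) : \sum_(a <- divisors n) \sum_(b <- divisors (n %/ a)) G a b =
    \sum_(a <- divisors n) \sum_(b <- divisors n | (a * b %| n)%N) G a b.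
  apply: eq_big_seq => a; rewrite -dvdn_divisors // => an.
  have a0 := dvdn_gt0 n0 an.
  have na0 : (0 < n %/ a)%N by rewrite divn_gt0 // dvdn_leq.
  rewrite -[RHS]big_filter; apply: perm_big; apply: uniq_perm; rewrite ?divisors_uniq ?filter_uniq ?divisors_uniq //.
  move=> b; rewrite mem_filter -!dvdn_divisors // dvdn_divRL // mulnC.
  by case: (boolP (a * b %| n)%N) => //= h; rewrite (dvdn_trans _ h) // dvdn_mull.
rewrite E (E (fun b a => F a b)) (exchange_big_dep predT) //=.
by apply: eq_bigr => b _; apply: eq_bigl => a; rewrite mulnC.
Qed.

(* For [m > V >= 1] it is minus the part [b <= V] of [\sum_(b | m) mu b = 0]; for [0 < m <= V] it vanishes. *)
Definition gam (V m : nat) : int := \sum_(b <- divisors m | (V < b)%N) mu b.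

(** Moebius cancellation in [b] reduces the sum of [Lam a * mu b] over [a b] dividing [n] with
    [a > U] to the term [a = n]. Its part with [b > V] is the [gam] term; in the part with [b <= V],
    the condition [a > U] is traded for all [a], which add up to a logarithm, minus those with
    [a <= U]. *)
Lemma vaughan_identity (U V n : nat) : (0 < n)%N ->
  Lam n = (if (n <= U)%N then Lam n else 0)
   + \sum_(b <- divisors n | (b <= V)%N) (mu b)%:~R * ln (n %/ b)%:R
   - \sum_(b <- divisors n | (b <= V)%N) (mu b)%:~R * \sum_(a <- divisors (n %/ b) | (a <= U)%N) Lam a
   + \sum_(a <- divisors n | (U < a)%N) Lam a * (gam V (n %/ a))%:~R.
Proof.
move=> n0.
pose H (a b : nat) : R := if (U < a)%N then Lam a * (mu b)%:~R else 0.
have -> : \sum_(a <- divisors n | (U < a)%N) Lam a * (gam V (n %/ a))%:~R =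
    \sum_(a <- divisors n) \sum_(b <- divisors (n %/ a)) H a b -
    \sum_(a <- divisors n) \sum_(b <- divisors (n %/ a)) (if (b <= V)%N then H a b else 0).
  rewrite -sumrB big_mkcond; apply: eq_bigr => a _; rewrite -sumrB /H.
  case: ifP => Ua; last by rewrite big1 // => b _; rewrite if_same subr0.
  rewrite /gam rmorph_sum mulr_sumr big_mkcond; apply: eq_bigr => b _.
  by rewrite ltnNge; case: leqP => _; rewrite ?subrr ?subr0.
have -> : \sum_(a <- divisors n) \sum_(b <- divisors (n %/ a)) H a b =
    if (n <= U)%N then 0 else Lam n.
  rewrite (eq_big_seq (fun a => if (a == n) && (U < a)%N then Lam a else 0)).
    rewrite (bigD1_seq n) ?divisors_uniq ?divisors_id //= eqxx /= big1 ?addr0; last first.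
      by move=> a /negbTE ->.
    by rewrite ltnNge; case: leqP.
  move=> a; rewrite -dvdn_divisors // => an; rewrite /H; case: (ltnP U a) => Ua; last first.
    by rewrite andbF big1.
  have a0 := dvdn_gt0 n0 an.
  rewrite -mulr_sumr -rmorph_sum /= sum_mu_divisors; last by rewrite divn_gt0 // dvdn_leq.
  have -> : (n %/ a == 1)%N = (a == n).
    apply/eqP/eqP => [h|->]; last by rewrite divnn n0.
    by rewrite -(divnK an) h mul1n.
  by rewrite andbT; case: eqP; rewrite ?mulr1 ?mulr0.
have -> : \sum_(a <- divisors n) \sum_(b <- divisors (n %/ a)) (if (b <= V)%N then H a b else 0) =
   \sum_(b <- divisors n | (b <= V)%N) (mu b)%:~R * ln (n %/ b)%:R
   - \sum_(b <- divisors n | (b <= V)%N) (mu b)%:~R * \sum_(a <- divisors (n %/ b) | (a <= U)%N) Lam a.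
  rewrite sum_dvd_exchange // -sumrB [RHS]big_mkcond; apply: eq_big_seq => b.
  rewrite -dvdn_divisors // => bn; case: ifP => _; last by rewrite big1.
  have b0 := dvdn_gt0 n0 bn.
  rewrite -mulrBr -sum_Lam_divisors; last by rewrite divn_gt0 // dvdn_leq.
  rewrite [X in _ * (_ - X)]big_mkcond -sumrB mulr_sumr; apply: eq_bigr => a _.
  rewrite /H ltnNge; case: leqP => _; first by rewrite subrr mulr0.
  by rewrite subr0 mulrC.
by case: ifP => _; ring.
Qed.
End Vaughan.

(** * Character sums over boxes *)
Section PeriodicSums.
Variables (V : zmodType) (q : nat) (F : int -> V).
Hypothesis q0 : (0 < q)%N.
Hypothesis Fper : forall x, F (x + q%:Z) = F x.

Lemma per_addM x k : F (x + q%:Z * k) = F x.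
Proof.
have pos (m : nat) y : F (y + q%:Z * m%:Z) = F y.
  elim: m => [|m IH]; first by rewrite mulr0 addr0.
  have -> : m.+1%:Z = m%:Z + 1 by lia.
  by rewrite mulrDr mulr1 addrA Fper IH.
case: (leP 0 k) => hk; first by have := pos `|k|%N x; rewrite gez0_abs.
rewrite -(pos `|k|%N (x + _)); congr F.
by rewrite -addrA -mulrDr ltz0_abs // addrN mulr0 addr0.
Qed.

Lemma per_mod x y : (x = y %[mod q%:Z])%Z -> F x = F y.
Proof.
move/eqP; rewrite eqz_mod_dvd => /dvdzP [k ek].
by rewrite -(per_addM y k) mulrC -ek addrC subrK.
Qed.

Lemma psum_shift x : \sum_(0 <= i < q) F (x + i%:Z) = \sum_(0 <= i < q) F i%:Z.
Proof.
have step y : \sum_(0 <= i < q) F (y + 1 + i%:Z) = \sum_(0 <= i < q) F (y + i%:Z).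
  case: q q0 Fper => // r _ Fp; rewrite big_nat_recr //= big_nat_recl //=.
  rewrite addrC addr0; congr (_ + _); first by rewrite -(Fp y); congr F; lia.
  by apply: eq_big_nat => i _; congr F; lia.
elim/int_rect: x => [|n IH|n IH].
- by apply: eq_bigr => i _; rewrite add0r.
- by rewrite -IH -(step n%:Z); apply: eq_bigr => i _; congr F; lia.
- by rewrite -IH -(step (- n.+1%:Z)); apply: eq_bigr => i _; congr F; lia.
Qed.

Lemma psum_dilate (a : int) : coprime `|a| q ->
  \sum_(0 <= i < q) F (a * i%:Z) = \sum_(0 <= i < q) F i%:Z.
Proof.
move=> ca; pose f (i : nat) := `|((a * i%:Z) %% q%:Z)%Z|%N.
have qz : q%:Z != 0 by lia.
have fE i : (f i)%:Z = ((a * i%:Z) %% q%:Z)%Z by rewrite /f gez0_abs // modz_ge0.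
have finj : {in index_iota 0 q &, injective f}.
  move=> i j; rewrite !mem_index_iota /= => hi hj e.
  have : (a * i%:Z = a * j%:Z %[mod q%:Z])%Z by rewrite -!fE e.
  move/eqP; rewrite eqz_mod_dvd -mulrBr dvdzE abszM /= Gauss_dvdr; last by rewrite coprime_sym.
  move: hi hj; clear; case: (ltngtP i j) => // lij hi hj /dvdn_leq; lia.
have flt i : (f i < q)%N by rewrite -ltz_nat fE ltz_mod.
have pe : perm_eq [seq f i | i <- index_iota 0 q] (index_iota 0 q).
  apply: uniq_perm; rewrite ?iota_uniq ?map_inj_in_uniq ?iota_uniq //.
  have us : uniq [seq f i | i <- index_iota 0 q] by rewrite map_inj_in_uniq ?iota_uniq.
  have sub : {subset [seq f i | i <- index_iota 0 q] <= index_iota 0 q}.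
    by move=> _ /mapP [i _ ->]; rewrite mem_index_iota flt.
  have [|_ h] := uniq_min_size us sub; first by rewrite size_map.
  by move=> i; rewrite h.
rewrite -[RHS](perm_big _ pe) big_map; apply: eq_bigr => i _.
by apply: per_mod; rewrite fE modz_mod.
Qed.

Lemma psum_mult t : \sum_(0 <= i < t * q) F i%:Z = (\sum_(0 <= i < q) F i%:Z) *+ t.
Proof.
elim: t => [|t IH]; first by rewrite mul0n big_geq.
rewrite mulSn addnC (big_cat_nat (n := (t * q)%N)) ?leq_addr //= IH mulrSr; congr (_ + _).
rewrite -{1}(add0n (t * q)%N) big_addn addKn.
by apply: eq_bigr => i _; rewrite -(per_addM i%:Z t); congr F; lia.
Qed.

End PeriodicSums.

(** Complete [q] by [q] blocks cancel. What remains of the square are two margins of width less than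
    [q] and length at most [s]. *)
Lemma psum2_bound (R : realFieldType) (f : int -> int -> R) (q s : nat) (x y : int) :
  (0 < q)%N ->
  (forall i j, f (i + q%:Z) j = f i j) -> (forall i j, f i (j + q%:Z) = f i j) ->
  (forall i j, `|f i j| <= 1) ->
  \sum_(0 <= i < q) \sum_(0 <= j < q) f i%:Z j%:Z = 0 ->
  `|\sum_(0 <= i < s) \sum_(0 <= j < s) f (x + i%:Z) (y + j%:Z)| <= (2 * s * q)%:R.
Proof.
move=> q0 p1 p2 f1 f0; set t := (s %/ q)%N.
have ts : (t * q <= s)%N by rewrite leq_trunc_div.
have tsq : (s - t * q <= q)%N.
  by have := divn_eq s q; have := ltn_pmod s q0; rewrite -/t; lia.
have z : \sum_(0 <= i < t * q) \sum_(0 <= j < t * q) f (x + i%:Z) (y + j%:Z) = 0.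
  rewrite (@psum_mult _ q (fun i => \sum_(0 <= j < t * q) f (x + i) (y + j%:Z))) //; last first.
    by move=> i; apply: eq_bigr => j _; rewrite addrA p1.
  rewrite (@psum_shift _ q (fun i => \sum_(0 <= j < t * q) f i (y + j%:Z))) //; last first.
    by move=> i; apply: eq_bigr => j _; rewrite p1.
  rewrite (eq_bigr (fun i => (\sum_(0 <= j < q) f i%:Z j%:Z) *+ t)); last first.
    move=> i _; rewrite (@psum_mult _ q (fun j => f i%:Z (y + j))) //; last first.
      by move=> j; rewrite addrA p2.
    by rewrite (@psum_shift _ q (fun j => f i%:Z j)).
  by rewrite sumrMnl f0 !mul0rn.
have bnd a b c d : `|\sum_(a <= i < b) \sum_(c <= j < d) f (x + i%:Z) (y + j%:Z)|
    <= ((b - a) * (d - c))%:R.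
  apply: le_trans (ler_norm_sum _ _ _) _.
  apply: (@le_trans _ _ (\sum_(a <= i < b) (d - c)%:R)).
    apply: ler_sum => i _; apply: le_trans (ler_norm_sum _ _ _) _.
    apply: (@le_trans _ _ (\sum_(c <= j < d) 1)); first by apply: ler_sum.
    by rewrite sumr_const_nat.
  by rewrite sumr_const_nat mulnC mulrnA.
have hs : (t * q <= s)%N by [].
rewrite (big_cat_nat (n := (t * q)%N)) //=.
rewrite (eq_bigr (fun i => \sum_(0 <= j < t * q) f (x + i%:Z) (y + j%:Z) +
   \sum_(t * q <= j < s) f (x + i%:Z) (y + j%:Z))); last first.
  by move=> i _; rewrite (big_cat_nat (n := (t * q)%N)).
rewrite big_split /= z add0r; apply: le_trans (ler_normD _ _) _.
apply: (@le_trans _ _ ((t * q * (s - t * q))%:R + ((s - t * q) * s)%:R)).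
  by apply: lerD; apply: (le_trans (bnd _ _ _ _)); rewrite subn0.
rewrite -natrD ler_nat; nia.
Qed.

Lemma odd_logn_or_square (m : nat) : (0 < m)%N ->
  (exists k, m = k ^ 2)%N \/ exists p, prime p /\ odd (logn p m).
Proof.
move=> m0; case: (boolP (has (fun p => odd (logn p m)) (primes m))).
  by case/hasP => p; rewrite mem_primes => /andP [pp _] h; right; exists p.
move/hasPn => h; left; exists (\prod_(p <- primes m) p ^ (logn p m)./2)%N.
rewrite {1}(prod_prime_decomp m0) prime_decompE big_map /= -mulnn.
rewrite -big_split /=; apply: eq_big_seq => p hp; rewrite -expnD addnn.
by have /negbTE hh := h p hp; rewrite -[in LHS](odd_double_half (logn p m)) hh.
Qed.

(** Squaring modulo [p] identifies 1 and [p - 1], so it is not injective, hence not surjective. *)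
Lemma legendre_nonresidue p : prime p -> odd p -> exists a : nat, legendre a%:Z p = -1.
Proof.
move=> pp op; have p3 := odd_prime_gt2 op pp.
case: (boolP [exists a : 'I_p, legendre (a : nat)%:Z p == -1]) => [/existsP [a /eqP h]|].
  by exists a.
rewrite negb_exists => /forallP h.
pose sq (x : 'I_p) : 'I_p := Ordinal (ltn_pmod (x ^ 2) (prime_gt0 pp)).
have sqsurj (a : 'I_p) : exists x, sq x = a.
  have := h a; rewrite /legendre; case: ifP => [pa _|_].
    exists a; apply: val_inj => /=; rewrite dvdzE /= in pa.
    have a0 : (a = 0 :> nat)%N.
      by move: pa; have := ltn_ord a; case: (posnP a) => // a0 ap /dvdn_leq; lia.
    by rewrite a0 mod0n.
  case: ifP => // /existsP [x /eqP hx] _; exists x; apply: val_inj => /=.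
  move: hx; have := ltn_ord a => ha; rewrite (_ : (x : nat)%:Z ^+ 2 = (x ^ 2)%N%:Z); last by rewrite expr2 -PoszM mulnn.
  by rewrite !modz_nat => -[->]; rewrite modn_small.
have inj : injective sq.
  apply/injectiveP; rewrite /dinjectiveb; apply/card_uniqP.
  rewrite size_map -cardE; apply: eq_card => a; rewrite !inE.
  by have [x <-] := sqsurj a; apply/codomP; exists x.
have l1 : (1 < p)%N by lia.
have l2 : (p.-1 < p)%N by lia.
have : sq (Ordinal l1) = sq (Ordinal l2).
  apply: val_inj => /=; have -> : (p.-1 ^ 2 = (p - 2) * p + 1)%N.
    by case: (p) p3 => [|[|r]] // _; rewrite -mulnn /=; nia.
  by rewrite modnMDl.
by move/inj => [e]; lia.
Qed.

(** The Chinese remainder theorem combines a nonresidue modulo the odd power of [p] with 1 modulo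
    the cofactor. The congruence to 1 is what makes a linear congruence solvable in
    [jac_progression_sum]. *)
Lemma jacobi_minus1_exists (m p : nat) : odd m -> prime p -> odd (logn p m) ->
  exists u : nat, [/\ jacobi u%:Z m = -1, coprime u m,
    (u = 1 %[mod m %/ p ^ logn p m])%N & ~~ (p %| u)%N].
Proof.
move=> om pp olp.
have m0 : (0 < m)%N by lia.
have lp0 : (0 < logn p m)%N by lia.
have op : odd p.
  by apply: (odd_dvdn _ om); move: lp0; rewrite logn_gt0 mem_primes => /and3P [].
have [a la] := legendre_nonresidue pp op.
have [m' pm' em] := pfactor_coprime pp m0; set e := logn p m in lp0 olp em *.
have cpm : coprime (p ^ e) m' by rewrite coprimeXl.
have pe0 : (0 < p ^ e)%N by rewrite expn_gt0 prime_gt0.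
have m'0 : (0 < m')%N by move: m0; rewrite em muln_gt0 => /andP [].
set u := chinese (p ^ e) m' a 1.
have u1 : (u = a %[mod p ^ e])%N := chinese_modl cpm a 1.
have u2 : (u = 1 %[mod m'])%N := chinese_modr cpm a 1.
have om' : odd m' by move: om; rewrite em oddM => /andP [].
have jX k : (0 < k)%N -> jacobi a (p ^ k) = (-1) ^+ k.
  elim: k => // -[|k] IH _; first by rewrite expn1 jacobi_prime // la.
  have pk0 : (0 < p ^ k.+1)%N by rewrite expn_gt0 prime_gt0.
  by rewrite expnS (jacobiMr _ (prime_gt0 pp) pk0) IH // jacobi_prime // la [RHS]exprS.
have ju : jacobi u m = -1.
  rewrite em jacobiMr // (@jacobi_mod u 1 m'); last by rewrite !modz_nat u2.
  rewrite jacobi1l // mul1r (@jacobi_mod u a (p ^ e)); last by rewrite !modz_nat u1.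
  by rewrite jX // -signr_odd olp expr1.
have cu : coprime u m by have := jacobi_eq0 u m0; rewrite ju /= => /esym /negbT /negPn.
exists u; split=> //; first by rewrite em mulnK.
rewrite -prime_coprime // coprime_sym; move: cu; rewrite em coprimeMr => /andP [_].
by rewrite coprime_pexpr.
Qed.

Lemma gnormal_gabs2_mod4 z : gnormal z -> (gabs2 z %% 4 = 1)%N.
Proof.
case/and3P => z0 oa eb; have e := gabs2E z.
have [k ek] : exists k, z.1 = 2 * k + 1 by exists (z.1 %/ 2)%Z; clear -z0 oa; lia.
have [l el] : exists l, z.2 = 2 * l by exists (z.2 %/ 2)%Z; clear -eb; lia.
have : (gabs2 z)%:Z = 4 * (k ^+ 2 + k + l ^+ 2) + 1 by rewrite e ek el; ring.
by move: (_ + l ^+ 2) => t; clear; lia.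
Qed.

Lemma gnormal_odd z : gnormal z -> odd (gabs2 z).
Proof. by move=> /gnormal_gabs2_mod4; clear; lia. Qed.

Lemma jacobi_re_gabs2 z : gnormal z -> gprim z -> jacobi z.1 (gabs2 z) = 1.
Proof.
move=> nz pz; have m4 := gnormal_gabs2_mod4 nz; have om := gnormal_odd nz.
case/and3P: nz => a0 oa eb.
have aE : `|z.1|%N%:Z = z.1 by rewrite gez0_abs // ltW.
rewrite -{1}aE jacobi_reciprocity // /recsign m4 andbF mulr1.
transitivity (jacobi (z.2 ^+ 2) `|z.1|); last first.
  by apply: jacobi_sqrl; rewrite // coprime_sym.
by apply: (@jacobi_mod_sub _ _ z.1); rewrite aE gabs2E; ring.
Qed.

Definition ibox (L : nat) : seq int := [seq i%:Z - L%:Z | i <- index_iota 0 (2 * L).+1].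
Definition gbox (L : nat) : seq gint := [seq (x, y) | x <- ibox L, y <- ibox L].

Arguments ibox : simpl never.
Arguments gbox : simpl never.

Lemma mem_ibox L x : (x \in ibox L) = (`|x| <= L)%N.
Proof.
apply/mapP/idP => [[i]|h]; first by rewrite mem_index_iota => hi ->; lia.
by exists `|(x + L%:Z)%R|%N; rewrite ?mem_index_iota; lia.
Qed.

Lemma ibox_uniq L : uniq (ibox L).
Proof. by rewrite map_inj_uniq ?iota_uniq // => i j /addIr []. Qed.

Lemma mem_gbox L z : (z \in gbox L) = (`|z.1| <= L)%N && (`|z.2| <= L)%N.
Proof.
case: z => a b; rewrite -!mem_ibox /=; apply/allpairsP/andP.
  by move=> [[x y] [/= hx hy [-> ->]]]; split.
by move=> [h1 h2]; exists (a, b).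
Qed.

Lemma gbox_uniq L : uniq (gbox L).
Proof. by apply: allpairs_uniq; rewrite ?ibox_uniq // => -[x y] [x' y'] _ _ [-> ->]. Qed.

Lemma size_gbox L : size (gbox L) = ((2 * L).+1 * (2 * L).+1)%N.
Proof. by rewrite size_allpairs size_map size_iota subn0. Qed.

Lemma mem_gbox_gabs2 L z : (gabs2 z <= L ^ 2)%N -> z \in gbox L.
Proof.
move=> h; have e := gabs2E z; rewrite mem_gbox.
have h1 : (`|z.1| ^ 2 + `|z.2| ^ 2 <= L ^ 2)%N.
  apply: leq_trans h; rewrite -lez_nat e PoszD -!abszX !gez0_abs ?sqr_ge0 //.
apply/andP; split; rewrite -(leq_exp2r _ _ (isT : 0 < 2)%N); apply: leq_trans h1.
  exact: leq_addr.
exact: leq_addl.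
Qed.

Section Bilinear.
Variable R : realFieldType.

(* With [z = a + b i], the map [u + v i |-> u - (b / a) v] is the reduction modulo the conjugate
   of [z] to integers modulo [gabs2 z], and [(a / gabs2 z) = 1]; hence [chi z] is multiplicative. *)
Definition chi (z w : gint) : R := (jacobi (z.1 * w.1 - z.2 * w.2) (gabs2 z))%:~R.

Lemma chi_norm z w : `|chi z w| <= 1.
Proof. by rewrite /chi -intr_norm lerz1 jacobi_norm. Qed.

Lemma chiM z w t : gnormal z -> gprim z -> chi z (gmul w t) = chi z w * chi z t.
Proof.
move=> nz pz; rewrite /chi -intrM; congr (_%:~R).
have on := gnormal_odd nz.
rewrite -jacobiMl // -[LHS]mul1r -(jacobi_re_gabs2 nz pz) -jacobiMl //.
apply: (@jacobi_mod_sub _ _ (- (w.2 * t.2))); rewrite gabs2E /=; ring.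
Qed.

Lemma chi1 z : gnormal z -> gprim z -> chi z (1, 0) = 1.
Proof. by move=> nz pz; rewrite /chi mulr1 mulr0 subr0 jacobi_re_gabs2. Qed.

Lemma chi_scale z (u : int) i j : gnormal z ->
  chi z (u * i, u * j) = (jacobi u (gabs2 z))%:~R * chi z (i, j).
Proof.
move=> nz; rewrite /chi -intrM -jacobiMl ?gnormal_odd //; congr (jacobi _ _)%:~R.
by rewrite /=; ring.
Qed.

Lemma chi_per z i j k l : chi z (i + (gabs2 z)%:Z * k, j + (gabs2 z)%:Z * l) = chi z (i, j).
Proof.
rewrite /chi; congr (_%:~R); apply: (@jacobi_mod_sub _ _ (z.1 * k - z.2 * l)) => /=.
by ring.
Qed.

Lemma sum_gbox (V : zmodType) (F : gint -> V) L :
  \sum_(n <- gbox L) F n = \sum_(0 <= i < (2 * L).+1) \sum_(0 <= j < (2 * L).+1)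
    F (- L%:Z + i%:Z, - L%:Z + j%:Z).
Proof.
rewrite big_allpairs_dep big_map; apply: eq_bigr => i _; rewrite big_map.
by apply: eq_bigr => j _; congr (F (_, _)); rewrite addrC.
Qed.

(** The summand is periodic modulo the product of the two norms, and scaling [n] by an integer [u]
    multiplies it by the symbol of [u] modulo that product. If the product is not a square, some [u]
    has symbol -1, so the sum over a full period equals its negative. *)
Lemma chi2_box_bound z1 z2 L : gnormal z1 -> gnormal z2 ->
  ~ (exists k, gabs2 z1 * gabs2 z2 = k ^ 2)%N ->
  `|\sum_(n <- gbox L) chi z1 n * chi z2 n| <= (2 * (2 * L).+1 * (gabs2 z1 * gabs2 z2))%:R.
Proof.
move=> n1 n2 nsq; rewrite sum_gbox.
have o1 := gnormal_odd n1; have o2 := gnormal_odd n2.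
have om : odd (gabs2 z1 * gabs2 z2) by rewrite oddM o1 o2.
set q := (gabs2 z1 * gabs2 z2)%N in om nsq *.
have q0 : (0 < q)%N by clear -om; lia.
apply: (@psum2_bound _ (fun i j => chi z1 (i, j) * chi z2 (i, j))) => //.
- move=> i j; rewrite -(chi_per z1 i j (gabs2 z2)%:Z 0) -(chi_per z2 i j (gabs2 z1)%:Z 0).
  by rewrite !mulr0 !addr0 -!PoszM [(gabs2 z2 * _)%N]mulnC.
- move=> i j; rewrite -(chi_per z1 i j 0 (gabs2 z2)%:Z) -(chi_per z2 i j 0 (gabs2 z1)%:Z).
  by rewrite !mulr0 !addr0 -!PoszM [(gabs2 z2 * _)%N]mulnC.
- by move=> i j; rewrite normrM mulr_ile1 ?chi_norm.
have [[k ek]|[p [pp op]]] := odd_logn_or_square q0; first by case: nsq; exists k.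
have [u [ju cu _ _]] := jacobi_minus1_exists om pp op.
set f := fun i j : int => chi z1 (i, j) * chi z2 (i, j).
have fu i j : f (u%:Z * i) (u%:Z * j) = - f i j.
  rewrite /f !chi_scale // mulrACA -intrM -jacobiMr; first by rewrite ju mulN1r.
    by clear -o1; lia.
  by clear -o2; lia.
have p1 i j : f (i + q%:Z) j = f i j.
  rewrite /f -(chi_per z1 i j (gabs2 z2)%:Z 0) -(chi_per z2 i j (gabs2 z1)%:Z 0).
  by rewrite !mulr0 !addr0 -!PoszM [(gabs2 z2 * _)%N]mulnC.
have p2 i j : f i (j + q%:Z) = f i j.
  rewrite /f -(chi_per z1 i j 0 (gabs2 z2)%:Z) -(chi_per z2 i j 0 (gabs2 z1)%:Z).
  by rewrite !mulr0 !addr0 -!PoszM [(gabs2 z2 * _)%N]mulnC.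
set S := \sum_(_ <= _ < _) _.
have : S = - S.
  rewrite {1}/S -(@psum_dilate _ q (fun i => \sum_(0 <= j < q) f i j%:Z) q0 _ u%:Z) //; last first.
    by move=> i; apply: eq_bigr => j _; rewrite p1.
  rewrite /S -sumrN; apply: eq_bigr => i _.
  rewrite -(@psum_dilate _ q (fun j => f (u%:Z * i%:Z) j) q0 _ u%:Z) // -sumrN.
  by apply: eq_bigr => j _; rewrite fu.
by move/eqP; rewrite -subr_eq0 opprK -mulr2n mulrn_eq0 /= => /eqP.
Qed.
End Bilinear.

(** * Bilinear forms *)
Section SumInequalities.
Variable R : realFieldType.

Lemma sum_cauchy (I : Type) (s : seq I) (a b : I -> R) :
  (\sum_(i <- s) a i * b i) ^+ 2 <= (\sum_(i <- s) a i ^+ 2) * (\sum_(i <- s) b i ^+ 2).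
Proof.
elim: s => [|x s IH]; first by rewrite !big_nil expr0n mul0r.
rewrite !big_cons; move: IH.
have A0 : 0 <= \sum_(i <- s) a i ^+ 2 by apply: sumr_ge0 => i _; apply: sqr_ge0.
have B0 : 0 <= \sum_(i <- s) b i ^+ 2 by apply: sumr_ge0 => i _; apply: sqr_ge0.
move: (\sum_(i <- s) a i * b i) (\sum_(i <- s) a i ^+ 2) (\sum_(i <- s) b i ^+ 2) A0 B0.
move: (a x) (b x) => u v S A B A0 B0 h.
have : 2 * (u * v) * S <= u ^+ 2 * B + v ^+ 2 * A.
  have [t [t0 tA tB]] : exists t, [/\ 0 <= t, `|S| <= t & t ^+ 2 <= A * B].
    by exists `|S|; rewrite normr_ge0 lexx real_normK ?num_real.
  have h2 : (2 * (u * v) * S) ^+ 2 <= (u ^+ 2 * B + v ^+ 2 * A) ^+ 2.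
    apply: (@le_trans _ _ (4 * (u ^+ 2 * v ^+ 2) * (A * B))).
      have -> : (2 * (u * v) * S) ^+ 2 = 4 * (u ^+ 2 * v ^+ 2) * S ^+ 2 by ring.
      apply: ler_wpM2l => //; apply: mulr_ge0; [exact: ler0n|by rewrite mulr_ge0 ?sqr_ge0].
    rewrite -subr_ge0 (_ : _ - _ = (u ^+ 2 * B - v ^+ 2 * A) ^+ 2) ?sqr_ge0 //; ring.
  have r0 : 0 <= u ^+ 2 * B + v ^+ 2 * A by apply: addr_ge0; apply: mulr_ge0; rewrite ?sqr_ge0.
  apply: le_trans (ler_norm _) _.
  by rewrite -(ler_pXn2r (ltn0Sn 1)) ?nnegrE // real_normK ?num_real.
move=> h3; rewrite -subr_ge0.
rewrite (_ : _ - _ = (A * B - S ^+ 2) + (u ^+ 2 * B + v ^+ 2 * A - 2 * (u * v) * S)); last by ring.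
by rewrite addr_ge0 // subr_ge0.
Qed.

Lemma sum_power_mean (I : Type) (s : seq I) (x : I -> R) k : (forall i, 0 <= x i) ->
  (\sum_(i <- s) x i) ^+ k.+1 <= (size s)%:R ^+ k * \sum_(i <- s) x i ^+ k.+1.
Proof.
move=> x0; elim: k => [|k IH]; first by rewrite expr0 mul1r expr1.
have S0 : 0 <= \sum_(i <- s) x i by apply: sumr_ge0.
rewrite exprS; apply: le_trans (ler_wpM2l S0 IH) _.
rewrite mulrCA exprSr -mulrA; apply: ler_wpM2l; first by rewrite exprn_ge0.
(* Chebyshev's rearrangement: [a - b] and [a ^ (k + 1) - b ^ (k + 1)] have the same sign. *)
have cheb a b : 0 <= a -> 0 <= b -> a * b ^+ k.+1 + b * a ^+ k.+1 <= a ^+ k.+2 + b ^+ k.+2 :> R.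
  move=> a0 b0; rewrite -subr_ge0.
  have -> : a ^+ k.+2 + b ^+ k.+2 - (a * b ^+ k.+1 + b * a ^+ k.+1) =
     (a - b) * (a ^+ k.+1 - b ^+ k.+1) by rewrite !(exprS _ k.+1); ring.
  case: (leP a b) => ab.
    by rewrite mulr_le0 // subr_le0 // lerXn2r // nnegrE.
  by apply: mulr_ge0; rewrite subr_ge0; [exact: ltW|apply: lerXn2r; rewrite ?nnegrE // ltW].
elim: s {S0 IH} => [|y s IH]; first by rewrite !big_nil !(mul0r, mulr0).
rewrite !big_cons /= -natr1 !mulrDl !mulrDr mul1r.
have : x y * \sum_(j <- s) x j ^+ k.+1 + (\sum_(j <- s) x j) * x y ^+ k.+1 <=
   (size s)%:R * x y ^+ k.+2 + \sum_(j <- s) x j ^+ k.+2.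
  rewrite mulr_sumr mulr_suml -big_split /=.
  have -> : (size s)%:R * x y ^+ k.+2 = \sum_(j <- s) x y ^+ k.+2.
    by rewrite big_const_seq count_predT iter_addr_0 mulr_natl.
  rewrite -big_split /=; apply: ler_sum => j _.
  by rewrite (mulrC (x j)) [x y ^+ k.+1 * _]mulrC cheb.
rewrite (exprS _ k.+1); move: IH => /=; lra.
Qed.

End SumInequalities.

Lemma sum_le_count (R : realDomainType) (I : Type) (s : seq I) (P : pred I) (F : I -> R) (c : R) :
  (forall i, P i -> F i <= c) -> \sum_(i <- s | P i) F i <= (count P s)%:R * c.
Proof.
move=> h; apply: (@le_trans _ _ (\sum_(i <- s | P i) c)); first exact: ler_sum.
by rewrite big_const_seq iter_addr_0 mulr_natl.
Qed.

Lemma norm_sum_le_size (R : realDomainType) (I : eqType) (s : seq I) (F : I -> R) (c : R) :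
  (forall i, i \in s -> `|F i| <= c) -> `|\sum_(i <- s) F i| <= (size s)%:R * c.
Proof.
move=> h; apply: le_trans (ler_norm_sum _ _ _) _.
rewrite big_seq; apply: le_trans (@ler_sum _ _ _ _ _ (fun _ => c) _) _ => //.
by rewrite -big_seq big_const_seq count_predT iter_addr_0 mulr_natl.
Qed.

Definition issq (n : nat) : bool := has (fun k => k ^ 2 == n)%N (iota 0 n.+1).

Lemma issqP n : reflect (exists k, n = k ^ 2)%N (issq n).
Proof.
apply: (iffP hasP) => [[k _ /eqP <-]|[k ->]]; first by exists k.
by exists k; rewrite ?mem_iota ?eqxx //= add0n ltnS -[X in (X <= _)%N]expn1; case: k => // k; rewrite leq_pexp2l.
Qed.

Lemma gmul_inj_gabs2 (z w w' : gint) : (0 < gabs2 z)%N -> gmul z w = gmul z w' -> w = w'.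
Proof.
move=> z0 [e1 e2]; have n0 : z.1 ^+ 2 + z.2 ^+ 2 != 0 by rewrite -gabs2E; lia.
rewrite [w]surjective_pairing [w']surjective_pairing; congr pair; apply: (mulfI n0).
  transitivity (z.1 * (z.1 * w.1 - z.2 * w.2) + z.2 * (z.1 * w.2 + z.2 * w.1)); first by ring.
  by rewrite e1 e2; ring.
transitivity (z.1 * (z.1 * w.2 + z.2 * w.1) - z.2 * (z.1 * w.1 - z.2 * w.2)); first by ring.
by rewrite e1 e2; ring.
Qed.

Section BilinearBound.
Variables (R : realFieldType) (W : seq gint) (beta : gint -> R) (L Q k D : nat).
Hypothesis Wbd : forall w, w \in W -> (0 < gabs2 w <= Q)%N.
Hypothesis beta1 : forall w, `|beta w| <= 1.
Hypothesis QL : (Q ^ k <= L ^ 2)%N.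
Hypothesis Wdvd : forall n, (0 < gabs2 n <= Q ^ k)%N ->
  (count (fun w => has (fun t => gmul w t == n) (gbox L)) W <= D)%N.

(* The coefficients of the [j]-th power of the linear form [w |-> \sum beta w chi w]. *)
Fixpoint powcoef (j : nat) (n : gint) : R :=
  if j is j'.+1 then
    \sum_(w <- W) beta w * \sum_(t <- gbox L | gmul w t == n) powcoef j' t
  else (n == (1, 0))%:R.

Lemma Q_gt0 w : w \in W -> (0 < Q)%N.
Proof. by move=> /Wbd /andP [h1 h2]; apply: leq_trans h2. Qed.

Lemma powcoef_supp j n : powcoef j n != 0 -> (0 < gabs2 n <= Q ^ j)%N.
Proof.
elim: j n => [|j IH] n /=; first by case: (n =P (1, 0)) => [->|_]; rewrite ?eqxx.
have [/hasP [w wW /hasP [t tb /andP [/eqP <- t0]]] _|/hasPn h] :=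
    boolP (has (fun w => has (fun t => (gmul w t == n) && (powcoef j t != 0)) (gbox L)) W).
  rewrite gabs2M muln_gt0 expnS.
  have /andP [-> h1] := Wbd wW; have /andP [-> h2] := IH _ t0.
  by rewrite leq_mul.
rewrite big_seq big1 ?eqxx // => w wW; rewrite big_seq_cond big1 ?mulr0 // => t /andP [tb tn].
by have /hasPn /(_ _ tb) := h _ wW; rewrite tn negbK => /eqP.
Qed.

(** Each step peels one factor [w] off [n]. At most [D] choices of [w] are possible, and the
    cofactor [t] is then determined by cancellation. *)
Lemma powcoef_bound j n : (j <= k)%N -> `|powcoef j n| <= D%:R ^+ j.
Proof.
elim: j n => [|j IH] n jk; first by rewrite /= normr_nat expr0 lern1; case: (n =P _).
have [->|n0] := eqVneq (powcoef j.+1 n) 0; first by rewrite normr0 exprn_ge0.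
have /andP [n1 n2] := powcoef_supp n0.
have nQ : (0 < gabs2 n <= Q ^ k)%N.
  have [w0 w0W] : exists w, w \in W.
    case e : W n0 => [|w s]; first by rewrite /= e big_nil eqxx.
    by exists w; rewrite mem_head.
  by rewrite n1 (leq_trans n2) // leq_pexp2l // (Q_gt0 w0W).
rewrite /=; apply: le_trans (ler_norm_sum _ _ _) _.
apply: (@le_trans _ _ (\sum_(w <- W | has (fun t => gmul w t == n) (gbox L)) D%:R ^+ j)); last first.
  rewrite big_const_seq iter_addr_0 exprSr -[leLHS]mulr_natr.
  by apply: ler_wpM2l; rewrite ?exprn_ge0 // ler_nat Wdvd.
rewrite [leRHS]big_mkcond big_seq [leRHS]big_seq; apply: ler_sum => w wW.
rewrite normrM; apply: (@le_trans _ _ (1 * `|\sum_(t <- gbox L | gmul w t == n) powcoef j t|)).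
  by apply: ler_wpM2r.
rewrite mul1r; apply: le_trans (ler_norm_sum _ _ _) _.
apply: le_trans (sum_le_count _ (fun t _ => IH t (ltnW jk))) _.
have w0 : (0 < gabs2 w)%N by have /andP [] := Wbd wW.
have cle : (count (fun t => gmul w t == n) (gbox L) <= has (fun t => gmul w t == n) (gbox L))%N.
  rewrite has_count; case: posnP => [->|c0] //; rewrite -size_filter.
  set s := [seq t <- gbox L | gmul w t == n].
  have us : uniq s by apply: filter_uniq; apply: gbox_uniq.
  have hs t : t \in s -> gmul w t = n by rewrite mem_filter => /andP [/eqP].
  move: s us hs => s; case: s => [|t [|t' s]]; [by []|by []|].

  move=> /= /andP [tn _] hs; have tt : t = t'.
    by apply: (gmul_inj_gabs2 w0); rewrite (hs t) ?(hs t') // !inE eqxx ?orbT.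
  by move: tn; rewrite tt inE eqxx.
case: ifP cle => _ cle; first by rewrite ler_piMl ?exprn_ge0 // lern1.
by move: cle; rewrite leqn0 => /eqP ->; rewrite mul0r.
Qed.

(** [Q ^ k <= L ^ 2] keeps all products of up to [k] elements of [W] inside the box, so
    multiplicativity of [chi] in its second argument expands the power without truncation. *)
Lemma powcoef_sum z j : gnormal z -> gprim z -> (j <= k)%N -> (0 < L)%N ->
  (\sum_(w <- W) beta w * chi R z w) ^+ j = \sum_(n <- gbox L) powcoef j n * chi R z n.
Proof.
move=> nz pz jk L0; elim: j jk => [|j IH] jk.
  have p0 n : powcoef 0 n = (n == (1, 0))%:R by [].
  have h10 : (1, 0) \in gbox L by rewrite mem_gbox /= L0.
  rewrite expr0 (bigD1_seq _ h10 (gbox_uniq L)) p0 eqxx mul1r chi1 //.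
  rewrite big1 => [|n /negbTE n1]; last by rewrite p0 n1 mul0r.
  by rewrite /= addr0.
rewrite exprS IH ?(ltnW jk) // mulr_suml.
under [RHS]eq_bigr => n _ do rewrite /= mulr_suml.
rewrite exchange_big /= big_seq [RHS]big_seq; apply: eq_bigr => w wW.
rewrite -mulrA mulr_sumr.
transitivity (\sum_(n <- gbox L) \sum_(t <- gbox L | gmul w t == n) beta w * (powcoef j t * chi R z (gmul w t))); last first.
  apply: eq_bigr => n _; rewrite -mulrA mulr_suml mulr_sumr; apply: eq_bigr => t /eqP <-.
  by [].
rewrite (exchange_big_dep predT) //= mulr_sumr; apply: eq_big_seq => t tb.
have [t0|t0] := eqVneq (powcoef j t) 0.
  by rewrite t0 !(mul0r, mulr0) big1 // => n _; rewrite mulr0.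
have wt : gmul w t \in gbox L.
  apply: mem_gbox_gabs2; apply: leq_trans QL; rewrite gabs2M.
  have /andP [w1 w2] := Wbd wW; have /andP [t1 t2] := powcoef_supp t0.
  by apply: leq_trans (leq_mul w2 t2) _; rewrite -expnS leq_pexp2l // (Q_gt0 wW).
rewrite big_mkcond (bigD1_seq (gmul w t)) ?gbox_uniq //= eqxx big1 ?addr0; last first.
  by move=> n; rewrite eq_sym => /negbTE ->.
by rewrite chiM //; ring.
Qed.

(** In the last factor, pairs whose product of norms is a square, at most [Sq] of them, are counted
    with the whole box. Any other pair costs [2 (2 L + 1) M ^ 2] in place of [(2 L + 1) ^ 2], a gain
    once [L] exceeds [M ^ 2]; the exponent [k] is there to allow such a long box. *)
Lemma bilinear_bound (C : seq gint) (M Sq : nat) : (0 < k)%N -> (0 < L)%N ->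
  (forall z, z \in C -> [/\ gnormal z, gprim z & (gabs2 z <= M)%N]) ->
  (count (fun zz => issq (gabs2 zz.1 * gabs2 zz.2)) [seq (z, z') | z <- C, z' <- C] <= Sq)%N ->
  (\sum_(z <- C) `|\sum_(w <- W) beta w * chi R z w|) ^+ (2 * k) <=
  ((size C) ^ (2 * k - 2) * ((2 * L).+1 ^ 2 * D ^ (2 * k)) *
    (Sq * (2 * L).+1 ^ 2 + (size C) ^ 2 * (2 * (2 * L).+1 * M ^ 2)))%:R.
Proof.
move=> k0 L0 hC hSq.
set s := fun z => \sum_(w <- W) beta w * chi R z w.
(* These signs make the sum of the [|s z| ^ k] linear in the coefficients [powcoef k n], so that
   Cauchy's inequality can be applied over all [n] in the box. *)
pose e z : R := Num.sg (s z ^+ k).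
pose X n := \sum_(z <- C) e z * chi R z n.
have e1 z : `|e z| <= 1 by rewrite normr_sg; case: eqP; rewrite ?ler01.
have h1 : \sum_(z <- C) `|s z| ^+ k = \sum_(n <- gbox L) powcoef k n * X n.
  rewrite /X; under [RHS]eq_bigr => n _ do rewrite mulr_sumr.
  rewrite exchange_big /= big_seq [RHS]big_seq; apply: eq_bigr => z zC.
  have [nz pz _] := hC z zC.
  transitivity (e z * s z ^+ k).
    by rewrite -normrX [LHS]normrEsg.
  rewrite /s powcoef_sum // mulr_sumr; apply: eq_bigr => n _; ring.
have h2 : (\sum_(z <- C) `|s z|) ^+ k <= (size C)%:R ^+ k.-1 * \sum_(z <- C) `|s z| ^+ k.
  by have := @sum_power_mean _ _ C (fun z => `|s z|) k.-1 (fun z => normr_ge0 _); rewrite prednK.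
have T0 : 0 <= \sum_(z <- C) `|s z| by apply: sumr_ge0.
have h3 : (\sum_(z <- C) `|s z|) ^+ (2 * k) <= (size C)%:R ^+ (2 * k - 2) *
    (\sum_(z <- C) `|s z| ^+ k) ^+ 2.
  rewrite mulnC exprM (_ : (k * 2 - 2 = k.-1 * 2)%N); last by lia.
  rewrite exprM -exprMn lerXn2r // nnegrE ?exprn_ge0 //.
  by rewrite mulr_ge0 ?exprn_ge0 // sumr_ge0 // => z _; rewrite exprn_ge0.
have -> : ((size C) ^ (2 * k - 2) * ((2 * L).+1 ^ 2 * D ^ (2 * k)) *
    (Sq * (2 * L).+1 ^ 2 + (size C) ^ 2 * (2 * (2 * L).+1 * M ^ 2)))%:R =
   (size C)%:R ^+ (2 * k - 2) * (((2 * L).+1%:R ^+ 2 * D%:R ^+ (2 * k)) *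
    (Sq%:R * (2 * L).+1%:R ^+ 2 + (size C)%:R ^+ 2 * (2%:R * ((2 * L).+1%:R * M%:R ^+ 2)))) :> R.
  by rewrite !(natrM, natrD, natrX) -!mulrA.
apply: le_trans h3 _; apply: ler_wpM2l; first by rewrite exprn_ge0.
rewrite h1; apply: le_trans (sum_cauchy _ _ _) _.
apply: ler_pM.
- by apply: sumr_ge0 => n _; apply: sqr_ge0.
- by apply: sumr_ge0 => n _; apply: sqr_ge0.
- apply: le_trans (ler_norm _) _.
  apply: le_trans (@norm_sum_le_size _ _ (gbox L) _ (D%:R ^+ (2 * k)) _) _.
    move=> n _; rewrite ger0_norm ?sqr_ge0 // mulnC exprM -[leLHS]real_normK ?num_real //.
    by rewrite lerXn2r // ?nnegrE ?exprn_ge0 // powcoef_bound.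
  by rewrite size_gbox natrM -expr2.
have -> : \sum_(n <- gbox L) X n ^+ 2 = \sum_(zz <- [seq (z, z') | z <- C, z' <- C])
    e zz.1 * e zz.2 * \sum_(n <- gbox L) chi R zz.1 n * chi R zz.2 n.
  under eq_bigr => n _ do rewrite expr2 /X mulr_suml.
  rewrite exchange_big /= big_allpairs; apply: eq_bigr => z _.
  under eq_bigr => n _ do rewrite mulr_sumr.
  rewrite exchange_big /=; apply: eq_bigr => z' _; rewrite mulr_sumr.
  by apply: eq_bigr => n _; ring.
set CC := [seq _ | _ <- _, _ <- _] in hSq *.
have CCP zz : zz \in CC -> [/\ gnormal zz.1, gnormal zz.2 & (gabs2 zz.1 * gabs2 zz.2 <= M ^ 2)%N].
  case/allpairsP => -[z z'] [/= /hC [n1 _ m1] /hC [n2 _ m2] ->]; split=> //=.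
  by rewrite -mulnn leq_mul.
apply: le_trans (ler_norm _) _; apply: le_trans (ler_norm_sum _ _ _) _.
rewrite (bigID (fun zz => issq (gabs2 zz.1 * gabs2 zz.2))) /=; apply: lerD.
  apply: (@le_trans _ _ ((count (fun zz => issq (gabs2 zz.1 * gabs2 zz.2)) CC)%:R * ((2 * L).+1%:R ^+ 2))); last first.
    by apply: ler_wpM2r; rewrite ?exprn_ge0 // ler_nat.
  apply: sum_le_count => zz _; rewrite !normrM.
  rewrite -[leRHS]mul1r; apply: ler_pM; [by rewrite mulr_ge0|by []|by rewrite mulr_ile1|].
  apply: le_trans (@norm_sum_le_size _ _ (gbox L) _ 1 _) _.
    by move=> n _; rewrite normrM mulr_ile1 ?chi_norm.
  by rewrite mulr1 size_gbox natrM -expr2.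
rewrite big_seq_cond.
apply: (@le_trans _ _ (\sum_(zz <- CC | (zz \in CC) && ~~ issq (gabs2 zz.1 * gabs2 zz.2)) (2%:R * ((2 * L).+1%:R * M%:R ^+ 2)))).
  apply: ler_sum => zz /andP [/CCP [n1 n2 hm] nsq]; rewrite !normrM.
  rewrite -[leRHS]mul1r; apply: ler_pM; [by rewrite mulr_ge0|by []|by rewrite mulr_ile1|].
  apply: le_trans (chi2_box_bound R L n1 n2 _) _; first by move/issqP; apply/negP.
  by rewrite -natrX -!natrM ler_nat -mulnA !leq_mul2l hm !orbT.
apply: le_trans (sum_le_count _ (fun _ _ => lexx _)) _.
apply: ler_wpM2r; first by rewrite !mulr_ge0 ?exprn_ge0.
rewrite -natrX ler_nat; apply: leq_trans (count_size _ _) _.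
by rewrite size_allpairs mulnn.
Qed.
End BilinearBound.

(** * Counting Gaussian integers by their norms *)

Section Counting.
Local Open Scope nat_scope.

Lemma sum_uniq_pred1 (I : eqType) (s : seq I) (x : I) : uniq s ->
  \sum_(i <- s) (x == i) = (x \in s).
Proof.
move=> us; rewrite -(count_uniq_mem x us) -sum1_count [RHS]big_mkcond /=.
by apply: eq_bigr => i _; rewrite eq_sym; case: eqP.
Qed.

Lemma count_fibres (I J : eqType) (s : seq I) (t : seq J) (f : I -> J) (P : pred I) : uniq t ->
  (forall i, i \in s -> P i -> f i \in t) ->
  count P s = \sum_(j <- t) count (fun i => P i && (f i == j)) s.
Proof.
move=> ut hf; under eq_bigr => j _ do rewrite -sum1_count big_mkcond.
rewrite exchange_big -sum1_count big_mkcond /=; apply: eq_big_seq => i hi.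
case: (boolP (P i)) => Pi /=; last by rewrite big1.
transitivity (\sum_(j <- t) (f i == j)); first by rewrite sum_uniq_pred1 // hf.
by apply: eq_bigr => j _; case: eqP.
Qed.

Lemma sum_le_size (I : eqType) (s : seq I) (F : I -> nat) c :
  (forall i, i \in s -> F i <= c) -> \sum_(i <- s) F i <= size s * c.
Proof.
move=> h; apply: (@leq_trans (\sum_(i <- s) c)).
  by rewrite big_seq [leqRHS]big_seq; apply: leq_sum.
by rewrite big_const_seq count_predT iter_addn_0 mulnC.
Qed.

Variables (Y N : nat).
Hypothesis tauY : forall n, 0 < n <= N -> tau n <= Y.

Lemma count_gabs2_eq (s : seq gint) n : uniq s ->
  (forall z, z \in s -> gnormal z && gprim z) -> 0 < n <= N ->
  count (fun z => gabs2 z == n) s <= Y.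
Proof.
move=> us hs hn; rewrite -size_filter.
set t := filter _ _; have ut : uniq t by rewrite filter_uniq.
have ht z : z \in t -> [/\ gnormal z, gprim z & gabs2 z = n].
  by rewrite mem_filter => /andP [/eqP -> /hs /andP []].
case e : t => [|z0 t'] //; rewrite -e.
have z0t : z0 \in t by rewrite e mem_head.
have on : odd n by have [nz _ <-] := ht z0 z0t; apply: gnormal_odd.
exact: leq_trans (gabs2_count on ut ht) (tauY hn).
Qed.

Lemma count_gabs2_dvd (s : seq gint) n : uniq s ->
  (forall z, z \in s -> gnormal z && gprim z) -> 0 < n <= N ->
  count (fun z => gabs2 z %| n) s <= Y * Y.
Proof.
move=> us hs /andP [n0 nN].
rewrite (@count_fibres _ _ _ (divisors n) gabs2) ?divisors_uniq //; last first.
  by move=> z _; rewrite -dvdn_divisors.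
apply: (@leq_trans (tau n * Y)); last by rewrite leq_mul2r tauY ?n0 ?orbT.
apply: sum_le_size => d; rewrite -dvdn_divisors // => dn.
apply: leq_trans (sub_count _ _) (count_gabs2_eq us hs (n := d) _).
  by move=> z /= /andP [].
by rewrite (dvdn_gt0 n0 dn) (leq_trans (dvdn_leq n0 dn)).
Qed.

Definition gneg (z : gint) : gint := (- z.1, - z.2).

Lemma gneg_inj : injective gneg.
Proof. by move=> [a b] [c d] [/oppr_inj -> /oppr_inj ->]. Qed.

Lemma gabs2_gneg z : gabs2 (gneg z) = gabs2 z.
Proof. by rewrite /gabs2 /= !sqrrN. Qed.

Lemma gprim_gneg z : gprim (gneg z) = gprim z.
Proof. by rewrite /gprim /= !abszN. Qed.

Definition gpar (z : gint) : bool := odd `|z.1| && ~~ odd `|z.2|.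

Lemma gpar_gnormal z : gpar z -> (0 < z.1)%R -> gnormal z.
Proof. by rewrite /gpar /gnormal => /andP [-> ->] ->. Qed.

Lemma gpar_gneg z : gpar z -> (z.1 <= 0)%R -> gnormal (gneg z).
Proof.
rewrite /gpar /gnormal => /andP [oa eb] z0 /=; rewrite !abszN oa eb !andbT.
by clear -oa z0; case: (z.1) oa z0 => //; case.
Qed.

(** Elements satisfying [gpar] are normalized up to sign, so splitting by the sign of the first
    coordinate leaves two normalized families. *)
Lemma count_signs (s : seq gint) (Q : pred gint) c : uniq s ->
  (forall z, z \in s -> gpar z && gprim z) -> (forall z, Q (gneg z) = Q z) ->
  (forall t : seq gint, uniq t -> (forall z, z \in t -> gnormal z && gprim z) -> count Q t <= c) ->
  count Q s <= 2 * c.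
Proof.
move=> us hs hQ ht; pose pos := fun z : gint => (0 < z.1)%R.
have swap (A : pred gint) : count A [seq z <- s | Q z] = count Q [seq z <- s | A z].
  by rewrite !count_filter; apply: eq_count => z /=; rewrite andbC.
rewrite -size_filter -(count_predC pos) mul2n -addnn !swap; apply: leq_add.
  apply: ht; first by rewrite filter_uniq.
  move=> z; rewrite mem_filter => /andP [pz /hs /andP [h1 ->]].
  by rewrite gpar_gnormal.
rewrite -(eq_count (a1 := preim gneg Q)); last by move=> z; rewrite /= hQ.
rewrite -count_map; apply: ht; first by rewrite map_inj_uniq ?filter_uniq //; apply: gneg_inj.
move=> _ /mapP [z + ->]; rewrite mem_filter => /andP [pz /hs /andP [h1 h2]].
by rewrite gprim_gneg h2 andbT gpar_gneg // leNgt.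
Qed.

Lemma count_gdvd (W : seq gint) (L : nat) (n : gint) : uniq W ->
  (forall w, w \in W -> gpar w && gprim w) -> 0 < gabs2 n <= N ->
  count (fun w => has (fun t => gmul w t == n) (gbox L)) W <= 2 * (Y * Y).
Proof.
move=> uW hW hn.
apply: (@leq_trans (count (fun w => gabs2 w %| gabs2 n) W)).
  by apply: sub_count => w /hasP [t _ /eqP <-]; rewrite gabs2M dvdn_mulr.
apply: (@count_signs _ (fun w => gabs2 w %| gabs2 n)) => //.
  by move=> z; rewrite gabs2_gneg.
by move=> t ut ht; apply: count_gabs2_dvd.
Qed.

Lemma count_gabs2_interval (s : seq gint) lo hi : uniq s ->
  (forall z, z \in s -> gpar z && gprim z) -> hi <= N ->
  count (fun z => lo <= gabs2 z <= hi) s <= 2 * ((hi.+1 - lo) * Y).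
Proof.
move=> us hs hN; apply: (@count_signs _ (fun z => lo <= gabs2 z <= hi)) => //.
  by move=> z; rewrite gabs2_gneg.
move=> t ut ht; rewrite (@count_fibres _ _ _ (index_iota lo hi.+1) gabs2) ?iota_uniq //; last first.
  by move=> z _; rewrite mem_index_iota ltnS.
rewrite -(size_iota lo (hi.+1 - lo)); apply: sum_le_size => m.
rewrite mem_index_iota ltnS => /andP [lm mh].
case: (posnP m) => m0.
  rewrite m0 (_ : count _ _ = 0) //; apply/eqP; rewrite -leqn0 leqNgt -has_count.
  apply/hasPn => z /ht /andP [_ /gprim_gabs2_gt0]; rewrite lt0n => /negbTE ->.
  by rewrite andbF.
apply: leq_trans (sub_count _ _) (count_gabs2_eq ut ht (n := m) _).
  by move=> z /= /andP [].
by rewrite m0 (leq_trans mh).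
Qed.

(** If the product of the norms is [k ^ 2], then [k <= M]; the norm of [z] divides [k ^ 2], which
    leaves [Y * Y] choices of [z], and the norm of [z'] is then fixed, which leaves [Y]. *)
Lemma count_square_pairs (C : seq gint) M : uniq C -> M ^ 2 <= N ->
  (forall z, z \in C -> [&& gnormal z, gprim z & gabs2 z <= M]) ->
  count (fun zz => issq (gabs2 zz.1 * gabs2 zz.2)) [seq (z, z') | z <- C, z' <- C]
    <= M * (Y * Y * Y).
Proof.
move=> uC hM hC; pose r z := (fun k => k ^ 2 == gabs2 z.1 * gabs2 z.2).
have hC' z : z \in C -> gnormal z && gprim z by move=> /hC /and3P [-> ->].
have C0 z : z \in C -> 0 < gabs2 z by move=> /hC /and3P [_ /gprim_gabs2_gt0].
rewrite -sum1_count big_mkcond big_allpairs /=.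
apply: (@leq_trans (\sum_(z <- C) \sum_(z' <- C) \sum_(1 <= k < M.+1) (k ^ 2 == gabs2 z * gabs2 z'))).
  rewrite big_seq [leqRHS]big_seq; apply: leq_sum => z zC.
  rewrite big_seq [leqRHS]big_seq; apply: leq_sum => z' zC'.
  case: ifP => // /issqP [k ek]; rewrite (bigD1_seq k) ?iota_uniq //=.
    by rewrite -ek eqxx.
  have h1 := C0 z zC; have h2 := C0 z' zC'.
  have /and3P [_ _ m1] := hC z zC; have /and3P [_ _ m2] := hC z' zC'.
  rewrite mem_index_iota ltnS; apply/andP; split.
    by case: (k) ek => //; rewrite exp0n //; move: h1 h2; nia.
  by rewrite -(leq_exp2r _ _ (isT : 0 < 2)) -ek -mulnn leq_mul.
apply: (@leq_trans (\sum_(z <- C) \sum_(1 <= k < M.+1) \sum_(z' <- C) (k ^ 2 == gabs2 z * gabs2 z'))).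
  by apply: eq_leq; apply: eq_bigr => z _; rewrite exchange_big.
rewrite exchange_big /=.
apply: (@leq_trans (\sum_(1 <= k < M.+1) (Y * Y * Y))); last by rewrite sum_nat_const_nat subn1.
rewrite big_nat [leqRHS]big_nat; apply: leq_sum => k hk.
have k2 : 0 < k ^ 2 <= N.
  rewrite expn_gt0; apply/andP; split; first by apply/orP; left; lia.
  by apply: leq_trans hM; rewrite leq_exp2r //; lia.
apply: (@leq_trans (\sum_(z <- C | gabs2 z %| k ^ 2) Y)).
  rewrite [leqRHS]big_mkcond big_seq [leqRHS]big_seq; apply: leq_sum => z zC.
  case: ifP => dv; last first.
    rewrite big1 // => z' _; case: eqP => // e; move: dv; rewrite e dvdn_mulr //.
  apply: (@leq_trans (count (fun z' => gabs2 z' == k ^ 2 %/ gabs2 z) C)).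
    rewrite -sum1_count [leqRHS]big_mkcond /=; apply: leq_sum => z' _.
    by case: eqP => //= ->; rewrite mulKn ?C0 // eqxx.
  apply: count_gabs2_eq => //; rewrite divn_gt0 ?C0 // dvdn_leq //=; last by case/andP: k2.
  by apply: leq_trans (leq_div _ _) _; case/andP: k2.
rewrite big_const_seq iter_addn_0 mulnC leq_mul2r; apply/orP; right.
exact: count_gabs2_dvd.
Qed.
End Counting.

(* Only used for [0 < t.1]; the absolute value is the cast to [nat]. *)
Definition spin (t : gint) : int := jacobi t.2 `|t.1|.

Definition inO (X : nat) (t : gint) : bool := [&& 0 < t.1, 0 < t.2 & (gabs2 t <= X)%N].

(* Once [z] is confined to a class and to a cell, [spin_sign] depends only on [w], and the region
   condition on [gmul z w] can be replaced by the one for the corner of the cell, at the cost of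
   the pairs whose product lies near the edge of the region. *)
Definition cls (z : gint) : bool * bool := ((z.1 %% 4 == 3)%Z, (z.2 %% 4 == 2)%Z).

Definition cell (H : nat) (z : gint) : gint := ((z.1 %/ H%:Z)%Z, (z.2 %/ H%:Z)%Z).
Definition corner (H : nat) (i : gint) : gint := (i.1 * H%:Z, i.2 * H%:Z).

Lemma sum_fibres (V : zmodType) (I J : eqType) (s : seq I) (t : seq J) (f : I -> J) (F : I -> V) :
  uniq t -> (forall i, i \in s -> f i \in t) ->
  \sum_(i <- s) F i = \sum_(j <- t) \sum_(i <- s | f i == j) F i.
Proof.
move=> ut hf; rewrite (exchange_big_dep predT) //=; apply: eq_big_seq => i hi.
rewrite big_mkcond (bigD1_seq (f i)) ?hf //= eqxx big1 ?addr0 // => j.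
by rewrite eq_sym => /negbTE ->.
Qed.

(** * Type II sums: classes, cells and the bilinear bound *)

Section TypeII.
Variable R : realFieldType.

(* This agrees with [spin (gmul z w)] when the product has positive first coordinate, but it
   makes sense for all pairs and separates the variables up to [chi] and the sign. *)
Definition Kf (z w : gint) : R := (spin z)%:~R * (spin w)%:~R * chi R z w *
  (spin_sign z.1 z.2 w.1 w.2)%:~R.

Lemma spin_norm t : `|(spin t)%:~R : R| <= 1.
Proof. by rewrite -intr_norm lerz1 jacobi_norm. Qed.

Lemma spin_sign_norm a b u v : `|spin_sign a b u v| = 1.
Proof. by rewrite /spin_sign !normrM !normrX !normrN1 !expr1n. Qed.

Lemma Kf_norm z w : `|Kf z w| <= 1.
Proof.
rewrite /Kf !normrM -[X in _ * X]intr_norm spin_sign_norm mulr1.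
by rewrite !mulr_ile1 ?mulr_ge0 ?spin_norm ?chi_norm // mulr_ile1 ?spin_norm.
Qed.

Lemma spin_Kf X z w : gnormal z -> gpar w -> inO X (gmul z w) ->
  (spin (gmul z w))%:~R = Kf z w.
Proof.
move=> /and3P [a0 oa eb] /andP [ou ev] /and3P [/= R0 _ _].
by rewrite /Kf /chi -!intrM; congr (_%:~R); rewrite /spin /= spin_mul.
Qed.

(** A prime dividing [gmul z w] divides [gabs2 z] times both coordinates of the primitive [w], hence
    [gabs2 z]; as it also divides the first coordinate of the product, [chi] vanishes. Thus
    imprimitive products may be left out of [boundary_count]. *)
Lemma Kf_prim z w : gnormal z -> gprim z -> gprim w -> Kf z w != 0 -> gprim (gmul z w).
Proof.
move=> nz pz pw; apply: contraR => /gprimP h.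
have [p [pp [p1 p2]]] : exists p, prime p /\ (p%:Z %| (gmul z w).1)%Z /\ (p%:Z %| (gmul z w).2)%Z.
  have [p [pp h1 h2]] := @not_coprime_prime (gmul z w).1 (gmul z w).2 (introN (gprimP _) h).
  by exists p.
suff e : jacobi (z.1 * w.1 - z.2 * w.2) (gabs2 z) = 0 by rewrite /Kf /chi e mulr0 mul0r.
have d1 : (p%:Z %| (gabs2 z)%:Z * w.1)%Z.
  have -> : (gabs2 z)%:Z * w.1 = z.1 * (gmul z w).1 + z.2 * (gmul z w).2.
    by rewrite gabs2E /=; ring.
  exact: dvdz_lincomb.
have d2 : (p%:Z %| (gabs2 z)%:Z * w.2)%Z.
  have -> : (gabs2 z)%:Z * w.2 = z.1 * (gmul z w).2 + (- z.2) * (gmul z w).1.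
    by rewrite gabs2E /=; ring.
  exact: dvdz_lincomb.
apply: (@jacobi_eq0_prime _ _ p) => //; first exact: gprim_gabs2_gt0.
apply/negPn/negP => np; move: d1 d2; rewrite !dvdzE !abszM /= !Euclid_dvdM // (negbTE np) /=.
by move=> w1 w2; apply: (gprimP _ pw p pp); rewrite dvdzE.
Qed.

Definition wsign (c : bool * bool) (w : gint) : int :=
  (-1) ^+ (c.1 && (w.1 %% 4 == 3)%Z) * (-1) ^+ (c.2 && (w.2 %% 4 == 2)%Z) *
  (-1) ^+ ((w.1 < 0) && (w.2 < 0)).

Lemma spin_sign_cls z w : spin_sign z.1 z.2 w.1 w.2 = wsign (cls z) w.
Proof. by []. Qed.

Lemma cell_size (H : nat) (C : seq gint) i : (0 < H)%N -> uniq C ->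
  (forall z, z \in C -> cell H z = i) -> (size C <= H ^ 2)%N.
Proof.
move=> H0 uC hC; have Hz : H%:Z != 0 by lia.
pose f (z : gint) := (`|(z.1 %% H%:Z)%Z|%N, `|(z.2 %% H%:Z)%Z|%N).
have -> : (H ^ 2 = size [seq (x, y) | x <- iota 0 H, y <- iota 0 H])%N.
  by rewrite size_allpairs !size_iota mulnn.
rewrite -(size_map f); apply: uniq_leq_size.
  rewrite map_inj_in_uniq // => z z' zC z'C [e1 e2].
  have [c1 c2] : cell H z = cell H z' by rewrite (hC z) // (hC z').
  have hm x : `|(x %% H%:Z)%Z|%N%:Z = (x %% H%:Z)%Z by rewrite gez0_abs // modz_ge0.
  rewrite [z]surjective_pairing [z']surjective_pairing; congr pair.
    by rewrite (divz_eq z.1 H) (divz_eq z'.1 H) c1 -(hm z.1) e1 hm.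
  by rewrite (divz_eq z.2 H) (divz_eq z'.2 H) c2 -(hm z.2) e2 hm.
move=> _ /mapP [z zC ->]; apply/allpairsP; exists (f z); split=> //=.
  by rewrite mem_iota /= add0n -ltz_nat gez0_abs ?modz_ge0 // ltz_mod.
by rewrite mem_iota /= add0n -ltz_nat gez0_abs ?modz_ge0 // ltz_mod.
Qed.

Lemma cell_mem (H r : nat) z : (0 < H)%N -> (gabs2 z <= r ^ 2)%N ->
  cell H z \in gbox (r %/ H).+1.
Proof.
move=> H0 /mem_gbox_gabs2; rewrite !mem_gbox => /andP [h1 h2].
have h (x : int) : (`|x| <= r)%N -> (`|(x %/ H%:Z)%Z| <= (r %/ H).+1)%N.
  move=> hx; have Hz : H%:Z != 0 by clear -H0; lia.
  have e := divz_eq x H; have m0 := modz_ge0 x Hz; have m1 : (x %% H%:Z)%Z < H%:Z by rewrite ltz_mod.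
  have hr : (r < (r %/ H).+1 * H)%N by rewrite -ltn_divLR.
  move: (x %/ H%:Z)%Z (x %% H%:Z)%Z e m0 m1 (r %/ H)%N hr => q m e m0 m1 t hr.
  by clear -H0 hx e m0 m1 hr; nia.
by rewrite /= !h.
Qed.

Variables (Y N k L Q M H r X T0 : nat) (Z W : seq gint) (alpha beta : gint -> R).
Hypothesis tauY : forall n, (0 < n <= N)%N -> (tau n <= Y)%N.
Hypothesis k0 : (0 < k)%N.
Hypothesis L0 : (0 < L)%N.
Hypothesis H0 : (0 < H)%N.
Hypothesis QkN : (Q ^ k <= N)%N.
Hypothesis QkL : (Q ^ k <= L ^ 2)%N.
Hypothesis MN : (M ^ 2 <= N)%N.
Hypothesis Mr : (M <= r ^ 2)%N.
Hypothesis uZ : uniq Z.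
Hypothesis uW : uniq W.
Hypothesis ZP : forall z, z \in Z -> [&& gnormal z, gprim z & (gabs2 z <= M)%N].
Hypothesis WP : forall w, w \in W -> [&& gpar w, gprim w & (gabs2 w <= Q)%N].
Hypothesis alpha1 : forall z, `|alpha z| <= 1.
Hypothesis beta1 : forall w, `|beta w| <= 1.
Hypothesis HT : ((H ^ 2) ^ (2 * k - 2) * ((2 * L).+1 ^ 2 * (2 * (Y * Y)) ^ (2 * k)) *
    (M * (Y * Y * Y) * (2 * L).+1 ^ 2 + (H ^ 2) ^ 2 * (2 * (2 * L).+1 * M ^ 2)) <= T0 ^ (2 * k))%N.

Lemma typeII_cell (c : bool * bool) (i : gint) :
  `|\sum_(z <- Z | (cls z, cell H z) == (c, i)) \sum_(w <- W)
     alpha z * beta w * Kf z w * (inO X (gmul (corner H (cell H z)) w))%:R| <= T0%:R.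
Proof.
pose b (w : gint) : R := if w \in W then beta w * (spin w)%:~R * (wsign c w)%:~R * (inO X (gmul (corner H i) w))%:R else 0.
pose C := [seq z <- Z | (cls z, cell H z) == (c, i)].
have CP z : z \in C -> [/\ cls z = c, cell H z = i & [&& gnormal z, gprim z & (gabs2 z <= M)%N]].
  by rewrite mem_filter => /andP [/eqP [-> ->] /ZP].
rewrite -big_filter -/C.
apply: (@le_trans _ _ (\sum_(z <- C) `|\sum_(w <- W) b w * chi R z w|)).
  apply: le_trans (ler_norm_sum _ _ _) _; rewrite big_seq [leRHS]big_seq.
  apply: ler_sum => z zC; have [cz iz _] := CP z zC.
  have -> : \sum_(w <- W) alpha z * beta w * Kf z w * (inO X (gmul (corner H (cell H z)) w))%:R =
      (alpha z * (spin z)%:~R) * \sum_(w <- W) b w * chi R z w.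
    rewrite mulr_sumr; apply: eq_big_seq => w wW.
    by rewrite /b wW /Kf spin_sign_cls cz iz; ring.
  rewrite normrM -[leRHS]mul1r; apply: ler_wpM2r => //.
  by rewrite normrM mulr_ile1 ?spin_norm.
have b1 w : `|b w| <= 1.
  rewrite /b; case: ifP => _; last by rewrite normr0.
  rewrite !normrM -[X in _ * X * _]intr_norm /wsign !normrM !normrX !normrN1 !expr1n !mulr1.
  by rewrite !mulr_ile1 ?mulr_ge0 ?normr_nat ?spin_norm ?mulr_ile1 // lern1; case: inO.
have S0 : 0 <= \sum_(z <- C) `|\sum_(w <- W) b w * chi R z w| by apply: sumr_ge0.
rewrite -(@ler_pXn2r _ (2 * k)) ?nnegrE //; last by rewrite muln_gt0.
rewrite -natrX.
have Wb w : w \in W -> (0 < gabs2 w <= Q)%N.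
  by move=> /WP /and3P [_ /gprim_gabs2_gt0 -> ->].
have Wd n : (0 < gabs2 n <= Q ^ k)%N ->
    (count (fun w => has (fun t => gmul w t == n) (gbox L)) W <= 2 * (Y * Y))%N.
  move=> /andP [n0 nQ]; apply: (count_gdvd tauY) => //.
    by move=> w /WP /and3P [-> ->].
  by rewrite n0 (leq_trans nQ).
have CP' z : z \in C -> [/\ gnormal z, gprim z & (gabs2 z <= M)%N].
  by move=> /CP [_ _ /and3P].
have uC : uniq C by rewrite filter_uniq.
have sq := count_square_pairs tauY uC MN (fun z zC => let: And3 _ _ h := CP z zC in h).
apply: le_trans (bilinear_bound Wb b1 QkL Wd k0 L0 CP' sq) _.
have sC : (size C <= H ^ 2)%N.
  by apply: (cell_size (i := i)) => // z /CP [].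
rewrite ler_nat; apply: leq_trans HT.
have e2 a : (size C ^ a <= (H ^ 2) ^ a)%N by case: a => // a; rewrite leq_exp2r.
by apply: leq_mul; [apply: leq_mul | rewrite leq_add2l leq_mul2r e2 orbT].
Qed.

Lemma typeII_main :
  `|\sum_(z <- Z) \sum_(w <- W)
     alpha z * beta w * Kf z w * (inO X (gmul (corner H (cell H z)) w))%:R| <=
  (4 * size (gbox (r %/ H).+1) * T0)%:R.
Proof.
pose bb := [seq (x, y) | x <- [:: true; false], y <- [:: true; false]].
pose J := [seq (c, i) | c <- bb, i <- gbox (r %/ H).+1].
have uJ : uniq J.
  by apply: allpairs_uniq; rewrite ?gbox_uniq // => -[a b] [a' b'] _ _ [-> ->].
rewrite (@sum_fibres _ _ _ Z J (fun z => (cls z, cell H z))) //; last first.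
  move=> z /ZP /and3P [_ _ zM]; apply/allpairsP; exists (cls z, cell H z); split=> //=.
    by case: (cls z) => -[] [].
  by apply: cell_mem => //; apply: leq_trans zM Mr.
apply: le_trans (@norm_sum_le_size _ _ J _ T0%:R _) _.
  by move=> [c i] _; apply: typeII_cell.
by rewrite size_allpairs -natrM.
Qed.
End TypeII.

Lemma odd_absz (x : int) : odd `|x| -> exists k, x = 2 * k + 1.
Proof. by move=> h; exists (x %/ 2)%Z; have := divz_eq x 2; lia. Qed.

Lemma even_absz (x : int) : ~~ odd `|x| -> exists k, x = 2 * k.
Proof. by move=> h; exists (x %/ 2)%Z; have := divz_eq x 2; lia. Qed.

(** * Pairs whose product lies near the edge of the region *)

Definition near_edge (X E D : nat) (t : gint) : bool :=
  [|| (`|t.1| <= E)%N, (`|t.2| <= E)%N | (X - D <= gabs2 t <= X + D)%N].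

(** Either a coordinate changes sign, and is then at most [E] in absolute value, or the norm crosses
    [X]; factoring differences of squares, the norm moves by at most [2 E (2 B + E)]. *)
Lemma inO_near X E B t t' : (`|(t.1 - t'.1)%R| <= E)%N -> (`|(t.2 - t'.2)%R| <= E)%N ->
  (`|t.1| <= B)%N -> (`|t.2| <= B)%N -> inO X t != inO X t' ->
  near_edge X E (2 * (E * (2 * B + E))) t.
Proof.
move=> d1 d2 b1 b2; rewrite /inO /near_edge.
have [//|l1] := leqP `|t.1| E; have [//|l2] := leqP `|t.2| E => /=.
have -> : (0 < t'.1) = (0 < t.1) by clear -d1 l1; lia.
have -> : (0 < t'.2) = (0 < t.2) by clear -d2 l2; lia.
have e1 := gabs2E t; have e2 := gabs2E t'.
have dn : `|(gabs2 t)%:Z - (gabs2 t')%:Z| <= (2 * (E * (2 * B + E)))%N%:Z.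
  rewrite e1 e2.
  have -> : t.1 ^+ 2 + t.2 ^+ 2 - (t'.1 ^+ 2 + t'.2 ^+ 2) =
    (t.1 - t'.1) * (t.1 + t'.1) + (t.2 - t'.2) * (t.2 + t'.2) by ring.
  have h (x x' : int) : (`|(x - x')%R| <= E)%N -> (`|x| <= B)%N ->
      `|(x - x') * (x + x')| <= (E * (2 * B + E))%N%:Z.
    move=> h1 h2; rewrite normrM PoszM; apply: ler_pM => //.
    by rewrite -abszE lez_nat; clear -h1 h2; lia.
  apply: le_trans (ler_normD _ _) _.
  by apply: le_trans (lerD (h _ _ d1 b1) (h _ _ d2 b2)) _; rewrite (mul2n (E * _)) -addnn PoszD.
rewrite -abszE lez_nat in dn; move: (2 * (E * _))%N dn => D dn; clear -dn.
by case: (0 < t.1) => //; case: (0 < t.2) => //=; lia.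
Qed.

Section Boundary.
Variables (R : realFieldType) (Y N Q M H X E B Wc : nat) (Z W : seq gint).
Hypothesis tauY : forall n, (0 < n <= N)%N -> (tau n <= Y)%N.
Hypothesis H0 : (0 < H)%N.
Hypothesis uZ : uniq Z.
Hypothesis uW : uniq W.
Hypothesis ZP : forall z, z \in Z -> [&& gnormal z, gprim z & (gabs2 z <= M)%N].
Hypothesis WP : forall w, w \in W -> [&& gpar w, gprim w & (gabs2 w <= Q)%N].
Hypothesis QW : (Q <= Wc ^ 2)%N.
Hypothesis HE : (2 * (H * Wc) <= E)%N.
Hypothesis MQB : (M * Q <= B ^ 2)%N.
Hypothesis BN : (2 * B ^ 2 <= N)%N.
Hypothesis XN : (X + 2 * (E * (2 * B + E)) <= N)%N.

Let D := (2 * (E * (2 * B + E)))%N.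

Lemma corner_diff z w : w \in W ->
  (`|((gmul z w).1 - (gmul (corner H (cell H z)) w).1)%R| <= E)%N /\
  (`|((gmul z w).2 - (gmul (corner H (cell H z)) w).2)%R| <= E)%N.
Proof.
move=> wW; have /and3P [_ _ wQ] := WP wW.
have := mem_gbox_gabs2 (leq_trans wQ QW); rewrite mem_gbox => /andP [w1 w2].
have Hz : H%:Z != 0 by clear -H0; lia.
have e1 := divz_eq z.1 H; have e2 := divz_eq z.2 H.
have m1 := modz_ge0 z.1 Hz; have m2 := modz_ge0 z.2 Hz.
have l1 : (z.1 %% H%:Z)%Z < H%:Z by rewrite ltz_mod.
have l2 : (z.2 %% H%:Z)%Z < H%:Z by rewrite ltz_mod.
rewrite /corner /cell /gmul /=.
have -> : z.1 * w.1 - z.2 * w.2 - ((z.1 %/ H%:Z)%Z * H%:Z * w.1 - (z.2 %/ H%:Z)%Z * H%:Z * w.2) =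
  (z.1 - (z.1 %/ H%:Z)%Z * H%:Z) * w.1 - (z.2 - (z.2 %/ H%:Z)%Z * H%:Z) * w.2 by ring.
have -> : z.1 * w.2 + z.2 * w.1 - ((z.1 %/ H%:Z)%Z * H%:Z * w.2 + (z.2 %/ H%:Z)%Z * H%:Z * w.1) =
  (z.1 - (z.1 %/ H%:Z)%Z * H%:Z) * w.2 + (z.2 - (z.2 %/ H%:Z)%Z * H%:Z) * w.1 by ring.
have -> : z.1 - (z.1 %/ H%:Z)%Z * H%:Z = (z.1 %% H%:Z)%Z by rewrite {1}e1; ring.
have -> : z.2 - (z.2 %/ H%:Z)%Z * H%:Z = (z.2 %% H%:Z)%Z by rewrite {1}e2; ring.
move: (z.1 %% H%:Z)%Z (z.2 %% H%:Z)%Z m1 m2 l1 l2 => x y x0 y0 xH yH.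
have h (s v : int) : 0 <= s -> s < H%:Z -> (`|v| <= Wc)%N -> `|s * v| <= (H * Wc)%N%:Z.
  by move=> s0 sH hv; rewrite normrM PoszM; apply: ler_pM => //; rewrite ger0_norm // ltW.
have a1 := h x w.1 x0 xH w1; have a2 := h y w.2 y0 yH w2.
have a3 := h x w.2 x0 xH w2; have a4 := h y w.1 y0 yH w1.
move: (H * Wc)%N (x * w.1) (y * w.2) (x * w.2) (y * w.1) HE a1 a2 a3 a4 => hw b1 b2 b3 b4.
by clear; lia.
Qed.

Lemma count_near :
  (count (near_edge X E D) [seq t <- gbox B | gpar t && gprim t] <=
   2 * ((2 * E).+1 * (2 * B).+1) + 2 * ((2 * D).+1 * Y))%N.
Proof.
set G := [seq _ <- _ | _].
have uG : uniq G by rewrite filter_uniq ?gbox_uniq.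
apply: (@leq_trans (count (fun t => `|t.1| <= E)%N G + count (fun t => `|t.2| <= E)%N G +
   count (fun t => X - D <= gabs2 t <= X + D)%N G)).
  rewrite -!sum1_count [leqLHS]big_mkcond [X in (_ <= X + _ + _)%N]big_mkcond.
  rewrite [X in (_ <= _ + X + _)%N]big_mkcond [X in (_ <= _ + _ + X)%N]big_mkcond -!big_split /=.
  by apply: leq_sum => t _; rewrite /near_edge; case: (`|t.1| <= E)%N; case: (`|t.2| <= E)%N; case: (X - D <= gabs2 t <= X + D)%N.
have hs (P : pred gint) : (count P G <= count P (gbox B))%N.
  by rewrite count_filter; apply: sub_count => t /andP [].
apply: leq_add; last first.
  apply: leq_trans (@count_gabs2_interval Y N tauY G (X - D) (X + D) uG _ XN) _.
    by move=> z; rewrite mem_filter => /andP [].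
  by rewrite leq_mul2l leq_mul2r; apply/orP; right; apply/orP; right; clear; lia.
have si b : size (ibox b) = (2 * b).+1 by rewrite size_map size_iota subn0.
rewrite mul2n -addnn; apply: leq_add; apply: leq_trans (hs _) _; rewrite -size_filter.
  rewrite -!si -(size_allpairs (fun x y => (x, y))); apply: uniq_leq_size.
    by rewrite filter_uniq ?gbox_uniq.
  move=> [a b]; rewrite mem_filter mem_gbox => /andP [h1 /andP [_ h2]].
  by apply/allpairsP; exists (a, b); rewrite !mem_ibox.
rewrite mulnC -!si -(size_allpairs (fun x y => (x, y))); apply: uniq_leq_size.
  by rewrite filter_uniq ?gbox_uniq.
move=> [a b]; rewrite mem_filter mem_gbox => /andP [h1 /andP [h2 _]].
by apply/allpairsP; exists (a, b); rewrite !mem_ibox.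
Qed.

(** Group the pairs by their product [t]. Each such [t] is primitive and near the edge, its
    normalized left factors number at most [tau (gabs2 t) <= Y], and [z] and [t] determine [w]. *)
Lemma boundary_count :
  (\sum_(z <- Z) \sum_(w <- W)
    (gprim (gmul z w) && (inO X (gmul z w) != inO X (gmul (corner H (cell H z)) w))) <=
   Y * (2 * ((2 * E).+1 * (2 * B).+1) + 2 * ((2 * D).+1 * Y)))%N.
Proof.
set G := [seq t <- gbox B | gpar t && gprim t].
have uG : uniq G by rewrite filter_uniq ?gbox_uniq.
have pZ z w : z \in Z -> w \in W -> gpar (gmul z w).
  move=> /ZP /and3P [/and3P [_ oa eb] _ _] /WP /and3P [/andP [ou ev] _ _].
  have [k ek] := odd_absz oa; have [l el] := even_absz eb.
  have [k' ek'] := odd_absz ou; have [l' el'] := even_absz ev.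
  rewrite /gpar /gmul /= ek el ek' el'.
  have -> : (2 * k + 1) * (2 * k' + 1) - 2 * l * (2 * l') = 2 * (2 * k * k' + k + k' - 2 * l * l') + 1 by ring.
  have -> : (2 * k + 1) * (2 * l') + 2 * l * (2 * k' + 1) = 2 * (2 * k * l' + l' + 2 * l * k' + l) by ring.
  by rewrite odd_abszD !abszM !oddM.
apply: (@leq_trans (\sum_(t <- G | near_edge X E D t) \sum_(z <- Z) \sum_(w <- W) (gmul z w == t))).
  rewrite [leqRHS]exchange_big /= big_seq [leqRHS]big_seq; apply: leq_sum => z zZ.
  rewrite [leqRHS]exchange_big /= big_seq [leqRHS]big_seq; apply: leq_sum => w wW.
  case: (boolP (_ && _)) => // /andP [pt hO].
  have tb : gmul z w \in gbox B.
    apply: mem_gbox_gabs2; rewrite gabs2M; apply: leq_trans MQB.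
    have /and3P [_ _ h1] := ZP zZ; have /and3P [_ _ h2] := WP wW.
    exact: leq_mul.
  have tG : gmul z w \in G by rewrite mem_filter pt tb pZ.
  have nt : near_edge X E D (gmul z w).
    have [d1 d2] := corner_diff z wW; move: tb; rewrite mem_gbox => /andP [b1 b2].
    exact: (inO_near d1 d2).
  by rewrite big_mkcond (bigD1_seq (gmul z w)) //= nt eqxx.
apply: (@leq_trans (\sum_(t <- G | near_edge X E D t) Y)); last first.
  by rewrite big_const_seq iter_addn_0 leq_mul2l count_near orbT.
rewrite big_seq_cond [leqRHS]big_seq_cond; apply: leq_sum => t /andP [].
rewrite mem_filter => /andP [/andP [pt prt] tb] _.
have t0 := gprim_gabs2_gt0 prt.
have tN : (gabs2 t <= N)%N.
  apply: leq_trans BN; move: tb; rewrite mem_gbox => /andP [b1 b2].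
  rewrite -lez_nat gabs2E mul2n -addnn PoszD.
  have h (x : int) : (`|x| <= B)%N -> x ^+ 2 <= (B ^ 2)%N%:Z.
    by move=> hx; rewrite -[leLHS]gez0_abs ?sqr_ge0 // lez_nat abszX leq_exp2r.
  by apply: lerD; apply: h.
have ot : odd (gabs2 t).
  case/andP: pt => oa eb; have e := gabs2E t.
  have h : odd `|(t.1 ^+ 2 + t.2 ^+ 2)%R| by rewrite odd_abszD !abszX !oddX /= oa (negbTE eb).
  by rewrite -[gabs2 t]/`|(gabs2 t)%:Z|%N e.
have Zw z : z \in Z -> (0 < gabs2 z)%N by move=> /ZP /and3P [_ /gprim_gabs2_gt0].
apply: (@leq_trans (count (fun z => has (fun w => gmul z w == t) W) Z)).
  rewrite -sum1_count [leqRHS]big_mkcond big_seq [leqRHS]big_seq; apply: leq_sum => z zZ.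
  case: hasP => [[w wW /eqP e]|h]; last first.
    by rewrite big_seq big1 // => w wW; case: eqP => // e; case: h; exists w; rewrite ?e.
  rewrite (bigD1_seq w) //= e eqxx big1 ?addn0 // => w' ww'.
  case: eqP => // e'; case/eqP: ww'; apply: (gmul_inj_gabs2 (Zw z zZ)); by rewrite e e'.
rewrite -size_filter; apply: (@leq_trans (tau (gabs2 t))); last by rewrite tauY // t0.
apply: gfactor_count => //; first by rewrite filter_uniq.
move=> z; rewrite mem_filter => /andP [/hasP [w _ /eqP e] /ZP /and3P [nz _ _]].
by split=> //; exists w.
Qed.
End Boundary.

Section TypeIIBound.
Variables (R : realFieldType) (Y N k L Q M H r X T0 E B Wc : nat) (Z W : seq gint) (alpha beta : gint -> R).
Hypothesis tauY : forall n, (0 < n <= N)%N -> (tau n <= Y)%N.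
Hypothesis k0 : (0 < k)%N.
Hypothesis L0 : (0 < L)%N.
Hypothesis H0 : (0 < H)%N.
Hypothesis QkN : (Q ^ k <= N)%N.
Hypothesis QkL : (Q ^ k <= L ^ 2)%N.
Hypothesis MN : (M ^ 2 <= N)%N.
Hypothesis Mr : (M <= r ^ 2)%N.
Hypothesis uZ : uniq Z.
Hypothesis uW : uniq W.
Hypothesis ZP : forall z, z \in Z -> [&& gnormal z, gprim z & (gabs2 z <= M)%N].
Hypothesis WP : forall w, w \in W -> [&& gpar w, gprim w & (gabs2 w <= Q)%N].
Hypothesis alpha1 : forall z, `|alpha z| <= 1.
Hypothesis beta1 : forall w, `|beta w| <= 1.
Hypothesis HT : ((H ^ 2) ^ (2 * k - 2) * ((2 * L).+1 ^ 2 * (2 * (Y * Y)) ^ (2 * k)) *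
    (M * (Y * Y * Y) * (2 * L).+1 ^ 2 + (H ^ 2) ^ 2 * (2 * (2 * L).+1 * M ^ 2)) <= T0 ^ (2 * k))%N.
Hypothesis QW : (Q <= Wc ^ 2)%N.
Hypothesis HE : (2 * (H * Wc) <= E)%N.
Hypothesis MQB : (M * Q <= B ^ 2)%N.
Hypothesis BN : (2 * B ^ 2 <= N)%N.
Hypothesis XN : (X + 2 * (E * (2 * B + E)) <= N)%N.

Lemma typeII_bound :
  `|\sum_(z <- Z) \sum_(w <- W)
     alpha z * beta w * (if inO X (gmul z w) then (spin (gmul z w))%:~R else 0)| <=
  (4 * size (gbox (r %/ H).+1) * T0 +
   Y * (2 * ((2 * E).+1 * (2 * B).+1) + 2 * ((2 * (2 * (E * (2 * B + E)))).+1 * Y)))%:R.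
Proof.
have m := typeII_main X tauY k0 L0 H0 QkN QkL MN Mr uZ uW ZP WP alpha1 beta1 HT.
have b := boundary_count tauY H0 uZ uW ZP WP QW HE MQB BN XN.
set S := \sum_(z <- Z) _; set S' := \sum_(z <- Z) _ in m.
rewrite -(subrK S' S) addrC natrD; apply: le_trans (ler_normD _ _) _.
apply: lerD => //; apply: le_trans (_ : _ <= (_ : nat)%:R) _; last by rewrite ler_nat; apply: b.
rewrite /S /S' -sumrB natr_sum; apply: le_trans (ler_norm_sum _ _ _) _.
rewrite big_seq [leRHS]big_seq; apply: ler_sum => z zZ.
rewrite -sumrB natr_sum; apply: le_trans (ler_norm_sum _ _ _) _.
rewrite big_seq [leRHS]big_seq; apply: ler_sum => w wW.
have /and3P [nz pz _] := ZP zZ; have /and3P [gw pw _] := WP wW.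
have -> : (if inO X (gmul z w) then (spin (gmul z w))%:~R else 0) =
    Kf R z w * (inO X (gmul z w))%:R.
  by case: ifP => h; rewrite ?mulr1 ?mulr0 // (spin_Kf R nz gw h).
have -> : alpha z * beta w * (Kf R z w * (inO X (gmul z w))%:R) -
   alpha z * beta w * Kf R z w * (inO X (gmul (corner H (cell H z)) w))%:R =
   alpha z * beta w * Kf R z w * ((inO X (gmul z w))%:R - (inO X (gmul (corner H (cell H z)) w))%:R).
  by ring.
have [K0|K0] := eqVneq (Kf R z w) 0; first by rewrite K0 mulr0 mul0r normr0.
rewrite (Kf_prim nz pz pw K0) /= normrM.
have h1 : `|alpha z * beta w * Kf R z w| <= 1.
  have h0 : `|alpha z| * `|beta w| <= 1 by rewrite mulr_ile1.
  rewrite normrM; apply: mulr_ile1; rewrite ?normr_ge0 ?Kf_norm // normrM h0 //.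
rewrite -[leRHS]mul1r; apply: ler_pM => //.
by case: inO; case: inO; rewrite ?subrr ?normr0 ?subr0 ?sub0r ?normrN ?normr1.
Qed.
End TypeIIBound.

(** * Sums over arithmetic progressions *)
(* Every nonzero shift below [J] is missed by some prime of odd exponent in [q], that is, the
   squarefree kernel of the character modulo [q] is at least [J]. *)
Definition large_core (q J : nat) : Prop :=
  forall h : nat, (0 < h < J)%N -> exists p, [/\ prime p, odd (logn p q) & ~~ (p %| h)%N].

Section CharSum.
Variables (R : realFieldType) (q : nat).
Hypothesis oq : odd q.

Definition jac (i : int) : R := (jacobi i q)%:~R.

Lemma q_gt0 : (0 < q)%N. Proof. by clear -oq; lia. Qed.

Lemma jac_per i : jac (i + q%:Z) = jac i.
Proof. by rewrite /jac; congr (_%:~R); apply: (@jacobi_mod_sub _ _ 1); ring. Qed.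

Lemma jac_norm i : `|jac i| <= 1.
Proof. by rewrite /jac -intr_norm lerz1 jacobi_norm. Qed.

Lemma jacM i j : jac (i * j) = jac i * jac j.
Proof. by rewrite /jac jacobiMl // intrM. Qed.

(** With [u] of symbol -1 and [c h = (u - 1) i] modulo [q], the substitution of [u a + c] for [a]
    permutes the residues and multiplies [i + a h] by [u], so the sum equals its negative. Such a
    [c] exists because [q / p ^ e] divides [u - 1] and [h] is invertible modulo [p ^ e]. *)
Lemma jac_progression_sum (i h : int) p : prime p -> odd (logn p q) -> ~~ (p%:Z %| h)%Z ->
  \sum_(0 <= a < q) jac (i + a%:Z * h) = 0.
Proof.
move=> pp op nph; have q0 := q_gt0.
have [u [ju cu u1 _]] := jacobi_minus1_exists oq pp op.
set e := logn p q in op u1; set m := (q %/ p ^ e)%N in u1.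
have qE : q = (m * p ^ e)%N by rewrite divnK // pfactor_dvdnn.
have /dvdzP [v ev] : (m%:Z %| u%:Z - 1)%Z.
  by rewrite -eqz_mod_dvd -[1]/(1%N%:Z) !modz_nat u1.
have cop : coprime `|h| `|(p ^ e)%N%:Z|.
  by rewrite /= coprimeXr // coprime_sym prime_coprime //; move: nph; rewrite dvdzE.
have [h' [k ek]] : exists h' k, h' * h + k * (p ^ e)%N%:Z = 1.
  have [x [y e1]] := Bezoutz h (p ^ e)%N; exists x, y; rewrite e1.
  by move: cop; rewrite /coprime /gcdz => /eqP ->.
pose c := m%:Z * (h' * v * i).
have ju' : jac u%:Z = -1 by rewrite /jac ju mulrN1z.
have key a : jac (i + (u%:Z * a + c) * h) = - jac (i + a * h).
  have -> : - jac (i + a * h) = jac (u%:Z * (i + a * h)) by rewrite jacM ju' mulN1r.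
  rewrite /jac; congr (_%:~R); apply: (@jacobi_mod_sub _ _ (- (k * v * i))).
  have uE : u%:Z = v * m%:Z + 1 by rewrite -ev subrK.
  transitivity (m%:Z * v * i * (h' * h) + i - u%:Z * i); first by rewrite /c; ring.
  have -> : h' * h = 1 - k * (p ^ e)%N%:Z by rewrite -ek addrK.
  by rewrite qE PoszM uE; ring.
pose F (a : int) := jac (i + a * h).
have Fper a : F (a + q%:Z) = F a.
  rewrite /F /jac; congr (_%:~R); apply: (@jacobi_mod_sub _ _ h); ring.
set S := \sum_(_ <= _ < _) _.
have : S = - S.
  rewrite {1}/S -(psum_shift q0 Fper c).
  rewrite -(@psum_dilate _ q (fun a => F (c + a)) q0 _ u%:Z) //; last first.
    by move=> a; rewrite addrA Fper.
  rewrite -sumrN; apply: eq_bigr => a _.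
  by rewrite /F (addrC c) key.
by move/eqP; rewrite -subr_eq0 opprK -mulr2n mulrn_eq0 /= => /eqP.
Qed.

Definition shift_sum (J : nat) (i a : int) : R := \sum_(0 <= j < J) jac (i + a * j%:Z).

Lemma shift_sum_perL J i a : shift_sum J (i + q%:Z) a = shift_sum J i a.
Proof. by apply: eq_bigr => j _; rewrite addrAC jac_per. Qed.

Definition variance (J : nat) : R := \sum_(0 <= i < q) shift_sum J i%:Z 1 ^+ 2.

Lemma variance_ge0 J : 0 <= variance J.
Proof. by apply: sumr_ge0 => i _; apply: sqr_ge0. Qed.

Lemma variance_dilate J a : coprime a q ->
  \sum_(0 <= i < q) shift_sum J i%:Z a%:Z ^+ 2 = variance J.
Proof.
move=> ca; have q0 := q_gt0.
rewrite -(@psum_dilate _ q (fun i => shift_sum J i a%:Z ^+ 2) q0 _ a%:Z) //; last first.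
  by move=> i; rewrite shift_sum_perL.
apply: eq_bigr => i _.
have -> : shift_sum J (a%:Z * i%:Z) a%:Z = jac a%:Z * shift_sum J i%:Z 1.
  by rewrite /shift_sum mulr_sumr; apply: eq_bigr => j _; rewrite -jacM mul1r mulrDr.
by rewrite exprMn /jac -rmorphXn /= jacobi_sqr ?mul1r // q_gt0.
Qed.

Lemma sum_units_le (f : nat -> R) (v : R) : (forall a, 0 <= f a) ->
  (forall a, coprime a q -> f a = v) ->
  (totient q)%:R * v <= \sum_(0 <= a < q) f a.
Proof.
move=> f0 fv; rewrite totient_count_coprime natr_sum mulr_suml.
by apply: ler_sum => a _; case: (boolP (coprime q a)) => h; rewrite ?mul1r ?mul0r // fv // coprime_sym.
Qed.

(** Dilation by a unit [a] preserves the variance. Summing over units and enlarging to all residues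
    [a], the opened square contains, for [j1] and [j2] distinct, sums over progressions of
    difference [j2 - j1], which vanish because the core is large. Only the diagonal [J q ^ 2]
    remains. *)
Lemma variance_bound J : large_core q J -> (totient q)%:R * variance J <= (J * q ^ 2)%:R.
Proof.
move=> lc; have q0 := q_gt0.
apply: le_trans (sum_units_le (f := fun a => \sum_(0 <= i < q) shift_sum J i%:Z a%:Z ^+ 2) _ _) _.
- by move=> a; apply: sumr_ge0 => i _; apply: sqr_ge0.
- by move=> a ca; apply: variance_dilate.
have -> : \sum_(0 <= a < q) \sum_(0 <= i < q) shift_sum J i%:Z a%:Z ^+ 2 =
    \sum_(0 <= j1 < J) \sum_(0 <= j2 < J) \sum_(0 <= a < q) \sum_(0 <= i < q)
      jac (i%:Z + a%:Z * j1%:Z) * jac (i%:Z + a%:Z * j2%:Z).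
  rewrite [RHS](eq_bigr (fun j1 => \sum_(0 <= a < q) \sum_(0 <= i < q) \sum_(0 <= j2 < J)
      jac (i%:Z + a%:Z * j1%:Z) * jac (i%:Z + a%:Z * j2%:Z))); last first.
    move=> j1 _; rewrite exchange_big /=; apply: eq_bigr => a _.
    by rewrite exchange_big.
  rewrite [RHS]exchange_big /=; apply: eq_bigr => a _.
  rewrite [RHS]exchange_big /=; apply: eq_bigr => i _.
  by rewrite expr2 /shift_sum mulr_suml; apply: eq_bigr => j1 _; rewrite mulr_sumr.
have step j1 j2 : (j1 < J)%N -> (j2 < J)%N ->
   \sum_(0 <= a < q) \sum_(0 <= i < q) jac (i%:Z + a%:Z * j1%:Z) * jac (i%:Z + a%:Z * j2%:Z)
     <= if j1 == j2 then (q ^ 2)%:R else 0.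
  move=> l1 l2; case: eqVneq => [_|ne].
    apply: le_trans (ler_norm _) _; apply: le_trans (ler_norm_sum _ _ _) _.
    apply: (@le_trans _ _ (\sum_(0 <= a < q) q%:R)); last first.
      by rewrite sumr_const_nat subn0 -mulnn mulrnA.
    apply: ler_sum => a _; apply: le_trans (ler_norm_sum _ _ _) _.
    apply: (@le_trans _ _ (\sum_(0 <= i < q) 1)); last by rewrite sumr_const_nat subn0.
    by apply: ler_sum => i _; rewrite normrM mulr_ile1 ?jac_norm.
  have [p [pp op np]] : exists p, [/\ prime p, odd (logn p q) & ~~ (p%:Z %| j2%:Z - j1%:Z)%Z].
    have [|p [pp op np]] := lc `|(j2%:Z - j1%:Z)%R|%N; first by clear -ne l1 l2; lia.
    by exists p; split=> //; rewrite dvdzE.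
  rewrite (eq_bigr (fun a => \sum_(0 <= i < q) jac i%:Z * jac (i%:Z + a%:Z * (j2%:Z - j1%:Z)))).
    rewrite exchange_big big1 //= => i _.
    by rewrite -mulr_sumr (jac_progression_sum _ pp op np) mulr0.
  move=> a _.
  rewrite -(@psum_shift _ q (fun i => jac i * jac (i + a%:Z * (j2%:Z - j1%:Z))) q0 _ (a%:Z * j1%:Z)); last first.
    by move=> i; rewrite jac_per addrAC jac_per.
  apply: eq_bigr => i _; rewrite addrC; congr (_ * jac _); ring.
apply: (@le_trans _ _ (\sum_(0 <= j1 < J) \sum_(0 <= j2 < J) if j1 == j2 then (q ^ 2)%:R else 0)).
  rewrite big_nat [leRHS]big_nat; apply: ler_sum => j1 /andP [_ l1].
  by rewrite big_nat [leRHS]big_nat; apply: ler_sum => j2 /andP [_ l2]; apply: step.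
rewrite (eq_big_nat _ _ (F2 := fun _ => (q ^ 2)%:R)); last first.
  move=> j1 hj; rewrite (bigD1_seq j1) ?iota_uniq ?mem_index_iota //= eqxx big1 ?addr0 // => j2.
  by rewrite eq_sym => /negbTE ->.
by rewrite sumr_const_nat subn0 -mulrnA mulnC.
Qed.

Lemma variance_le J : large_core q J -> variance J <= (tau q * J * q)%:R.
Proof.
move=> lc; have q0 := q_gt0; have := variance_bound lc.
have qR : 0 < q%:R :> R by rewrite ltr0n.
have h : q%:R <= (totient q)%:R * (tau q)%:R :> R by rewrite -natrM ler_nat leq_totient_tau.
move=> h2; rewrite -(ler_pM2l qR).
apply: le_trans (ler_wpM2r (variance_ge0 J) h) _.
rewrite mulrAC mulrC; apply: le_trans (ler_wpM2l (ler0n _ (tau q)) h2) _.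
by rewrite -!natrM ler_nat; apply: eq_leq; ring.
Qed.

Lemma jac_sum_shift (s : int) T j :
  `|\sum_(0 <= i < T) jac (s + i%:Z + j%:Z) - \sum_(0 <= i < T) jac (s + i%:Z)| <= (2 * j)%:R.
Proof.
elim: j => [|j IH].
  rewrite (eq_bigr (fun i : nat => jac (s + i%:Z))) ?subrr ?normr0 // => i _.
  by rewrite addr0.
have step : `|\sum_(0 <= i < T) jac (s + i%:Z + j.+1%:Z) - \sum_(0 <= i < T) jac (s + i%:Z + j%:Z)| <= 2%:R.
  have -> : \sum_(0 <= i < T) jac (s + i%:Z + j.+1%:Z) = \sum_(0 <= i < T) jac (s + i.+1%:Z + j%:Z).
    by apply: eq_bigr => i _; congr jac; lia.
  rewrite -sumrB telescope_sumr //.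
  apply: le_trans (ler_normB _ _) _; rewrite -[2%:R]/(1 + 1 : R).
  by apply: lerD; apply: jac_norm.
rewrite -(subrK (\sum_(0 <= i < T) jac (s + i%:Z + j%:Z)) (\sum_(0 <= i < T) jac (s + i%:Z + j.+1%:Z))) -addrA.
apply: le_trans (ler_normD _ _) _.
by rewrite mulnS natrD lerD.
Qed.

(** Moving the interval by [j < J] changes the sum by at most [2 J], so [J] times the sum is within
    [2 J ^ 2] of [D]. Cauchy's inequality bounds [D] by the variance, counted once for each of at
    most [T / q + 1] periods. *)
Lemma interval_char_sum (s : int) (T J B : nat) : large_core q J -> (0 < J)%N ->
  (T * (T + q) * tau q <= J * B ^ 2)%N ->
  `|\sum_(0 <= i < T) jac (s + i%:Z)| <= (2 * J + B)%:R.
Proof.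
move=> lc J0 hB; have q0 := q_gt0.
pose D := \sum_(0 <= i < T) shift_sum J (s + i%:Z) 1.
have JR : 0 < J%:R :> R by rewrite ltr0n.
have h1 : `|J%:R * \sum_(0 <= i < T) jac (s + i%:Z) - D| <= (2 * J * J)%:R.
  have -> : J%:R * \sum_(0 <= i < T) jac (s + i%:Z) = \sum_(0 <= j < J) \sum_(0 <= i < T) jac (s + i%:Z).
    by rewrite sumr_const_nat subn0 mulr_natl.
  rewrite /D /shift_sum [X in _ - X]exchange_big /= -sumrB; apply: le_trans (ler_norm_sum _ _ _) _.
  apply: (@le_trans _ _ (\sum_(0 <= j < J) (2 * J)%:R)); last first.
    by rewrite sumr_const_nat subn0 -mulrnA.
  rewrite [leLHS]big_nat [leRHS]big_nat; apply: ler_sum => j /andP [_ jJ].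
  rewrite distrC; under eq_bigr => i _ do rewrite mul1r.
  apply: le_trans (jac_sum_shift s T j) _.
  by rewrite ler_nat leq_mul2l ltnW.
have h2 : D ^+ 2 <= (J * B)%:R ^+ 2.
  have c := @sum_cauchy R _ (index_iota 0 T) (fun _ => 1) (fun i => shift_sum J (s + i%:Z) 1).
  have D1 : \sum_(0 <= i < T) 1 * shift_sum J (s + i%:Z) 1 = D by apply: eq_bigr => i _; rewrite mul1r.
  rewrite D1 in c; apply: le_trans c _.
  have -> : \sum_(0 <= i < T) (1 : R) ^+ 2 = T%:R by rewrite expr1n sumr_const_nat subn0.
  pose t := (T %/ q).+1.
  have Tt : (T <= t * q)%N by rewrite ltnW // -ltn_divLR.
  have le1 : \sum_(0 <= i < T) shift_sum J (s + i%:Z) 1 ^+ 2 <= t%:R * variance J.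
    apply: (@le_trans _ _ (\sum_(0 <= i < t * q) shift_sum J (s + i%:Z) 1 ^+ 2)).
      rewrite [leRHS](big_cat_nat (n := T)) //= lerDl; apply: sumr_ge0 => i _; exact: sqr_ge0.
    rewrite (@psum_mult _ q (fun i => shift_sum J (s + i) 1 ^+ 2) q0); last first.
      by move=> i; rewrite addrA shift_sum_perL.
    rewrite (@psum_shift _ q (fun i => shift_sum J i 1 ^+ 2) q0); last first.
      by move=> i; rewrite shift_sum_perL.
    by rewrite mulr_natl.
  apply: le_trans (ler_wpM2l (ler0n _ T) le1) _.
  apply: le_trans (ler_wpM2l (ler0n _ T) (ler_wpM2l (ler0n _ t) (variance_le lc))) _.
  rewrite -natrX -!natrM ler_nat.
  have tq : (t * q <= T + q)%N by rewrite /t mulSn addnC leq_add2r leq_trunc_div.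
  apply: (@leq_trans (J * (T * (T + q) * tau q))).
    have -> : (T * (t * (tau q * J * q)) = J * (T * (t * q) * tau q))%N by ring.
    by rewrite leq_mul2l leq_mul2r leq_mul2l tq !orbT.
  apply: leq_trans (leq_mul (leqnn J) hB) _; apply: eq_leq; ring.
have h3 : `|D| <= (J * B)%:R.
  rewrite -(@ler_pXn2r _ 2) ?nnegrE //.
  by rewrite real_normK ?num_real.
rewrite -(ler_pM2l JR) -{1}[J%:R]ger0_norm // -normrM.
rewrite -(subrK D (J%:R * _)); apply: le_trans (ler_normD _ _) _.
apply: le_trans (lerD h1 h3) _.
by rewrite -natrD -natrM ler_nat; apply: eq_leq; ring.
Qed.
End CharSum.

Lemma nat_threshold (P : pred nat) n : (forall i j, (i <= j)%N -> P j -> P i) ->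
  (forall i, (n <= i)%N -> ~~ P i) -> exists T, (T <= n)%N /\ forall i, P i = (i < T)%N.
Proof.
move=> hP; elim: n => [|n IH] hn.
  by exists 0%N; split=> // i; apply/negbTE/hn.
have [Pn|nPn] := boolP (P n); last first.
  have [i|T [hT hi]] := IH; last by exists T; split=> //; apply: leq_trans hT _.
  by rewrite leq_eqVlt => /orP [/eqP <- //|]; apply: hn.
exists n.+1; split=> // i; rewrite ltnS; apply/idP/idP => [Pi|/hP]; last exact.
by rewrite leqNgt; apply: contraL Pi; apply: hn.
Qed.

(* Stated through [q = c * f ^ 2] with [c < J], not necessarily squarefree. *)
Definition small_core (q J : nat) : bool :=
  has (fun f => (f ^ 2 %| q) && (q %/ f ^ 2 < J))%N (iota 1 q).

Lemma coprime_prod_primes (s : seq nat) p : prime p -> all prime s -> p \notin s ->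
  coprime p (\prod_(q <- s) q).
Proof.
move=> pp; elim: s => [|q s IH] /=; first by rewrite big_nil coprimen1.
move=> /andP [pq as_]; rewrite inE negb_or => /andP [npq nps].
by rewrite big_cons coprimeMr IH // andbT prime_coprime // dvdn_prime2.
Qed.

Lemma prod_primes_dvd (s : seq nat) (h : nat) : uniq s -> all prime s ->
  all (fun p => p %| h)%N s -> (\prod_(p <- s) p %| h)%N.
Proof.
elim: s => [|p s IH] /=; first by rewrite big_nil dvd1n.
move=> /andP [ps us] /andP [pp as_] /andP [ph hs]; rewrite big_cons.
by rewrite Gauss_dvd ?ph ?IH // coprime_prod_primes.
Qed.

(** Write [q = c f ^ 2] with [c] the product of the primes of odd exponent. A shift below [J]
    divisible by all these primes is a multiple of [c], so [c < J]. *)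
Lemma small_or_large_core q J : (0 < q)%N -> small_core q J \/ large_core q J.
Proof.
move=> q0; have [|/hasPn h] := boolP (small_core q J); first by left.
right=> n /andP [n0 nJ].
pose s := [seq p <- primes q | odd (logn p q)].
have [/allP ha|/allPn [p]] := boolP (all (fun p => p %| n)%N s); last first.
  rewrite mem_filter mem_primes => /andP [op /and3P [pp _ _]] np; by exists p.
exfalso; set c := (\prod_(p <- s) p)%N.
have sp : all prime s by apply/allP => p; rewrite mem_filter mem_primes => /andP [_ /and3P []].
have cn : (c %| n)%N by apply: prod_primes_dvd => //; [rewrite filter_uniq ?primes_uniq|apply/allP].
pose f := (\prod_(p <- primes q) p ^ (logn p q)./2)%N.
have qE : (q = c * f ^ 2)%N.
  rewrite {1}(prod_prime_decomp q0) prime_decompE big_map /= /c big_filter -mulnn [X in (X * _)%N]big_mkcond -!big_split /=.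
  apply: eq_bigr => p _; rewrite -expnD addnn -[in LHS](odd_double_half (logn p q)) expnD.
  by case: odd; rewrite ?expn1 ?expn0.
have f0 : (0 < f)%N by move: q0; rewrite qE muln_gt0 expn_gt0 => /andP [_ /orP []].
have fq : f \in iota 1 q.
  rewrite mem_iota f0 add1n ltnS {1}qE; have c0 : (0 < c)%N := dvdn_gt0 n0 cn.
  by rewrite -mulnn mulnA leq_pmull // muln_gt0 c0.
have := h f fq; rewrite {1}qE dvdn_mull //= {1}qE mulnK ?expn_gt0 ?f0 // -leqNgt leqNgt.
by rewrite (leq_ltn_trans (dvdn_leq n0 cn) nJ).
Qed.

Lemma count_dvd_interval d X : (0 < d)%N ->
  (count (fun q => d %| q)%N (index_iota 1 X.+1) = X %/ d)%N.
Proof.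
move=> d0; rewrite -sum1_count big_mkcond /=.
elim: X => [|X IH]; first by rewrite big_geq // div0n.
by rewrite big_nat_recr //= IH divnS // addnC; case: ifP.
Qed.

Lemma sum_div_squares X F n : (0 < F)%N ->
  (F * \sum_(F.+1 <= f < n.+1) X %/ f ^ 2 <= X)%N.
Proof.
move=> F0; case: (leqP n F) => nF; first by rewrite big_geq // muln0.
(* This form carries the induction: cleared of denominators, it is the telescoping bound
   [1 / F - 1 / m] for the sum of [1 / f ^ 2] over [F < f <= m]. *)
have h m : (F <= m)%N -> (F * m * \sum_(F.+1 <= f < m.+1) X %/ f ^ 2 <= X * (m - F))%N.
  elim: m => [|m IH]; first by rewrite leqn0 => /eqP F00; rewrite F00 in F0.
  rewrite leq_eqVlt => /orP [/eqP <-|]; first by rewrite big_geq // muln0.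
  rewrite ltnS => Fm; have hIH := IH Fm; rewrite big_nat_recr //=; move: hIH.
  have hq : (X %/ m.+1 ^ 2 * (m.+1 * m.+1) <= X)%N by rewrite mulnn leq_trunc_div.
  move: (X %/ m.+1 ^ 2)%N (\sum_(_ <= _ < _) _)%N hq => u S hq hS.
  have m0 : (0 < m)%N by apply: leq_trans Fm.
  rewrite -(leq_pmul2l m0).
  have -> : (m * (F * m.+1 * (S + u)) = m.+1 * (F * m * S) + F * m * (m.+1 * u))%N by ring.
  apply: (@leq_trans (m.+1 * (X * (m - F)) + F * X)%N).
    apply: leq_add; first by rewrite leq_mul2l hS orbT.
    rewrite -mulnA leq_mul2l; apply/orP; right; apply: leq_trans hq.
    apply: (@leq_trans (m.+1 * (m.+1 * u))); first by rewrite leq_mul2r leqnSn orbT.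
    by apply: eq_leq; ring.
  apply: eq_leq; rewrite subSn // -(subnK Fm); move: (m - F)%N => e; rewrite addnK; ring.
have := h n (ltnW nF); have n0 : (0 < n)%N by apply: leq_trans nF.
move=> hn; rewrite -(leq_pmul2l n0); apply: (@leq_trans (X * (n - F))); last first.
  by rewrite mulnC leq_mul2r leq_subr orbT.
by apply: leq_trans hn; rewrite mulnA [(n * F)%N]mulnC.
Qed.

(** If [q > X / G] is [c f ^ 2] with [c < J], then [F ^ 2 J G <= X] forces [f > F], and the
    multiples of such squares are sparse. *)
Lemma count_small_core X J F G : (0 < F)%N -> (0 < G)%N -> (F ^ 2 * J * G <= X)%N ->
  (count (fun q => small_core q J) (index_iota 1 X.+1) <= X %/ G + X %/ F)%N.
Proof.
move=> F0 G0 hF.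
apply: (@leq_trans (count (fun q => q <= X %/ G)%N (index_iota 1 X.+1) +
   \sum_(F.+1 <= f < X.+1) count (fun q => f ^ 2 %| q)%N (index_iota 1 X.+1))).
  have -> : (\sum_(F.+1 <= f < X.+1) count (fun q => f ^ 2 %| q)%N (index_iota 1 X.+1) =
     \sum_(1 <= q < X.+1) \sum_(F.+1 <= f < X.+1) (f ^ 2 %| q))%N.
    rewrite exchange_big /=; apply: eq_bigr => f _; rewrite -sum1_count big_mkcond /=.
    by apply: eq_bigr => q _; case: ifP.
  rewrite -!sum1_count [leqLHS]big_mkcond [X in (_ <= X + _)%N]big_mkcond -big_split /=.
  rewrite big_nat [leqRHS]big_nat; apply: leq_sum => q /andP [q0 qX].
  case: ifP => // /hasP [f]; rewrite mem_iota => hf /andP [df lf].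
  case: (leqP q (X %/ G)) => // hq; rewrite (bigD1_seq f) ?iota_uniq ?df //= mem_index_iota.
  have fq : (f <= q)%N by clear -hf; lia.
  rewrite (leq_ltn_trans fq) // andbT -(ltn_exp2r _ _ (isT : 0 < 2)%N).
  have f20 : (0 < f ^ 2)%N by rewrite expn_gt0; clear -hf; lia.
  have hX : (X < q * G)%N by rewrite -ltn_divLR.
  have qE : (q = q %/ f ^ 2 * f ^ 2)%N by rewrite divnK.
  rewrite ltnNge; apply/negP => hle; move: hF; rewrite leqNgt => /negP; apply.
  apply: (leq_trans hX); rewrite leq_mul2r qE mulnC; apply/orP; right.
  by apply: leq_mul => //; apply: ltnW.
apply: leq_add.
  rewrite -size_filter -[leqRHS](size_iota 1); apply: uniq_leq_size.
    by rewrite filter_uniq ?iota_uniq.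
  by move=> q; rewrite mem_filter mem_index_iota mem_iota add1n !ltnS => /andP [hq /andP [h1 _]]; rewrite h1 hq.
rewrite leq_divRL // mulnC.
under eq_big_nat => f /andP [hf _].
  rewrite count_dvd_interval; last by rewrite expn_gt0 (leq_ltn_trans _ hf).
  over.
exact: sum_div_squares.
Qed.

(** * Type I sums for one Gaussian divisor *)

Section TypeI.
Variables (R : realFieldType) (X X0 : nat) (z : gint).
Hypothesis XX0 : (X <= X0 ^ 2)%N.
Hypothesis nz : gnormal z.
Hypothesis pz : gprim z.
Let d := gabs2 z.

(** The divisibility concerns the imaginary part of [t] times the conjugate of [z]. It is the linear
    form of the condition that [z] divides [t]: with [t.1] fixed, it puts [t.2] in one residue
    class. *)
Definition lattice_cond (t : gint) : bool :=
  [&& inO X t, gpar t & (d%:Z %| t.2 * z.1 - t.1 * z.2)%Z].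

Definition row_sum (x : int) : R :=
  \sum_(y <- ibox X0 | lattice_cond (x, y)) (spin (x, y))%:~R.

Lemma inO_bound t : inO X t -> (`|t.2| <= X0)%N.
Proof.
move=> /and3P [_ _ h]; have := mem_gbox_gabs2 (leq_trans h XX0).
by rewrite mem_gbox => /andP [].
Qed.

(** [z.1] is invertible modulo [2 d], so parity and divisibility together say that [y] lies in one
    class modulo [2 d]. The norm grows with positive [y], hence the region keeps an initial segment
    of the progression. *)
Lemma row_eq (x : int) : 0 < x -> odd `|x| ->
  exists y0 T, [/\ 0 < y0, (d%:Z %| y0 * z.1 - x * z.2)%Z, (T <= X0 %/ (2 * d) + 1)%N &
    row_sum x = \sum_(0 <= i < T) (jacobi (y0 + (2 * d)%N%:Z * i%:Z) `|x|)%:~R].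
Proof.
move=> x0 ox; have od : odd d := gnormal_odd nz.
have d0 : (0 < d)%N by clear -od; lia.
have /and3P [z10 oz1 ez2] := nz.
have [b2 eb2] := even_absz ez2.
have c1 : coprime `|z.1| (2 * d) by rewrite coprimeMr coprimen2 oz1 gprim_coprime_gabs2.
have [a' [k ea']] : exists a' k, a' * z.1 + k * (2 * d)%N%:Z = 1.
  have [u [v e1]] := Bezoutz z.1 (2 * d)%N; exists u, v; rewrite e1.
  by move: c1; rewrite /coprime /gcdz => /eqP ->.
set D := (2 * d)%N in c1 ea' *.
have D0 : (0 < D)%N by rewrite muln_gt0.
have Dz : D%:Z != 0 by clear -D0; lia.
pose r := ((a' * x * z.2) %% D%:Z)%Z.
have r0 : 0 <= r by apply: modz_ge0.
have rD : r < D%:Z by rewrite ltz_mod.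
(* The region requires a positive second coordinate, so the class of 0 starts at [D]. *)
pose y0 := if r == 0 then D%:Z else r.
have y00 : 0 < y0 by rewrite /y0; case: eqP => [_|h]; [rewrite ltz_nat|rewrite lt_def r0 andbT; apply/eqP].
have y0D : y0 <= D%:Z by rewrite /y0; case: eqP => // _; rewrite ltW.
have [k0 ek0] : exists k0, y0 = a' * x * z.2 + D%:Z * k0.
  have e := divz_eq (a' * x * z.2) D; rewrite /y0 -/r in e *; move: ((_ %/ _)%Z) e => q e.
  case: eqP => [r00|_]; [exists (1 - q)|exists (- q)]; rewrite e ?r00; ring.
have DE : D%:Z = 2 * d%:Z by rewrite /D PoszM.
have condE y : (~~ odd `|y| && (d%:Z %| y * z.1 - x * z.2)%Z) = (D%:Z %| y - y0)%Z.
  apply/idP/idP => [/andP [ey dy]|/dvdzP [m em]].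
    have [y2 ey2] := even_absz ey; have /dvdzP [m em] := dy.
    have : (2 %| m * d%:Z)%Z.
      by apply/dvdzP; exists (y2 * z.1 - x * b2); rewrite -em ey2 eb2; ring.
    rewrite dvdzE abszM /= dvdn2 oddM od andbT => /even_absz [m2 em2].
    apply/dvdzP; exists (a' * m2 + k * y - k0).
    have yE : y = a' * (y * z.1 - x * z.2) + a' * x * z.2 + k * y * D%:Z.
      by transitivity (y * (a' * z.1 + k * D%:Z)); [rewrite ea' mulr1|ring].
    by rewrite {1}yE ek0 em em2 DE; ring.
  have yE : y = a' * x * z.2 + D%:Z * (k0 + m) by rewrite -(subrK y0 y) em ek0; ring.
  apply/andP; split.
    rewrite -dvdn2 -[(2 %| _)%N]/(2 %| y)%Z yE DE eb2.
    by apply/dvdzP; exists (a' * x * b2 + d%:Z * (k0 + m)); ring.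
  apply/dvdzP; exists (2 * (k0 + m) * z.1 - 2 * k * x * z.2).
  have h : a' * z.1 = 1 - k * D%:Z by rewrite -ea' addrK.
  transitivity (a' * z.1 * x * z.2 + D%:Z * (k0 + m) * z.1 - x * z.2); first by rewrite yE; ring.
  by rewrite h DE; ring.
pose Q (i : nat) := (gabs2 (x, (y0 + D%:Z * i%:Z)%R) <= X)%N.
have Qmono i j : (i <= j)%N -> Q j -> Q i.
  move=> ij; apply: leq_trans; rewrite -lez_nat !gabs2E /= lerD2l.
  have pos n : 0 <= y0 + D%:Z * n%:Z by rewrite addr_ge0 ?mulr_ge0 // ltW.
  by rewrite lerXn2r ?nnegrE ?pos // lerD2l ler_wpM2l // lez_nat.
have Qlarge i : (X0 %/ D + 1 <= i)%N -> ~~ Q i.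
  move=> hi; apply/negP => hX.
  have := mem_gbox_gabs2 (leq_trans hX XX0); rewrite mem_gbox /= => /andP [_].
  have hl : (X0 < D * i)%N.
    apply: (@leq_trans (D * (X0 %/ D).+1)); last by rewrite leq_mul2l -addn1 hi orbT.
    by rewrite mulnC ltn_ceil.
  rewrite leqNgt => /negP; apply; move: hl; rewrite -ltz_nat PoszM => hl.
  by clear -hl y00; lia.
have [T [hT hTi]] := nat_threshold Qmono Qlarge.
exists y0, T; split=> //.
  by have := condE y0; rewrite subrr dvdz0 => /andP [].
rewrite /row_sum; have P i : inO X (x, y0 + D%:Z * i%:Z) = (i < T)%N.
  rewrite -hTi /inO /= x0; suff -> : 0 < y0 + D%:Z * i%:Z by [].
  by rewrite ltr_pwDl // mulr_ge0.
have pe : perm_eq [seq y <- ibox X0 | lattice_cond (x, y)] [seq y0 + D%:Z * i%:Z | i <- index_iota 0 T].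
  apply: uniq_perm.
  - by rewrite filter_uniq ?ibox_uniq.
  - rewrite map_inj_uniq ?iota_uniq // => i j /addrI /(mulfI Dz) [] //.
  move=> y; rewrite mem_filter mem_ibox /lattice_cond /gpar /= ox /=.
  apply/idP/mapP => [/andP [/andP [iO hc] yb]|[i]].
    rewrite condE in hc; have /dvdzP [m em] := hc.
    have m0 : 0 <= m.
      have y_0 : 0 < y by case/and3P: iO.
      have : - D%:Z < m * D%:Z by rewrite -em; lra.
      by rewrite -mulN1r ltr_pM2r ?ltz_nat //; clear; lia.
    have yE : y = y0 + D%:Z * `|m|%N%:Z by rewrite gez0_abs // mulrC -em addrC subrK.
    exists `|m|%N => //; rewrite mem_index_iota /= -P -yE //.
  rewrite mem_index_iota /= -P => hi ->; rewrite hi condE /= addrC addKr dvdz_mulr //=.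
  exact: inO_bound hi.
rewrite -big_filter (perm_big _ pe) big_map; apply: eq_bigr => i _.
by rewrite /spin.
Qed.

Lemma row_trivial x : `|row_sum x| <= (X0 %/ (2 * d) + 1)%N%:R.
Proof.
have [/andP [x0 ox]|h] := boolP ((0 < x) && odd `|x|); last first.
  rewrite /row_sum big1 ?normr0 ?ler0n // => y /and3P [/and3P [/= x0 _ _] /andP [/= ox _] _].
  by rewrite x0 ox in h.
have [y0 [T [_ _ hT ->]]] := row_eq x0 ox.
apply: le_trans (@norm_sum_le_size _ _ (index_iota 0 T) _ 1 _) _.
  by move=> i _; rewrite -intr_norm lerz1 jacobi_norm.
by rewrite size_iota subn0 mulr1 ler_nat.
Qed.

(** If [x] is coprime to [2 d], dividing by [2 d] modulo [x] turns the progression into an interval.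
    Otherwise, [x] being odd, some prime divides [x] and [d], hence [y0], and every term is 0. *)
Lemma row_bound x J B (T := (X0 %/ (2 * d) + 1)%N) : 0 < x -> odd `|x| -> large_core `|x| J -> (0 < J)%N ->
  (T * (T + `|x|) * tau `|x| <= J * B ^ 2)%N -> `|row_sum x| <= (2 * J + B)%:R.
Proof.
move=> x0 ox lc J0 hB; have [y0 [T' [y00 dy0 hT ->]]] := row_eq x0 ox.
have q0 : (0 < `|x|)%N by clear -ox; lia.
have od : odd d := gnormal_odd nz.
have [cop|ncop] := boolP (coprime `|x| (2 * d)).
  have [e [k ek]] : exists e k, e * (2 * d)%N%:Z + k * `|x|%N%:Z = 1.
    have [u [v e1]] := Bezoutz (2 * d)%N `|x|%N; exists u, v; rewrite e1.
    by move: cop; rewrite coprime_sym /coprime /gcdz => /eqP ->.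
  have -> : \sum_(0 <= i < T') (jacobi (y0 + (2 * d)%N%:Z * i%:Z) `|x|)%:~R =
     jac R `|x| (2 * d)%N * \sum_(0 <= i < T') jac R `|x| (e * y0 + i%:Z).
    rewrite mulr_sumr; apply: eq_bigr => i _; rewrite -jacM // /jac; congr (_%:~R).
    apply: (@jacobi_mod_sub _ _ (k * y0)).
    transitivity (y0 - (e * (2 * d)%N%:Z) * y0); first by ring.
    have -> : e * (2 * d)%N%:Z = 1 - k * `|x|%N%:Z by rewrite -ek addrK.
    by ring.
  rewrite normrM -[leRHS]mul1r; apply: ler_pM => //; first exact: jac_norm.
  apply: interval_char_sum => //; apply: leq_trans hB.
  by rewrite leq_mul2r; apply/orP; right; apply: leq_mul => //; rewrite leq_add2r.
have [p [pp]] := @not_coprime_prime `|x|%N (2 * d)%N ncop.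
rewrite !dvdzE /= => px pd2.
have pd : (p %| d)%N.
  move: pd2; rewrite Euclid_dvdM // => /orP [p2|//].
  have p2' : p = 2%N by move: p2; rewrite dvdn_prime2 // => /eqP.
  by move: px; rewrite p2' dvdn2 ox.
have py0 : (p%:Z %| y0)%Z.
  have : (p%:Z %| y0 * z.1)%Z.
    have -> : y0 * z.1 = (y0 * z.1 - x * z.2) + z.2 * x by ring.
    rewrite rpredD //; first by apply: dvdz_trans dy0; rewrite dvdzE.
    by rewrite dvdz_mull // dvdzE.
  rewrite dvdzE abszM Euclid_dvdM // => /orP [py|pz1]; first by rewrite dvdzE.
  by have := gprim_prime_dvd1 pz pp pd; rewrite dvdzE pz1.
rewrite big1 ?normr0 ?ler0n // => i _.
rewrite (@jacobi_eq0_prime _ _ p) // rpredD // dvdz_mulr // dvdzE /=.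
Qed.

Lemma typeI_sum J B F G Y (T := (X0 %/ (2 * d) + 1)%N) :
  (0 < J)%N -> (0 < F)%N -> (0 < G)%N -> (F ^ 2 * J * G <= X0)%N ->
  (forall n, (0 < n <= X0)%N -> (tau n <= Y)%N) ->
  (T * (T + X0) * Y <= J * B ^ 2)%N ->
  `|\sum_(t <- gbox X0 | lattice_cond t) (spin t)%:~R : R| <=
    (X0 * (2 * J + B) + (X0 %/ G + X0 %/ F) * T)%:R.
Proof.
move=> J0 F0 G0 hF hY hB.
have -> : \sum_(t <- gbox X0 | lattice_cond t) (spin t)%:~R = \sum_(1 <= x < X0.+1) row_sum x%:Z :> R.
  rewrite big_mkcond big_allpairs /=.
  transitivity (\sum_(x <- ibox X0) row_sum x).
    by apply: eq_bigr => x _; rewrite /row_sum [RHS]big_mkcond.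
  rewrite (bigID (fun x : int => 0 < x)) /= addrC big1 ?add0r; last first.
    move=> x x0; rewrite /row_sum big1 // => y /and3P [/and3P [/= h _ _] _ _].
    by rewrite h in x0.
  rewrite -big_filter; have pe : perm_eq [seq x <- ibox X0 | 0 < x] [seq i%:Z | i <- index_iota 1 X0.+1].
    apply: uniq_perm; rewrite ?filter_uniq ?ibox_uniq ?map_inj_uniq ?iota_uniq //.
      by move=> i j [].
    move=> x; rewrite mem_filter mem_ibox; apply/andP/mapP => [[x0 hx]|[i + ->]].
      by exists `|x|%N; rewrite ?mem_index_iota; clear -x0 hx; lia.
    by rewrite mem_index_iota; clear; lia.
  by rewrite (perm_big _ pe) big_map.
apply: le_trans (ler_norm_sum _ _ _) _.
apply: (@le_trans _ _ (\sum_(1 <= x < X0.+1) ((2 * J + B)%:R + (if small_core x J then T%:R else 0)))).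
  rewrite big_nat [leRHS]big_nat; apply: ler_sum => x hx.
  case: ifP => hs.
    by apply: le_trans (row_trivial _) _; rewrite lerDr.
  rewrite addr0; have [ox|ex] := boolP (odd x); last first.
    rewrite /row_sum big1 ?normr0 ?ler0n // => y /and3P [_ /andP [/= ox _] _].
    by rewrite ox in ex.
  have x0 : (0 < x)%N by case/andP: hx.
  have lc : large_core x J by case: (small_or_large_core J x0); rewrite ?hs.
  apply: row_bound => //=; apply: leq_trans hB; apply: leq_mul.
    by rewrite leq_mul2l leq_add2l; apply/orP; right; case/andP: hx.
  by apply: hY; rewrite x0; case/andP: hx.
rewrite big_split /= sumr_const_nat subn1 /= [leRHS]natrD; apply: lerD.
  by rewrite [leRHS]natrM [leRHS]mulr_natl.
rewrite -big_mkcond /=; apply: le_trans (sum_le_count _ (fun _ _ => lexx _)) _.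
rewrite natrM; apply: ler_wpM2r => //; rewrite ler_nat.
exact: count_small_core.
Qed.
End TypeI.

(** * Bounds in powers of a parameter *)
Section PowerBounds.
Local Open Scope nat_scope.
Variable y : nat.
Hypothesis y10 : 10 <= y.

Lemma ypow_le a b : a <= b -> y ^ a <= y ^ b.
Proof. by move=> ab; rewrite leq_pexp2l //; apply: leq_trans y10. Qed.

Lemma ypow_gt0 a : 0 < y ^ a.
Proof. by rewrite expn_gt0; apply/orP; left; apply: leq_trans y10. Qed.

Lemma ypow_mul u v a b : u <= y ^ a -> v <= y ^ b -> u * v <= y ^ (a + b).
Proof. by move=> hu hv; rewrite expnD leq_mul. Qed.

Lemma ypow_scale c u a : c <= 10 -> u <= y ^ a -> c * u <= y ^ a.+1.
Proof. by move=> hc hu; rewrite expnS leq_mul // (leq_trans hc). Qed.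

Lemma ypow_add u v a : u <= y ^ a -> v <= y ^ a -> u + v <= y ^ a.+1.
Proof.
move=> hu hv; apply: leq_trans (@ypow_scale 2 (y ^ a) a isT (leqnn _)).
by rewrite mul2n -addnn leq_add.
Qed.

Lemma ypow_double1 u a : u <= y ^ a -> (2 * u).+1 <= y ^ a.+1.
Proof.
move=> hu; have h := ypow_gt0 a; apply: leq_trans (@ypow_scale 3 (y ^ a) a isT (leqnn _)).
by move: (y ^ a) h hu => w; lia.
Qed.

Lemma ypow_exp u a k : u <= y ^ a -> u ^ k <= y ^ (a * k).
Proof. by move=> hu; rewrite expnM; case: k => // k; rewrite leq_exp2r. Qed.

(** The exponents describe cell side [h], norm of [z] [j], box [l], norm of [w] [q] and target [t].
    The condition [3 j <= l + 4 g + 2] keeps the pairs with nonsquare product below the diagonal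
    contribution, and [(4 + 2 k) g <= j] makes the diagonal itself small enough. *)
Lemma typeII_root_bound g k j h l q t : (k = 1 \/ k = 2 \/ k = 6) ->
  2 * h + 2 * g <= j -> j <= 2 * h + 2 * g + 1 -> 2 * l <= k * q + 1 ->
  3 * j <= l + 4 * g + 2 -> (4 + 2 * k) * g <= j -> 2 * h + q + 10 <= t + g ->
  ((y ^ h) ^ 2) ^ (2 * k - 2) * ((2 * y ^ l).+1 ^ 2 * (2 * (y * y)) ^ (2 * k)) *
    (y ^ j.+1 * (y * y * y) * (2 * y ^ l).+1 ^ 2 +
     ((y ^ h) ^ 2) ^ 2 * (2 * (2 * y ^ l).+1 * (y ^ j.+1) ^ 2)) <= (y ^ t) ^ (2 * k).
Proof.
move=> hk h1 h2 h3 h4 h5 h6.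
have y1 : y <= y ^ 1 by rewrite expn1.
have L1 := ypow_double1 (leqnn (y ^ l)).
have Y2 : 2 * (y * y) <= y ^ 3 by apply: ypow_scale => //; apply: (ypow_mul y1 y1).
have Hh : (y ^ h) ^ 2 <= y ^ (h * 2) by apply: ypow_exp.
have b1 := ypow_exp (2 * k - 2) Hh.
have b2 := ypow_mul (ypow_exp 2 L1) (ypow_exp (2 * k) Y2).
have b3 := ypow_mul (ypow_mul (leqnn (y ^ j.+1)) (ypow_mul (ypow_mul y1 y1) y1)) (ypow_exp 2 L1).
have b4 := ypow_mul (ypow_exp 2 Hh) (ypow_mul (@ypow_scale 2 _ _ isT L1) (ypow_exp 2 (leqnn (y ^ j.+1)))).
have b5 : y ^ j.+1 * (y * y * y) * (2 * y ^ l).+1 ^ 2 +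
     ((y ^ h) ^ 2) ^ 2 * (2 * (2 * y ^ l).+1 * (y ^ j.+1) ^ 2) <= y ^ (j + 2 * l + 7).
  apply: leq_trans (ypow_add (a := j + 2 * l + 6) _ _) _; last by apply: ypow_le; lia.
    by apply: leq_trans b3 _; apply: ypow_le; lia.
  by apply: leq_trans b4 _; apply: ypow_le => //; clear -h1 h4; lia.
apply: leq_trans (ypow_mul (ypow_mul b1 b2) b5) _.
rewrite -expnM; apply: ypow_le; clear -hk h1 h2 h3 h4 h5 h6.
by case: hk h3 h5 => [->|[->|->]] h3 h5; lia.
Qed.
End PowerBounds.

(** * Type II sums on one scale *)

Section TypeIIScale.
Variables (R : realFieldType) (g y x : nat).
Hypothesis y10 : (10 <= y)%N.
Hypothesis g1 : (2 <= g)%N.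
Hypothesis tauy : forall n, (0 < n <= y ^ (500 * g))%N -> (tau n <= y)%N.
Hypothesis xy : (x <= y ^ (70 * g + 1))%N.

(* Cells have side about [y ^ (- g)] times the radius of [Z]; the moment [2 k] is chosen so that
   the dual sum, of length [Q ^ (k / 2)] with [Q = y ^ (70 g + 1 - j)], exceeds the modulus
   [y ^ (2 j)] of [chi z * chi z'] by a power of [y ^ g]. *)
Lemma typeII_scale k j (Z W : seq gint) (alpha beta : gint -> R) :
  (k = 1 \/ k = 2 \/ k = 6)%N -> ((4 + 2 * k) * g <= j)%N -> (j <= 35 * g + 1)%N ->
  (6 * j <= k * (70 * g - j) + 8 * g)%N ->
  uniq Z -> uniq W ->
  (forall z, z \in Z -> [&& gnormal z, gprim z & (gabs2 z <= y ^ j.+1)%N]) ->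
  (forall w, w \in W -> [&& gpar w, gprim w & (gabs2 w <= y ^ (70 * g + 1 - j))%N]) ->
  (forall z, `|alpha z| <= 1) -> (forall w, `|beta w| <= 1) ->
  `|\sum_(z <- Z) \sum_(w <- W)
     alpha z * beta w * (if inO x (gmul z w) then (spin (gmul z w))%:~R else 0)| <=
  (y ^ (69 * g + 20))%:R.
Proof.
move=> hk hj1 hj2 hj3 uZ uW ZP WP a1 b1.
have k0 : (0 < k)%N by clear -hk; lia.
pose h := (j./2 - g)%N; pose q := (70 * g + 1 - j)%N; pose l := ((k * q).+1)./2.
pose t := (2 * h + q + 10 - g)%N.
have e1 : (2 * h + 2 * g <= j)%N by rewrite /h; clear -hj1 hk; case: hk hj1 => [->|[->|->]]; lia.
have e2 : (j <= 2 * h + 2 * g + 1)%N by rewrite /h; clear; lia.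
have e3 : (k * q <= 2 * l <= k * q + 1)%N by rewrite /l; clear; move: (k * q)%N => w; lia.
have e4 : (3 * j <= l + 4 * g + 2)%N.
  by rewrite /q in e3; clear -e3 hj3 hk hj2; case: hk e3 hj3 => [->|[->|->]]; lia.
have e5 : (2 * h + q + 10 <= t + g)%N by rewrite /t /q; clear -hj2 g1; lia.
have HT := typeII_root_bound y10 hk e1 e2 (proj2 (andP e3)) e4 hj1 e5.
have y0 : (0 < y)%N by apply: leq_trans y10.
pose r := (y ^ (j./2).+1)%N; pose Wc := (y ^ (q.+1)./2)%N.
pose E := (y ^ (34 * g + 2))%N; pose B := (y ^ (35 * g + 1))%N.
have y1 : (y <= y ^ 1)%N by rewrite expn1.
have le := ypow_le y10.
have EB : (2 * B + E <= y ^ (35 * g + 3))%N.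
  apply: leq_trans (ypow_add y10 (a := (35 * g + 2)%N) _ _) _.
  - by apply: leq_trans (ypow_scale y10 (c := 2) isT (leqnn B)) _; apply: le; lia.
  - by apply: le; clear -g1; lia.
  - by apply: le; lia.
have EB2 : (2 * (E * (2 * B + E)) <= y ^ (69 * g + 6))%N.
  by apply: leq_trans (ypow_scale y10 (c := 2) isT (ypow_mul (leqnn E) EB)) _; apply: le; lia.
have XN : (x + 2 * (E * (2 * B + E)) <= y ^ (500 * g))%N.
  apply: leq_trans (ypow_add y10 (a := (70 * g + 6)%N) _ _) _.
  - by apply: leq_trans xy _; apply: le; lia.
  - by apply: leq_trans EB2 _; apply: le; lia.
  - by apply: le; clear -g1; lia.
apply: le_trans (@typeII_bound R y (y ^ (500 * g)) k (y ^ l) (y ^ q) (y ^ j.+1) (y ^ h) r x (y ^ t)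
  E B Wc Z W alpha beta tauy k0 _ _ _ _ _ _ uZ uW ZP WP a1 b1 HT _ _ _ _ XN) _.
- by rewrite expn_gt0 y0.
- by rewrite expn_gt0 y0.
- rewrite -expnM; apply: le; rewrite /q; clear -hk hj2 g1 hj1.
  by case: hk hj1 => [->|[->|->]]; lia.
- by rewrite -!expnM; apply: le; rewrite mulnC; clear -e3; lia.
- by rewrite -expnM; apply: le; clear -hj2 g1; lia.
- by rewrite -expnM; apply: le; clear; lia.
- by rewrite -expnM; apply: le; clear; lia.
- apply: leq_trans (ypow_scale y10 (c := 2) isT (ypow_mul (leqnn (y ^ h)) (leqnn Wc))) _.
  apply: le; rewrite /q; clear -e1 hj2; lia.
- by rewrite -!expnM -expnD; apply: le; rewrite /q; clear -hj2; lia.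
- apply: leq_trans (ypow_scale y10 (c := 2) isT (ypow_exp 2 (leqnn B))) _.
  by apply: le; clear -g1; lia.
rewrite ler_nat.
have c1 : (size (gbox (r %/ y ^ h).+1) <= y ^ (2 * g + 6))%N.
  have rh : (r %/ y ^ h <= y ^ (g + 1))%N.
    rewrite /r -expnB // ?y0 //; last by rewrite /h; clear; lia.
    by apply: le; rewrite /h; clear -e1; lia.
  have rh1 : ((r %/ y ^ h).+1 <= y ^ (g + 2))%N.
    rewrite -addn1; apply: leq_trans (ypow_add y10 rh _) _; first by rewrite expn_gt0 y0.
    by apply: le; lia.
  rewrite size_gbox; apply: leq_trans (ypow_mul (ypow_double1 y10 rh1) (ypow_double1 y10 rh1)) _.
  by apply: le; lia.
have m1 : (4 * size (gbox (r %/ y ^ h).+1) * y ^ t <= y ^ (69 * g + 18))%N.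
  apply: leq_trans (ypow_mul (ypow_scale y10 (c := 4) isT c1) (leqnn (y ^ t))) _.
  by apply: le; rewrite /t /q; clear -e1 hj2; lia.
have m2 : (y * (2 * ((2 * E).+1 * (2 * B).+1) + 2 * ((2 * (2 * (E * (2 * B + E)))).+1 * y)) <= y ^ (69 * g + 18))%N.
  have p1 := ypow_scale y10 (c := 2) isT (ypow_mul (ypow_double1 y10 (leqnn E)) (ypow_double1 y10 (leqnn B))).
  have p2 := ypow_scale y10 (c := 2) isT (ypow_mul (ypow_double1 y10 EB2) y1).
  apply: leq_trans (ypow_mul y1 (ypow_add y10 (a := (69 * g + 10)%N) _ _)) _.
  - by apply: leq_trans p1 _; apply: le; clear; lia.
  - by apply: leq_trans p2 _; apply: le; clear; lia.
  - by apply: le; clear; lia.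
by apply: leq_trans (ypow_add y10 m1 m2) _; apply: le; clear; lia.
Qed.
End TypeIIScale.

Lemma gpar_gmul z w : gnormal z -> gpar w -> gpar (gmul z w).
Proof.
move=> /and3P [_ oa eb] /andP [ou ev].
have [k ek] := odd_absz oa; have [l el] := even_absz eb.
have [k' ek'] := odd_absz ou; have [l' el'] := even_absz ev.
rewrite /gpar /gmul /= ek el ek' el'.
have -> : (2 * k + 1) * (2 * k' + 1) - 2 * l * (2 * l') = 2 * (2 * k * k' + k + k' - 2 * l * l') + 1 by ring.
have -> : (2 * k + 1) * (2 * l') + 2 * l * (2 * k' + 1) = 2 * (2 * k * l' + l' + 2 * l * k' + l) by ring.
by rewrite odd_abszD !abszM !oddM.
Qed.

Lemma gpar_odd t : gpar t -> odd (gabs2 t).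
Proof.
case/andP=> oa eb; have e := gabs2E t.
have h : odd `|(t.1 ^+ 2 + t.2 ^+ 2)%R| by rewrite odd_abszD !abszX !oddX /= oa (negbTE eb).
by rewrite -[gabs2 t]/`|(gabs2 t)%:Z|%N e.
Qed.

Lemma gpar_factor z w : gnormal z -> gpar (gmul z w) -> gpar w.
Proof.
move=> /and3P [_ oa eb] /andP [/= h1 h2].
have [k ek] := odd_absz oa; have [l el] := even_absz eb.
have ou : odd `|w.1|.
  move: h1; rewrite ek el (_ : _ - _ = w.1 + 2 * (k * w.1 - l * w.2)); last by ring.
  by rewrite odd_abszD abszM oddM /= addbF.
rewrite /gpar ou /=; move: h2.
rewrite ek el (_ : _ + _ = w.2 + 2 * (k * w.2 + l * w.1)); last by ring.
by rewrite odd_abszD abszM oddM /= addbF.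
Qed.

Lemma spin_nprim t : gpar t -> ~~ gprim t -> spin t = 0.
Proof.
move=> /andP [o1 _] np; apply/eqP; rewrite jacobi_eq0; last by clear -o1; lia.
by rewrite coprime_sym.
Qed.

(** * Type II sums over all scales *)

Section TypeIITotal.
Variables (R : realFieldType) (x X0 : nat).
Hypothesis xX0 : (x <= X0 ^ 2)%N.

Definition spin_conv (al be : nat -> R) : R :=
  \sum_(t <- gbox X0 | inO x t && gpar t)
    (spin t)%:~R * \sum_(m <- divisors (gabs2 t)) al m * be (gabs2 t %/ m)%N.

Definition Zall : seq gint := [seq z <- gbox X0 | gnormal z && gprim z].
Definition Wall : seq gint := [seq w <- gbox X0 | gpar w && gprim w].

Lemma uniq_Zall : uniq Zall. Proof. by rewrite filter_uniq ?gbox_uniq. Qed.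
Lemma uniq_Wall : uniq Wall. Proof. by rewrite filter_uniq ?gbox_uniq. Qed.

(** This transfers a divisor sum over integers to Gaussian integers: [gfactor_exists] and
    [gfactor_uniq] match each divisor [m] of the norm with exactly one pair of product [t] and left
    norm [m]. *)
Lemma conv_factor (f : nat -> nat -> R) t : inO x t -> gpar t -> gprim t ->
  \sum_(m <- divisors (gabs2 t)) f m (gabs2 t %/ m)%N =
  \sum_(z <- Zall) \sum_(w <- Wall) if gmul z w == t then f (gabs2 z) (gabs2 w) else 0.
Proof.
move=> tO pt prt; have ot := gpar_odd pt; have t0 := gprim_gabs2_gt0 prt.
have tx : (gabs2 t <= X0 ^ 2)%N by case/and3P: tO => _ _ h; apply: leq_trans h xX0.
rewrite [RHS](eq_big_seq (fun z => if (gabs2 z %| gabs2 t)%N then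
   \sum_(w <- Wall) if gmul z w == t then f (gabs2 z) (gabs2 w) else 0 else 0)); last first.
  move=> z _; case: ifP => // nd; rewrite big1 // => w _; case: eqP => // e.
  by rewrite -e gabs2M dvdn_mulr in nd.
rewrite -big_mkcond -big_filter.
rewrite (@sum_fibres _ _ _ _ (divisors (gabs2 t)) gabs2) ?divisors_uniq //; last first.
  by move=> z; rewrite mem_filter -dvdn_divisors // => /andP [].
apply: eq_big_seq => m; rewrite -dvdn_divisors // => mt.
have m0 := dvdn_gt0 t0 mt; have om : odd m := odd_dvdn mt ot.
have tE : gabs2 t = (m * (gabs2 t %/ m))%N by rewrite mulnC divnK.
have [z [w [nz zm wn e]]] := gfactor_exists prt tE om.
have pz : gprim z by move: prt; rewrite -e; apply: gprimMl.
have pw : gprim w by move: prt; rewrite -e; apply: gprimMr.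
have gw : gpar w by apply: gpar_factor nz _; rewrite e.
have le_t u : (gabs2 u %| gabs2 t)%N -> u \in gbox X0.
  by move=> /dvdn_leq h; apply: mem_gbox_gabs2; apply: leq_trans tx; apply: h.
have zZ : z \in Zall by rewrite mem_filter nz pz le_t // zm.
have wW : w \in Wall by rewrite mem_filter gw pw le_t // wn dvdn_div.
rewrite big_mkcond big_filter big_mkcond /= (bigD1_seq z) ?uniq_Zall //= zm mt eqxx.
rewrite (bigD1_seq w) ?uniq_Wall //= e eqxx wn big1 ?addr0; last first.
  move=> w' ww'; case: eqP => // e'; case/eqP: ww'.
  by apply: (gmul_inj nz); rewrite e e'.
rewrite big_seq_cond big1 ?addr0 // => z' /andP [z'Z zz']; case: ifP => // d'; case: eqP => // m'.
rewrite big1 // => w' _; case: eqP => // e'; case/eqP: zz'.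
have /andP [nz' _] : gnormal z' && gprim z' by move: z'Z; rewrite mem_filter => /andP [].
by apply: (gfactor_uniq nz' nz prt _ _ e' e); rewrite ?zm ?m' // m'.
Qed.

Lemma spin_conv_factor al be : spin_conv al be =
  \sum_(z <- Zall) \sum_(w <- Wall) al (gabs2 z) * be (gabs2 w) *
    (if inO x (gmul z w) then (spin (gmul z w))%:~R else 0).
Proof.
rewrite /spin_conv.
rewrite (eq_bigr (fun t => \sum_(z <- Zall) \sum_(w <- Wall)
   if gmul z w == t then (spin t)%:~R * (al (gabs2 z) * be (gabs2 w)) else 0)); last first.
  move=> t /andP [tO pt]; have [prt|npr] := boolP (gprim t); last first.
    rewrite (spin_nprim pt npr) mul0r big1 // => z _; rewrite big1 // => w _.
    by rewrite mul0r if_same.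
  rewrite (conv_factor (fun a b => al a * be b) tO pt prt) mulr_sumr.
  apply: eq_bigr => z _; rewrite mulr_sumr; apply: eq_bigr => w _.
  by case: eqP => _; rewrite ?mulr0.
rewrite exchange_big /=; apply: eq_big_seq => z zZ.
rewrite exchange_big /=; apply: eq_big_seq => w wW.
have /andP [nz pz] : gnormal z && gprim z by move: zZ; rewrite mem_filter => /andP [].
have /andP [gw pw] : gpar w && gprim w by move: wW; rewrite mem_filter => /andP [].
case: ifP => hO; last first.
  rewrite mulr0 big1 // => t /andP [tO _]; case: eqP => // e; by rewrite e tO in hO.
have tb : gmul z w \in gbox X0.
  by case/and3P: (hO) => _ _ h; apply: mem_gbox_gabs2; apply: leq_trans h xX0.
rewrite big_mkcond (bigD1_seq (gmul z w)) ?gbox_uniq //= hO gpar_gmul // eqxx big1 ?addr0 1?mulrC //.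
by move=> t; rewrite eq_sym => /negbTE ->; rewrite if_same.
Qed.

Variables (g y : nat).
Hypothesis y10 : (10 <= y)%N.
Hypothesis g1 : (2 <= g)%N.
Hypothesis gy : (70 * g <= y)%N.
Hypothesis tauy : forall n, (0 < n <= y ^ (500 * g))%N -> (tau n <= y)%N.
Hypothesis xy : (x <= y ^ (70 * g + 1))%N.

Lemma typeII_small_variable al be : (forall m, `|al m| <= 1) -> (forall m, `|be m| <= 1) ->
  (forall m, al m != 0 -> (y ^ (7 * g) <= m < y ^ (35 * g + 2))%N) ->
  `|spin_conv al be| <= (y ^ (69 * g + 21))%:R.
Proof.
move=> a1 b1 as_; rewrite spin_conv_factor.
have y1 : (1 < y)%N by clear -y10; lia.
(* Cutting the norms of [z] at the powers of [y] gives [28 g + 2] pieces, at most [y], so it costs a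
   single factor [y]. *)
pose j0 := index_iota (7 * g) (35 * g + 2).
pose sc z := trunc_log y (gabs2 z).
pose Z' := [seq z <- Zall | sc z \in j0].
have -> : \sum_(z <- Zall) \sum_(w <- Wall) al (gabs2 z) * be (gabs2 w) *
    (if inO x (gmul z w) then (spin (gmul z w))%:~R else 0) =
  \sum_(z <- Z') \sum_(w <- Wall) al (gabs2 z) * be (gabs2 w) *
    (if inO x (gmul z w) then (spin (gmul z w))%:~R else 0).
  rewrite /Z' [RHS]big_filter [RHS]big_mkcond; apply: eq_big_seq => z zZ; case: ifP => // nsc.
  have [a0|a0] := eqVneq (al (gabs2 z)) 0.
    by rewrite big1 // => w _; rewrite a0 !mul0r.
  have /andP [h1 h2] := as_ _ a0.
  have z0 : (0 < gabs2 z)%N by move: zZ; rewrite mem_filter => /andP [/andP [_ /gprim_gabs2_gt0]].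
  have /andP [t1 t2] := trunc_log_bounds y1 z0.
  exfalso; move: nsc; rewrite mem_index_iota; have -> // : (7 * g <= sc z < 35 * g + 2)%N.
  rewrite -ltnS -(ltn_exp2l _ _ y1) (leq_ltn_trans h1 t2) /=.
  by rewrite -(ltn_exp2l _ _ y1) (leq_ltn_trans t1 h2).
rewrite (@sum_fibres _ _ _ Z' j0 sc) ?iota_uniq //; last by move=> z; rewrite mem_filter => /andP [].
apply: le_trans (@norm_sum_le_size _ _ j0 _ (y ^ (69 * g + 20))%:R _) _; last first.
  rewrite size_iota -natrM ler_nat [(69 * g + 21)%N]addnS expnS leq_mul2r; apply/orP; right.
  by clear -gy g1; lia.
move=> j; rewrite mem_index_iota => /andP [j1 j2].
rewrite -big_filter; set Zj := [seq z <- Z' | sc z == j].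
(* As [x <= y ^ (70 g + 1)] and [gabs2 z >= y ^ j], the region forces this bound on the norm of
   [w]. *)
pose Wj := [seq w <- Wall | (gabs2 w <= y ^ (70 * g + 1 - j))%N].
have ZjP z : z \in Zj -> [/\ gnormal z, gprim z & (y ^ j <= gabs2 z < y ^ j.+1)%N].
  rewrite !mem_filter => /andP [/eqP e /andP [_ /andP [/andP [nz pz] _]]]; split=> //.
  by rewrite -e; apply: trunc_log_bounds => //; apply: gprim_gabs2_gt0.
have -> : \sum_(z <- Zj) \sum_(w <- Wall) al (gabs2 z) * be (gabs2 w) *
    (if inO x (gmul z w) then (spin (gmul z w))%:~R else 0) =
  \sum_(z <- Zj) \sum_(w <- Wj) al (gabs2 z) * be (gabs2 w) *
    (if inO x (gmul z w) then (spin (gmul z w))%:~R else 0).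
  apply: eq_big_seq => z /ZjP [_ _ /andP [zl _]]; rewrite /Wj [RHS]big_filter [RHS]big_mkcond.
  apply: eq_bigr => w _; case: (leqP (gabs2 w)) => // wl; case: ifP; [case/and3P=> _ _|by rewrite mulr0].
  rewrite gabs2M => hx; exfalso; have : (y ^ (70 * g + 1) < gabs2 z * gabs2 w)%N.
    have -> : (70 * g + 1 = j + (70 * g + 1 - j))%N by clear -j2; lia.
    by rewrite expnD; apply: leq_trans (leq_mul zl wl); rewrite ltn_pmul2l // expn_gt0; clear -y10; lia.
  by rewrite ltnNge (leq_trans hx).
have j2' : (j <= 35 * g + 1)%N by clear -j2; lia.
have app k : (k = 1 \/ k = 2 \/ k = 6)%N -> ((4 + 2 * k) * g <= j)%N -> (6 * j <= k * (70 * g - j) + 8 * g)%N ->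
  `|\sum_(z <- Zj) \sum_(w <- Wj) al (gabs2 z) * be (gabs2 w) *
    (if inO x (gmul z w) then (spin (gmul z w))%:~R else 0)| <= (y ^ (69 * g + 20))%:R.
  move=> hk h1 h2; apply: (typeII_scale y10 g1 tauy xy hk h1 j2' h2 (alpha := fun z => al (gabs2 z)) (beta := fun w => be (gabs2 w))) => //.
  - by rewrite !filter_uniq ?gbox_uniq.
  - by rewrite !filter_uniq ?gbox_uniq.
  - by move=> z /ZjP [-> -> /andP [_ /ltnW ->]].
  - by move=> w; rewrite !mem_filter => /and3P [-> /andP [-> ->] _].
(* The moments [k = 1, 2, 6] admit [j] from [6 g], [8 g], [16 g] up to about [11 g], [18 g], [35 g],
   so the three ranges overlap. For [k = 6] and [j = 35 g + 1] the requirement is [12 <= 8 g],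
   whence [g >= 2]. *)
case: (ltnP j (9 * g)) => c1; first by apply: (app 1%N); [auto|clear -j1; lia|clear -c1; lia].
case: (ltnP j (17 * g)) => c2; first by apply: (app 2%N); [auto|clear -c1; lia|clear -c2; lia].
by apply: (app 6%N); [auto|clear -c2; lia|clear -j2 g1; lia].
Qed.

Lemma spin_convC al be : spin_conv al be = spin_conv be al.
Proof.
apply: eq_bigr => t /andP [_ pt]; congr (_ * _).
have t0 : (0 < gabs2 t)%N by have := gpar_odd pt; case: gabs2.
have pe : perm_eq (divisors (gabs2 t)) [seq (gabs2 t %/ m)%N | m <- divisors (gabs2 t)].
  have inv m : (m %| gabs2 t)%N -> (gabs2 t %/ (gabs2 t %/ m) = m)%N.
    by move=> h; rewrite divnA // mulKn.
  apply: uniq_perm; first exact: divisors_uniq.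
    rewrite map_inj_in_uniq ?divisors_uniq // => m n; rewrite -!dvdn_divisors // => hm hn e.
    by rewrite -(inv m hm) e inv.
  move=> m; apply/idP/mapP => [|[n + ->]]; rewrite -!dvdn_divisors // => hm.
    by exists (gabs2 t %/ m)%N; rewrite -?dvdn_divisors ?dvdn_div ?inv.
  by rewrite dvdn_div.
rewrite [RHS](perm_big _ pe) big_map; apply: eq_big_seq => m; rewrite -dvdn_divisors // => hm.
by rewrite divnA // mulKn // mulrC.
Qed.

Lemma spin_convDl a1 a2 be : spin_conv (fun m => a1 m + a2 m) be = spin_conv a1 be + spin_conv a2 be.
Proof.
rewrite /spin_conv -big_split; apply: eq_bigr => t _; rewrite /= -mulrDr; congr (_ * _).
by rewrite -big_split; apply: eq_bigr => m _; rewrite /= mulrDl.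
Qed.

(** The variable placed on [z] must stay below [y ^ (35 g + 2)]. If [m] does not, or merely reaches
    [y ^ (35 g)], the complementary divisor is at most [y ^ (35 g + 1)] and the roles are exchanged
    by [spin_convC]. *)
Lemma typeII_total al be : (forall m, `|al m| <= 1) -> (forall m, `|be m| <= 1) ->
  (forall m, al m != 0 -> (y ^ (7 * g) <= m)%N) ->
  (forall m, be m != 0 -> (y ^ (7 * g) <= m)%N) ->
  `|spin_conv al be| <= (y ^ (69 * g + 22))%:R.
Proof.
move=> a1 b1 as_ bs.
pose c m := (m < y ^ (35 * g))%N.
pose b2 m := if (m < y ^ (35 * g + 2))%N then be m else 0.
have y0 : (0 < y)%N by clear -y10; lia.
have -> : spin_conv al be = spin_conv (fun m => if c m then al m else 0) be +
    spin_conv b2 (fun m => if c m then 0 else al m).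
  rewrite [X in _ + X]spin_convC.
  have -> : spin_conv (fun m => if c m then 0 else al m) b2 = spin_conv (fun m => if c m then 0 else al m) be.
    apply: eq_bigr => t /andP [/and3P [_ _ tx] pt]; congr (_ * _).
    have t0 : (0 < gabs2 t)%N by have := gpar_odd pt; case: gabs2.
    apply: eq_big_seq => m; rewrite -dvdn_divisors // => hm; rewrite /c.
    case: ltnP => hc; rewrite ?mul0r // /b2; case: ltnP => // hl; exfalso.
    have : (y ^ (70 * g + 1) < gabs2 t)%N.
      rewrite -(divnK hm) [(_ %/ _ * _)%N]mulnC; apply: leq_trans (leq_mul hc hl).
      by rewrite -expnD ltn_exp2l; clear -y10; lia.
    by rewrite ltnNge (leq_trans tx).
  rewrite -spin_convDl; apply: eq_bigr => t _; congr (_ * _); apply: eq_bigr => m _.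
  by case: (c m); rewrite ?addr0 ?add0r.
apply: le_trans (ler_normD _ _) _.
apply: (@le_trans _ _ ((y ^ (69 * g + 21))%:R + (y ^ (69 * g + 21))%:R)).
  apply: lerD; apply: typeII_small_variable => //.
  - by move=> m; case: ifP; rewrite ?normr0 ?ler01.
  - move=> m; rewrite /c; case: ltnP => [h|]; rewrite ?eqxx // => a0; rewrite as_ //=.
    by apply: leq_trans h _; rewrite leq_exp2l; clear -y10; lia.
  - by move=> m; rewrite /b2; case: ifP; rewrite ?normr0 ?ler01.
  - by move=> m; case: ifP; rewrite ?normr0 ?ler01.
  - by move=> m; rewrite /b2; case: ltnP => [h|]; rewrite ?eqxx // => /bs ->.
rewrite -natrD ler_nat; apply: leq_trans (ypow_add y10 (leqnn _) (leqnn _)) _.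
by apply: ypow_le => //; clear; lia.
Qed.
End TypeIITotal.

(** * Type I sums for one rational divisor *)

Section TypeITotal.
Variables (R : realFieldType) (X g y : nat).
Hypothesis y10 : (10 <= y)%N.
Hypothesis g1 : (2 <= g)%N.
Hypothesis tauy : forall n, (0 < n <= y ^ (500 * g))%N -> (tau n <= y)%N.
Hypothesis Xy : (X <= y ^ (70 * g + 1))%N.
Let X0 := (y ^ (35 * g + 1))%N.

Lemma typeI_root_bound : (X <= X0 ^ 2)%N.
Proof. by apply: leq_trans Xy _; rewrite -expnM; apply: ypow_le => //; clear; lia. Qed.

Lemma typeI_scale z : gnormal z -> gprim z -> (gabs2 z <= y ^ (14 * g))%N ->
  (gabs2 z)%:R * `|\sum_(t <- gbox X0 | lattice_cond X z t) (spin t)%:~R : R| <= (y ^ (68 * g + 7))%:R.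
Proof.
(* The shifts have length [J = d * u ^ 2] with [u = y ^ (2 g)], so that the mean square over the
   shifts saves the factor [u] both on the diagonal and on the complete sums. *)
move=> nz pz; have := gprim_gabs2_gt0 pz; set d := gabs2 z => d0 dy.
have y0 : (0 < y)%N by clear -y10; lia.
pose u := (y ^ (2 * g))%N; have u0 : (0 < u)%N by rewrite /u expn_gt0 y0.
pose B := (X0 * y ^ 2 %/ (d * u) + 1)%N.
have du0 : (0 < d * u)%N by rewrite muln_gt0 d0.
have d20 : (0 < 2 * d)%N by rewrite muln_gt0.
have hd : (2 * d <= X0)%N.
  by apply: leq_trans (ypow_scale y10 (c := 2) isT dy) _; apply: ypow_le => //; clear -g1; lia.
set T := (X0 %/ (2 * d) + 1)%N.
have dT : (d * T <= X0)%N.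
  have h : (X0 %/ (2 * d) * (2 * d) <= X0)%N := leq_divM _ _.
  by rewrite /T; clear -h hd; move: (X0 %/ _)%N h => q; nia.
have TX : (T <= X0)%N by apply: leq_trans dT; rewrite leq_pmull.
have B1 : (X0 * y ^ 2 <= d * u * B)%N by rewrite /B addn1 [leqRHS]mulnC; apply/ltnW/ltn_ceil.
have B2 : (d * B <= y ^ (33 * g + 4))%N.
  have h : (X0 * y ^ 2 %/ (d * u) * (d * u) <= X0 * y ^ 2)%N := leq_divM _ _.
  have e : (X0 * y ^ 2 = u * y ^ (33 * g + 3))%N.
    by rewrite /X0 /u -!expnD; congr (_ ^ _)%N; clear; lia.
  have h2 : (d * (X0 * y ^ 2 %/ (d * u)) <= y ^ (33 * g + 3))%N.
    rewrite -(leq_pmul2l u0) -e; apply: leq_trans h; rewrite mulnCA; clear; lia.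
  rewrite /B mulnDr muln1 [(33 * g + 4)%N]addnS; apply: (ypow_add y10 h2).
  by apply: leq_trans dy _; apply: ypow_le => //; clear; lia.
have hF : (u ^ 2 * (d * u ^ 2) * u <= X0)%N.
  have -> : (u ^ 2 * (d * u ^ 2) * u = d * u ^ 5)%N by rewrite -!mulnn; ring.
  apply: leq_trans (ypow_mul dy (ypow_exp 5 (leqnn u))) _.
  by apply: ypow_le => //; clear; lia.
have ht n : (0 < n <= X0)%N -> (tau n <= y)%N.
  case/andP=> n0 nX; apply: tauy; rewrite n0 /=; apply: leq_trans nX _.
  by apply: ypow_le => //; clear -g1; lia.
have hB : (T * (T + X0) * y <= d * u ^ 2 * B ^ 2)%N.
  rewrite -(leq_pmul2l d0).
  have -> : (d * (d * u ^ 2 * B ^ 2) = (d * u * B) ^ 2)%N by rewrite -!mulnn; ring.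
  apply: (@leq_trans ((X0 * y ^ 2) ^ 2)); last by rewrite leq_exp2r.
  apply: (@leq_trans (X0 * (X0 + X0) * y)).
    by rewrite !mulnA leq_mul2r; apply/orP; right; apply: leq_mul => //; rewrite leq_add2r.
  have -> : ((X0 * y ^ 2) ^ 2 = X0 * (X0 * y ^ 3) * y)%N by rewrite -!mulnn !expnS; ring.
  rewrite leq_mul2r leq_mul2l; apply/orP; right; apply/orP; right.
  rewrite addnn -muln2 leq_mul2l; apply/orP; right.
  by apply: (@leq_trans y); [clear -y10; lia|rewrite -[leqLHS]expn1; apply: ypow_le].
have J0 : (0 < d * u ^ 2)%N by rewrite muln_gt0 d0 expn_gt0 u0.
have := typeI_sum R typeI_root_bound nz pz J0 u0 u0 hF ht hB.
rewrite -/d -/T => h.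
apply: le_trans (ler_wpM2l (ler0n _ _) h) _; rewrite -natrM ler_nat.
have -> : (d * (X0 * (2 * (d * u ^ 2) + B) + (X0 %/ u + X0 %/ u) * T) =
  (2 * (X0 * (d * d * u ^ 2)) + X0 * (d * B)) + 2 * (X0 %/ u * (d * T)))%N by ring.
have q1 : (2 * (X0 * (d * d * u ^ 2)) <= y ^ (68 * g + 5))%N.
  apply: leq_trans (ypow_scale y10 (c := 2) isT (ypow_mul (leqnn X0) (ypow_mul (ypow_mul dy dy) (ypow_exp 2 (leqnn u))))) _.
  by apply: ypow_le => //; clear; lia.
have q2 : (X0 * (d * B) <= y ^ (68 * g + 5))%N.
  by apply: leq_trans (ypow_mul (leqnn X0) B2) _; apply: ypow_le => //; clear; lia.
have q3 : (2 * (X0 %/ u * (d * T)) <= y ^ (68 * g + 6))%N.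
  have hu : (X0 %/ u <= y ^ (33 * g + 1))%N.
    rewrite /X0 (_ : (35 * g + 1 = 33 * g + 1 + 2 * g)%N); last by clear; lia.
    by rewrite expnD mulnK.
  apply: leq_trans (ypow_scale y10 (c := 2) isT (ypow_mul hu dT)) _.
  by apply: ypow_le => //; clear; lia.
rewrite [(68 * g + 7)%N]addnS; apply: (ypow_add y10 _ q3).
by rewrite [(68 * g + 6)%N]addnS; apply: (ypow_add y10 q1 q2).
Qed.

Definition norm_roots (d : nat) : seq gint :=
  [seq z <- gbox X0 | [&& gnormal z, gprim z & gabs2 z == d]].

Lemma lattice_dvd z t : gprim z -> (((gabs2 z)%:Z %| t.2 * z.1 - t.1 * z.2)%Z -> (gabs2 z %| gabs2 t)%N).
Proof.
move=> pz /dvdzP [k ek].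
have h : ((gabs2 z)%:Z %| z.1 ^+ 2 * (gabs2 t)%:Z)%Z.
  apply/dvdzP; exists (k * (t.2 * z.1 + t.1 * z.2) + t.1 ^+ 2).
  transitivity ((t.2 * z.1 - t.1 * z.2) * (t.2 * z.1 + t.1 * z.2) + t.1 ^+ 2 * (gabs2 z)%:Z).
    by rewrite !gabs2E; ring.
  by rewrite ek; ring.
have c := gprim_coprime_gabs2 pz.
rewrite dvdzE abszM /= Gauss_dvdr // in h.
by rewrite abszX coprime_sym coprimeXl.
Qed.

(** For primitive [t] of norm divisible by [d], exactly one root of norm [d] satisfies the
    congruence. So the condition on the norm splits into the linear conditions of [lattice_cond]. *)
Lemma lattice_count (F : R) d t : odd d -> (d <= X0 ^ 2)%N -> gprim t ->
  \sum_(z <- norm_roots d) (if (d%:Z %| t.2 * z.1 - t.1 * z.2)%Z then F else 0) =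
  if (d %| gabs2 t)%N then F else 0.
Proof.
move=> od dX pt; case: ifP => dt; last first.
  rewrite big_seq big1 // => z; rewrite mem_filter => /andP [/and3P [_ pz /eqP e] _].
  by case: ifP => //; rewrite -e => /(lattice_dvd pz); rewrite e dt.
have tE : gabs2 t = (d * (gabs2 t %/ d))%N by rewrite mulnC divnK.
have [z [w [nz zd _ e]]] := gfactor_exists pt tE od.
have pz : gprim z by move: pt; rewrite -e; apply: gprimMl.
have zZ : z \in norm_roots d.
  by rewrite mem_filter nz pz zd eqxx /=; apply: mem_gbox_gabs2; rewrite zd.
have dz := gfactor_dvd e; rewrite zd in dz.
rewrite (bigD1_seq z) ?filter_uniq ?gbox_uniq //= dz big_seq_cond big1 ?addr0 // => z'.
rewrite mem_filter => /andP [/andP [/and3P [nz' _ /eqP e'] _] zz']; case: ifP => // dz'.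
by case/eqP: zz'; apply/esym/(@lattice_uniq z z' t); rewrite ?zd ?e'.
Qed.

Definition typeI_term (d : nat) : R :=
  \sum_(t <- gbox X0 | (inO X t && gpar t) && (d %| gabs2 t)%N) (spin t)%:~R.

(** The factor [d] on the left is essential: it lets the later sums over [d] cost only harmonic
    sums. The roots of norm [d] number at most [tau d <= y]. *)
Lemma typeI_total d : (0 < d <= y ^ (14 * g))%N -> d%:R * `|typeI_term d| <= (y ^ (68 * g + 8))%:R.
Proof.
case/andP=> d0 dy; have [od|ed] := boolP (odd d); last first.
  rewrite /typeI_term big1 ?normr0 ?mulr0 ?ler0n // => t /andP [/andP [_ /gpar_odd o] dt].
  by rewrite (odd_dvdn dt o) in ed.
have dX : (d <= X0 ^ 2)%N.
  by apply: leq_trans dy _; rewrite -expnM; apply: ypow_le => //; clear; lia.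
have -> : typeI_term d = \sum_(z <- norm_roots d) \sum_(t <- gbox X0 | lattice_cond X z t) (spin t)%:~R.
  rewrite (eq_big_seq (fun z => \sum_(t <- gbox X0 | inO X t && gpar t)
     if (d%:Z %| t.2 * z.1 - t.1 * z.2)%Z then (spin t)%:~R else 0)); last first.
    move=> z; rewrite mem_filter => /andP [/and3P [_ _ /eqP e] _].
    rewrite -big_mkcondr; apply: eq_bigl => t.
    by rewrite /lattice_cond e andbA.
  rewrite exchange_big /typeI_term big_mkcondr /=; apply: eq_bigr => t /andP [_ pt].
  have [prt|npr] := boolP (gprim t); first by rewrite lattice_count.
  by rewrite (spin_nprim pt npr) if_same big1 // => z _; rewrite if_same.
have szd : (size (norm_roots d) <= y)%N.
  apply: (@leq_trans (tau d)).
    apply: gabs2_count => //; first by rewrite filter_uniq ?gbox_uniq.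
    by move=> z; rewrite mem_filter => /andP [/and3P [-> -> /eqP ->]].
  by apply: tauy; rewrite d0 /=; apply: leq_trans dy _; apply: ypow_le => //; clear; lia.
rewrite -[X in X * _]normr_nat -normrM mulr_sumr.
apply: le_trans (@norm_sum_le_size _ _ _ _ (y ^ (68 * g + 7))%:R _) _; last first.
  by rewrite -natrM ler_nat [(68 * g + 8)%N]addnS expnS leq_mul2r szd orbT.
move=> z; rewrite mem_filter => /andP [/and3P [nz pz /eqP e] _].
by rewrite normrM normr_nat -e; apply: typeI_scale; rewrite ?e.
Qed.
End TypeITotal.

(** * Sums over primes *)
(** Partial summation. For a monotone weight the total variation is the single difference between
    its end values. *)
Lemma abel_bound (R : realDomainType) (I : eqType) (s : seq I) (F : I -> R) (phi : I -> nat)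
  (h : nat -> R) (N : nat) (M : R) :
  (forall i, i \in s -> (phi i <= N)%N) ->
  (forall n, (n <= N)%N -> `|\sum_(i <- s | (phi i <= n)%N) F i| <= M) ->
  (forall n, (n < N)%N -> h n <= h n.+1) \/ (forall n, (n < N)%N -> h n.+1 <= h n) ->
  `|\sum_(i <- s) F i * h (phi i)| <= M * (`|h N| + `|h N - h 0%N|).
Proof.
move=> hs hM hm.
have E : \sum_(i <- s) F i * h (phi i) = h N * \sum_(i <- s | (phi i <= N)%N) F i -
    \sum_(0 <= n < N) (h n.+1 - h n) * \sum_(i <- s | (phi i <= n)%N) F i.
  under [X in _ - X]eq_bigr => n _ do rewrite big_mkcond mulr_sumr.
  rewrite exchange_big mulr_sumr /= [X in X - _]big_mkcond -sumrB.
  apply: eq_big_seq => i /hs hi; rewrite hi.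
  rewrite (big_cat_nat (n := phi i)) //= big_nat_cond big1 ?add0r; last first.
    by move=> n; rewrite andbT => /andP [_ hn]; rewrite leqNgt hn mulr0.
  rewrite [X in _ - X](_ : _ = \sum_(phi i <= n < N) (h n.+1 - h n) * F i); last first.
    by apply: eq_big_nat => n /andP [-> _].
  by rewrite -mulr_suml telescope_sumr // mulrBl mulrC; ring.
rewrite E; apply: le_trans (ler_normB _ _) _; rewrite mulrDr; apply: lerD.
  by rewrite normrM mulrC ler_wpM2r // hM.
apply: le_trans (ler_norm_sum _ _ _) _.
apply: (@le_trans _ _ (\sum_(0 <= n < N) M * `|h n.+1 - h n|)).
  rewrite big_nat [leRHS]big_nat; apply: ler_sum => n /andP [_ hn].
  by rewrite normrM mulrC ler_wpM2r // hM // ltnW.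
rewrite -mulr_sumr; have M0 : 0 <= M by apply: le_trans (hM 0%N (leq0n _)).
rewrite ler_wpM2l //; case: hm => hm.
  rewrite (eq_big_nat _ _ (F2 := fun n => h n.+1 - h n)); last first.
    by move=> n /andP [_ hn]; rewrite ger0_norm // subr_ge0 hm.
  by rewrite telescope_sumr // ler_norm.
rewrite (eq_big_nat _ _ (F2 := fun n => (- h n.+1) - (- h n))); last first.
  by move=> n /andP [_ hn]; rewrite ler0_norm ?subr_le0 ?hm //; ring.
by rewrite (telescope_sumr (fun n => - h n)) // distrC opprK addrC ler_norm.
Qed.

Lemma harmonic_le (R : realType) n : (0 < n)%N -> \sum_(1 <= b < n.+1) (b%:R : R)^-1 <= 1 + ln n%:R.
Proof.
elim: n => // n IH _; case: (posnP n) => [->|n0]; first by rewrite big_nat1 invr1 ln1 addr0.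
rewrite big_nat_recr //=; apply: le_trans (lerD (IH n0) (lexx _)) _.
rewrite -addrA lerD2l -lerBrDl.
have p1 : (0 : R) < n%:R by rewrite ltr0n.
have p2 : (0 : R) < n.+1%:R by rewrite ltr0n.
have e : 1 + (- n.+1%:R^-1) = n%:R / n.+1%:R :> R.
  by rewrite -natr1; field; rewrite natr1 gt_eqF.
have lt1 : -1 < - (n.+1%:R : R)^-1.
  by rewrite ltrN2 invf_lt1 // ltr1n ltnS.
by have := le_ln1Dx lt1; rewrite e ln_div ?posrE // lerNr opprB.
Qed.

Lemma sum_divisors_le (V : nmodType) (F : nat -> V) n B : (0 < n)%N ->
  \sum_(b <- divisors n | (b <= B)%N) F b = \sum_(1 <= b < B.+1) if (b %| n)%N then F b else 0.
Proof.
move=> n0; rewrite -[RHS]big_mkcond -[LHS]big_filter -[RHS]big_filter. apply: perm_big.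
apply: uniq_perm; rewrite ?filter_uniq ?divisors_uniq ?iota_uniq // => b.
rewrite !mem_filter mem_index_iota -dvdn_divisors // ltnS andbC.
by case: (boolP (b %| n)%N) => //= h; rewrite (dvdn_gt0 n0 h).
Qed.

(** * Vaughan's identity for the sum weighted by the von Mangoldt function *)

Section Vaughan.
Variables (R : realType) (g y : nat).
Hypothesis y10 : (10 <= y)%N.
Hypothesis g1 : (2 <= g)%N.
Hypothesis gy : (70 * g <= y)%N.
Hypothesis tauy : forall n, (0 < n <= y ^ (500 * g))%N -> (tau n <= y)%N.
Hypothesis lny : forall n, (n <= y ^ (70 * g + 1))%N -> ln (n%:R : R) <= y%:R.
Let X0 := (y ^ (35 * g + 1))%N.
Let V := (y ^ (7 * g))%N.

Lemma lny_norm n : (n <= y ^ (70 * g + 1))%N -> `|ln (n%:R : R)| <= y%:R.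
Proof. by move=> h; rewrite ger0_norm ?ln_nat_ge0 ?lny. Qed.

Lemma Lamy n : (n <= y ^ (70 * g + 1))%N -> `|Lam R n| <= y%:R.
Proof.
move=> h; rewrite ger0_norm ?Lam_ge0 //; case: (posnP n) => [->|n0]; first by rewrite /Lam.
by apply: le_trans (Lam_le R n0) (lny h).
Qed.

Lemma gam_le B m : (0 < m <= y ^ (70 * g + 1))%N -> `|(gam B m)%:~R : R| <= y%:R.
Proof.
case/andP=> m0 hm; apply: (@le_trans _ _ (tau m)%:R); last first.
  rewrite ler_nat; apply: tauy; rewrite m0; apply: leq_trans hm _.
  by apply: ypow_le => //; clear -g1; lia.
rewrite /gam big_mkcond rmorph_sum /= /tau -[leRHS]mulr1; apply: norm_sum_le_size => b _.
by rewrite -intr_norm lerz1; case: ifP => _; rewrite ?mu_norm.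
Qed.

Section AtX.
Variable X : nat.
Hypothesis Xy : (X <= y ^ (70 * g + 1))%N.

Let XX0 : (X <= X0 ^ 2)%N := typeI_root_bound y10 Xy.
Let M : R := (y ^ (68 * g + 8))%:R.

Definition log_term (b : nat) : R :=
  \sum_(t <- gbox X0 | (inO X t && gpar t) && (b %| gabs2 t)%N) (spin t)%:~R * ln (gabs2 t %/ b)%:R.

Lemma typeI_termE n d : (n <= X)%N -> typeI_term R n g y d =
  \sum_(t <- [seq t <- gbox X0 | (inO X t && gpar t) && (d %| gabs2 t)%N] | (gabs2 t <= n)%N) (spin t)%:~R.
Proof.
move=> nX; rewrite big_filter_cond; apply: eq_bigl => t; rewrite /inO.
case: (leqP (gabs2 t) n) => h; first by rewrite (leq_trans h nX) !andbT.
by rewrite !andbF.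
Qed.

Lemma typeI_div n d : (n <= X)%N -> (0 < d <= y ^ (14 * g))%N -> `|typeI_term R n g y d| <= M * d%:R^-1.
Proof.
move=> nX hd; have d0 : (0 < d)%N by case/andP: hd.
rewrite ler_pdivlMr ?ltr0n // mulrC; apply: typeI_total => //.
exact: leq_trans nX Xy.
Qed.

(** The bound [typeI_div] holds for every truncation [n <= X] of the norm, so partial summation
    absorbs the increasing logarithm at the cost of twice its largest value. *)
Lemma log_term_le b : (0 < b <= y ^ (14 * g))%N -> `|log_term b| <= M * b%:R^-1 * (2%:R * y%:R).
Proof.
move=> hb; have b0 : (0 < b)%N by case/andP: hb.
pose h n : R := ln (n %/ b)%:R.
rewrite /log_term -big_filter.
apply: le_trans (@abel_bound R _ _ (fun t => (spin t)%:~R) gabs2 h X (M * b%:R^-1) _ _ _) _.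
- by move=> t; rewrite mem_filter => /andP [/andP [/andP [/and3P [_ _ ->]]]].
- by move=> n nX; rewrite -typeI_termE // typeI_div.
- left=> n _; rewrite /h; case: (posnP (n %/ b)%N) => [->|n0].
    by rewrite ln0 // ln_nat_ge0.
  by apply: ln_nat_le; rewrite n0 leq_div2r.
rewrite ler_wpM2l //; first by rewrite mulr_ge0 ?invr_ge0 ?ler0n.
have h0 : h 0%N = 0 by rewrite /h div0n ln0.
have hX : `|h X| <= y%:R by apply: lny_norm; apply: leq_trans (leq_div _ _) Xy.
by rewrite h0 subr0 mulr_natl mulr2n lerD.
Qed.

Lemma harmonic_y B : (0 < B <= y ^ (70 * g + 1))%N -> \sum_(1 <= b < B.+1) (b%:R : R)^-1 <= (y ^ 2)%:R.
Proof.
case/andP=> B0 hB; apply: le_trans (harmonic_le R B0) _.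
apply: (@le_trans _ _ (1 + y%:R)); first by rewrite lerD2l lny.
rewrite -[1]/(1%:R) -natrD ler_nat; clear -y10; nia.
Qed.

Definition Lam_big (m : nat) : R := if (V < m)%N then Lam R m else 0.

Definition small_Lam_sum : R :=
  \sum_(t <- gbox X0 | inO X t && gpar t) (spin t)%:~R * (if (gabs2 t <= V)%N then Lam R (gabs2 t) else 0).

Lemma inO_gabs2_gt0 t : inO X t -> (0 < gabs2 t)%N.
Proof.
move=> /and3P [h1 h2 _]; rewrite -ltz_nat gabs2E.
by rewrite ltr_pwDl ?exprn_gt0 ?sqr_ge0.
Qed.

Lemma sum_log_term : \sum_(1 <= b < V.+1) (mu b)%:~R * log_term b =
  \sum_(t <- gbox X0 | inO X t && gpar t) (spin t)%:~R *
    \sum_(b <- divisors (gabs2 t) | (b <= V)%N) (mu b)%:~R * ln (gabs2 t %/ b)%:R.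
Proof.
rewrite /log_term; under eq_bigr => b _ do rewrite big_mkcondr mulr_sumr.
rewrite exchange_big /=; apply: eq_bigr => t /andP [/inO_gabs2_gt0 n0 _].
rewrite sum_divisors_le // mulr_sumr; apply: eq_bigr => b _.
by case: ifP => _; rewrite ?mulr0 // mulrCA.
Qed.

Lemma sum_typeI_term :
  \sum_(1 <= b < V.+1) \sum_(1 <= a < V.+1) (mu b)%:~R * Lam R a * typeI_term R X g y (a * b) =
  \sum_(t <- gbox X0 | inO X t && gpar t) (spin t)%:~R *
    \sum_(b <- divisors (gabs2 t) | (b <= V)%N) (mu b)%:~R *
      \sum_(a <- divisors (gabs2 t %/ b) | (a <= V)%N) Lam R a.
Proof.
rewrite /typeI_term.
under eq_bigr => b _ do (under eq_bigr => a _ do rewrite big_mkcondr mulr_sumr; rewrite exchange_big /=).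
rewrite exchange_big /=; apply: eq_bigr => t /andP [/inO_gabs2_gt0 n0 _].
rewrite sum_divisors_le // mulr_sumr; apply: eq_big_nat => b /andP [b0 _].
case: ifP => bn; last first.
  rewrite mulr0 big1 // => a _; case: ifP => [h|_]; last by rewrite mulr0.
  by rewrite (dvdn_trans (dvdn_mull a (dvdnn b)) h) in bn.
rewrite sum_divisors_le ?divn_gt0 ?(dvdn_leq n0 bn) // !mulr_sumr; apply: eq_bigr => a _.
by rewrite dvdn_divRL //; case: ifP => _; rewrite ?mulr0 // mulrC.
Qed.

Lemma vaughan_split : \sum_(t <- gbox X0 | inO X t && gpar t) (spin t)%:~R * Lam R (gabs2 t) =
  small_Lam_sum + \sum_(1 <= b < V.+1) (mu b)%:~R * log_term b
  - \sum_(1 <= b < V.+1) \sum_(1 <= a < V.+1) (mu b)%:~R * Lam R a * typeI_term R X g y (a * b)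
  + spin_conv X X0 Lam_big (fun m => (gam V m)%:~R).
Proof.
rewrite sum_log_term sum_typeI_term /small_Lam_sum /spin_conv -big_split -sumrB -big_split.
apply: eq_bigr => t /andP [/inO_gabs2_gt0 n0 _] /=.
rewrite [X in _ * X = _](vaughan_identity R V V n0) -!mulrDr -mulrBr -mulrDr; congr (_ * (_ + _)).
rewrite big_mkcond; apply: eq_bigr => m _; rewrite /Lam_big.
by case: ifP => // _; rewrite mul0r.
Qed.

Lemma small_Lam_sum_le : `|small_Lam_sum| <= (y ^ (8 * g + 3))%:R.
Proof.
have hV : (V <= y ^ (70 * g + 1))%N by apply: ypow_le => //; clear; lia.
rewrite /small_Lam_sum.
apply: le_trans (ler_norm_sum _ _ _) _.
apply: (@le_trans _ _ (\sum_(t <- gbox X0 | (gabs2 t <= V)%N) y%:R)).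
  rewrite big_mkcond [leRHS]big_mkcond; apply: ler_sum => t _; case: ifP => _; last by case: ifP.
  case: ifP => h; last by rewrite mulr0 normr0.
  rewrite normrM -[leRHS]mul1r; apply: ler_pM => //; first exact: spin_norm.
  by apply: Lamy; apply: leq_trans h hV.
apply: le_trans (sum_le_count _ (fun t _ => lexx y%:R)) _.
rewrite -natrM ler_nat [(8 * g + 3)%N]addnS expnSr leq_mul2r; apply/orP; right.
apply: (@leq_trans (size (gbox (y ^ (4 * g))))).
  rewrite -size_filter; apply: uniq_leq_size; first by rewrite filter_uniq ?gbox_uniq.
  move=> t; rewrite mem_filter => /andP [h _]; apply: mem_gbox_gabs2; apply: leq_trans h _.
  by rewrite -expnM; apply: ypow_le => //; clear; lia.
rewrite size_gbox; have h := ypow_double1 y10 (leqnn (y ^ (4 * g))).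
by apply: leq_trans (ypow_mul h h) _; apply: ypow_le => //; clear; lia.
Qed.

Lemma sum_log_term_le : `|\sum_(1 <= b < V.+1) (mu b)%:~R * log_term b| <= (y ^ (68 * g + 12))%:R.
Proof.
have hV : (0 < V <= y ^ (70 * g + 1))%N.
  by rewrite ypow_gt0 //=; apply: ypow_le => //; clear; lia.
apply: le_trans (ler_norm_sum _ _ _) _.
apply: (@le_trans _ _ (\sum_(1 <= b < V.+1) M * (2%:R * y%:R) * b%:R^-1)).
  rewrite big_nat [leRHS]big_nat; apply: ler_sum => b /andP [b0 bV].
  rewrite mulrAC normrM -[leRHS]mul1r; apply: ler_pM => //.
    by rewrite -intr_norm lerz1 mu_norm.
  apply: log_term_le; rewrite b0 /=; apply: leq_trans (_ : V <= _)%N; first by [].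
  by apply: ypow_le => //; clear; lia.
rewrite -mulr_sumr; apply: le_trans (ler_wpM2l _ (harmonic_y hV)) _; first by rewrite !mulr_ge0.
rewrite /M -!natrM ler_nat.
rewrite [leqLHS](_ : _ = 2 * (y ^ (68 * g + 8) * y ^ 1 * y ^ 2))%N; last by rewrite expn1; ring.
by rewrite -!expnD; apply: leq_trans (ypow_scale y10 (c := 2) isT (leqnn _)) _; apply: ypow_le => //; clear; lia.
Qed.

(** The modulus [a b] stays within the reach [y ^ (14 g)] of [typeI_div], whose factor [1 / (a b)]
    turns the double sum into a product of two harmonic sums. *)
Lemma sum_typeI_term_le :
  `|\sum_(1 <= b < V.+1) \sum_(1 <= a < V.+1) (mu b)%:~R * Lam R a * typeI_term R X g y (a * b)|
    <= (y ^ (68 * g + 13))%:R.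
Proof.
have hV : (0 < V <= y ^ (70 * g + 1))%N.
  by rewrite ypow_gt0 //=; apply: ypow_le => //; clear; lia.
have hH := harmonic_y hV.
apply: le_trans (ler_norm_sum _ _ _) _.
apply: (@le_trans _ _ (\sum_(1 <= b < V.+1) b%:R^-1 * (y%:R * M * (y ^ 2)%:R))).
  rewrite big_nat [leRHS]big_nat; apply: ler_sum => b /andP [b0 bV].
  apply: le_trans (ler_norm_sum _ _ _) _.
  apply: (@le_trans _ _ (\sum_(1 <= a < V.+1) b%:R^-1 * (y%:R * M) * a%:R^-1)).
    rewrite big_nat [leRHS]big_nat; apply: ler_sum => a /andP [a0 aV].
    have h1 : `|(mu b)%:~R * Lam R a| <= y%:R.
      rewrite normrM -[leRHS]mul1r; apply: ler_pM => //.
        by rewrite -intr_norm lerz1 mu_norm.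
      by apply: Lamy; case/andP: hV => _; apply: leq_trans; rewrite -ltnS.
    have h2 : `|typeI_term R X g y (a * b)| <= M * (a * b)%:R^-1.
      apply: typeI_div => //; rewrite muln_gt0 a0 b0 /=.
      have -> : (14 * g = 7 * g + 7 * g)%N by clear; lia.
      by rewrite expnD leq_mul.
    rewrite normrM; apply: le_trans (ler_pM _ _ h1 h2) _ => //.
    by rewrite natrM invfM le_eqVlt; apply/orP; left; apply/eqP; ring.
  rewrite -mulr_sumr !mulrA ler_wpM2l // !mulr_ge0 ?invr_ge0 //.
rewrite -mulr_suml; apply: le_trans (ler_wpM2r _ hH) _; first by rewrite !mulr_ge0.
rewrite /M -!natrM ler_nat [leqLHS](_ : _ = y ^ 2 * (y ^ 1 * y ^ (68 * g + 8) * y ^ 2))%N; last by rewrite expn1.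
by rewrite -!expnD; apply: ypow_le => //; clear; lia.
Qed.

Lemma gam_small B m : (0 < B)%N -> (m <= B)%N -> gam B m = 0.
Proof.
(* [divisors 0] is [[:: 1]], so at 0 the sum is empty because [B >= 1]. *)
case: m => [|m] B0 h; first by rewrite /gam (_ : divisors 0 = [:: 1%N]) // big_mkcond big_seq1 ltnNge B0.
rewrite /gam big_seq_cond big1 // => b; rewrite -dvdn_divisors // => /andP [/(dvdn_leq (ltn0Sn m)) hb].
by rewrite ltnNge (leq_trans hb h).
Qed.

Lemma spin_conv_vaughan_le : `|spin_conv X X0 Lam_big (fun m => (gam V m)%:~R)| <= (y ^ (69 * g + 24))%:R.
Proof.
have y0 : (0 : R) < y%:R by rewrite ltr0n; clear -y10; lia.
(* Dividing by [y] brings the coefficients below 1, and cutting at [X] makes this hold for every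
   argument; the factor [y ^ 2] is restored at the end. *)
pose al m : R := if (m <= X)%N then Lam_big m / y%:R else 0.
pose be m : R := if (m <= X)%N then (gam V m)%:~R / y%:R else 0.
have -> : spin_conv X X0 Lam_big (fun m => (gam V m)%:~R) = y%:R ^+ 2 * spin_conv X X0 al be.
  rewrite /spin_conv mulr_sumr; apply: eq_bigr => t /andP [tO _].
  rewrite mulrCA; congr (_ * _); rewrite mulr_sumr.
  have n0 := inO_gabs2_gt0 tO; have nX : (gabs2 t <= X)%N by case/and3P: tO.
  apply: eq_big_seq => m; rewrite -dvdn_divisors // => hm.
  rewrite /al /be (leq_trans (dvdn_leq n0 hm) nX) (leq_trans (leq_div _ _) nX).
  by field; rewrite gt_eqF.
have b1 (u : R) : `|u| <= y%:R -> `|u / y%:R| <= 1.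
  by move=> h; rewrite normrM normfV (gtr0_norm y0) ler_pdivrMr // mul1r.
have hal m : `|al m| <= 1.
  rewrite /al; case: leqP => h; rewrite ?normr0 ?ler01 //; apply: b1; rewrite /Lam_big.
  by case: ifP => _; rewrite ?normr0 ?ler0n //; apply: Lamy; apply: leq_trans h Xy.
have hbe m : `|be m| <= 1.
  rewrite /be; case: leqP => h; rewrite ?normr0 ?ler01 //; apply: b1.
  case: (posnP m) => [->|m0]; first by rewrite gam_small ?ypow_gt0 // normr0 ler0n.
  by apply: gam_le; rewrite m0 (leq_trans h Xy).
have als m : al m != 0 -> (y ^ (7 * g) <= m)%N.
  rewrite /al /Lam_big; case: ifP => _; rewrite ?eqxx //; case: ltnP => h; rewrite ?mul0r ?eqxx // => _.
  exact: ltnW h.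
have bes m : be m != 0 -> (y ^ (7 * g) <= m)%N.
  rewrite /be; case: ifP => _; rewrite ?eqxx //; case: (leqP m V) => [h|/ltnW //].
  by rewrite gam_small ?ypow_gt0 // mul0r eqxx.
have := typeII_total XX0 y10 g1 gy tauy Xy hal hbe als bes.
rewrite normrM normrX normr_nat => h; apply: le_trans (ler_wpM2l _ h) _; first by rewrite exprn_ge0.
by rewrite -natrX -natrM ler_nat -expnD; apply: ypow_le => //; clear; lia.
Qed.

Lemma sum_Lam_le :
  `|\sum_(t <- gbox X0 | inO X t && gpar t) (spin t)%:~R * Lam R (gabs2 t)| <= (y ^ (69 * g + 26))%:R.
Proof.
have A (u v : R) k : `|u| <= (y ^ k)%:R -> `|v| <= (y ^ k)%:R -> `|u + v| <= (y ^ k.+1)%:R.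
  move=> hu hv; apply: le_trans (ler_normD _ _) _; apply: le_trans (lerD hu hv) _.
  by rewrite -natrD ler_nat; apply: (ypow_add y10).
have L (u : R) k l : (k <= l)%N -> `|u| <= (y ^ k)%:R -> `|u| <= (y ^ l)%:R.
  by move=> kl h; apply: le_trans h _; rewrite ler_nat ypow_le.
rewrite vaughan_split [(69 * g + 26)%N]addnS -addrA; apply: (A).
  rewrite [(69 * g + 25)%N]addnS; apply: (A).
    by apply: (L _ _ _ _ small_Lam_sum_le); clear; lia.
  by apply: (L _ _ _ _ sum_log_term_le); clear -g1; lia.
rewrite [(69 * g + 25)%N]addnS; apply: (A); last exact: spin_conv_vaughan_le.
by rewrite normrN; apply: (L _ _ _ _ sum_typeI_term_le); clear -g1; lia.
Qed.

End AtX.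
End Vaughan.

Lemma ln2_ge (R : realType) : 2%:R^-1 <= ln (2%:R : R).
Proof.
have h : -1 < - (2%:R : R)^-1 by lra.
have := le_ln1Dx h.
have -> : 1 + - (2%:R : R)^-1 = 2%:R^-1 by field.
by rewrite lnV ?posrE ?ltr0n // lerN2.
Qed.

Lemma tau_pfactor_ge p e : prime p -> (e < tau (p ^ e))%N.
Proof.
move=> pp; rewrite /tau -[leqLHS](size_iota 0) -[leqLHS](size_map (fun i => p ^ i)%N).
apply: uniq_leq_size.
  by rewrite map_inj_uniq ?iota_uniq // => i j /eqP; rewrite eqn_exp2l ?prime_gt1 // => /eqP.
move=> _ /mapP [i + ->]; rewrite mem_iota -dvdn_divisors ?expn_gt0 ?prime_gt0 // => hi.
exact: dvdn_exp2l.
Qed.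

(** * Removing the weight *)

Section PrimeSum.
Variables (R : realType) (g y : nat).
Hypothesis y10 : (10 <= y)%N.
Hypothesis g1 : (2 <= g)%N.
Hypothesis gy : (70 * g <= y)%N.
Hypothesis tauy : forall n, (0 < n <= y ^ (500 * g))%N -> (tau n <= y)%N.
Hypothesis lny : forall n, (n <= y ^ (70 * g + 1))%N -> ln (n%:R : R) <= y%:R.
Variable X : nat.
Hypothesis Xy : (X <= y ^ (70 * g + 1))%N.
Let X0 := (y ^ (35 * g + 1))%N.

Let tauX n : (0 < n <= X)%N -> (tau n <= y)%N.
Proof.
move=> /andP [n0 nX]; apply: tauy; rewrite n0; apply: leq_trans nX (leq_trans Xy _).
by apply: ypow_le => //; clear -g1; lia.
Qed.

(** The norm is [p ^ e] with [e >= 2], so [p <= X0]; also [e < tau (p ^ e) <= y], and each norm is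
    attained at most [y] times. *)
Lemma count_prime_powers :
  (count (fun t => [&& inO X t, gpar t, gprim t, ~~ prime (gabs2 t) & Lam R (gabs2 t) != 0%R])
     (gbox X0) <= X0 * y * y)%N.
Proof.
pose f t := (pdiv (gabs2 t), logn (pdiv (gabs2 t)) (gabs2 t)).
pose J := [seq (p, e) | p <- iota 1 X0, e <- iota 0 y].
have pf t : inO X t -> Lam R (gabs2 t) != 0 -> exists p e,
    [/\ prime p, (0 < e)%N, f t = (p, e) & gabs2 t = (p ^ e)%N].
  move=> /inO_gabs2_gt0 n0 /(Lam_pfactor n0) [p [e [pp e0 E]]]; exists p, e; split=> //.
  by rewrite /f E; case: (e) e0 => // k _; rewrite pdiv_pfactor // pfactorK.
rewrite (@count_fibres _ _ _ J f).
- rewrite (_ : X0 * y = size J)%N; last by rewrite size_allpairs !size_iota.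
  apply: sum_le_size => -[p e] _; rewrite -size_filter; set s := filter _ _.
  have sP t : t \in s -> [/\ inO X t, gpar t, gprim t & gabs2 t = (p ^ e)%N].
    rewrite mem_filter => /andP [/andP [/and5P [tO pt prt _ L0] /eqP ef] _]; split=> //.
    by have [p' [e' [_ _ E ->]]] := pf t tO L0; move: E; rewrite ef => -[-> ->].
  case es : s => [//|t0 s']; have t0s : t0 \in s by rewrite es mem_head.
  have [tO pt0 _ E] := sP t0 t0s; rewrite -es.
  apply: (@leq_trans (tau (p ^ e))); last first.
    by apply: tauX; rewrite -E (inO_gabs2_gt0 tO) /=; case/and3P: tO.
  apply: gabs2_count; first by rewrite -E gpar_odd.
    by rewrite filter_uniq ?gbox_uniq.
  move=> t /sP [/and3P [t1 _ _] /andP [o1 o2] pt ->]; split=> //.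
  by rewrite /gnormal t1 o1 o2.
- by rewrite allpairs_uniq ?iota_uniq // => -[a b] [a' b'] _ _ [-> ->].
move=> t _ /and5P [tO pt prt npr L0]; have [p [e [pp e0 -> E]]] := pf t tO L0.
have nX : (gabs2 t <= X)%N by case/and3P: tO.
apply/allpairsP; exists (p, e); rewrite !mem_iota /= add0n; split=> //; last first.
  apply: leq_trans (tau_pfactor_ge e pp) _; rewrite -E; apply: tauX.
  by rewrite (inO_gabs2_gt0 tO).
rewrite prime_gt0 //= add1n ltnS -(@leq_exp2r _ _ 2) //.
apply: leq_trans (typeI_root_bound y10 Xy); apply: leq_trans nX; rewrite E.
rewrite (leq_exp2l _ _ (prime_gt1 pp)); case: e e0 E => [|[|k]] // _ E.
by rewrite E expn1 pp in npr.
Qed.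

(** The maximum with 2 keeps the logarithm positive at 0 and 1, so that the weight is bounded and
    decreasing from 0 on, as [abel_bound] requires. *)
Definition inv_log (n : nat) : R := (ln (maxn n 2)%:R)^-1.

Lemma inv_log_bounds n : 0 <= inv_log n <= 2%:R.
Proof.
have h : 2%:R^-1 <= ln (maxn n 2)%:R :> R.
  by apply: le_trans (ln2_ge R) _; apply: ln_nat_le; rewrite leq_maxr.
have h0 : 0 < ln (maxn n 2)%:R :> R by apply: lt_le_trans h; rewrite invr_gt0 ltr0n.
by rewrite invr_ge0 (ltW h0) /= -[leRHS]invrK lef_pV2 // posrE invr_gt0 ltr0n.
Qed.

Lemma inv_log_decr n : inv_log n.+1 <= inv_log n.
Proof.
have p m : 0 < ln (maxn m 2)%:R :> R.
  by rewrite ln_gt0 // ltr1n leq_maxr.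
rewrite lef_pV2 ?posrE //; apply: ln_nat_le.
rewrite (leq_trans _ (leq_maxr n 2)) //=; clear; lia.
Qed.

Lemma Lam_inv_log_le n : (0 < n)%N -> 0 <= Lam R n * inv_log n <= 1.
Proof.
move=> n0; have /andP [h0 _] := inv_log_bounds n; rewrite mulr_ge0 ?Lam_ge0 //=.
have p : 0 < ln (maxn n 2)%:R :> R by rewrite ln_gt0 // ltr1n leq_maxr.
rewrite ler_pdivrMr // mul1r; apply: le_trans (Lam_le R n0) _; apply: ln_nat_le.
by rewrite n0 leq_maxl.
Qed.

Lemma Lam_inv_log_prime p : prime p -> Lam R p * inv_log p = 1.
Proof.
move=> pp; have p1 := prime_gt1 pp.
rewrite Lam_prime // /inv_log; have -> : maxn p 2 = p by clear -p1; lia.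
by rewrite divff // gt_eqF // ln_gt0 // ltr1n.
Qed.

Definition prime_spin_sum : R :=
  \sum_(t <- gbox X0 | (inO X t && gpar t) && prime (gabs2 t)) (spin t)%:~R.

Lemma prime_spin_sum_le : `|prime_spin_sum| <= (y ^ (69 * g + 28))%:R.
Proof.
have P0 : forall k, (0 : R) <= (y ^ k)%:R by move=> k; apply: ler0n.
pose W t : R := (spin t)%:~R * Lam R (gabs2 t) * inv_log (gabs2 t).
pose s := [seq t <- gbox X0 | inO X t && gpar t].
have hA : `|\sum_(t <- s) W t| <= (y ^ (69 * g + 27))%:R.
  apply: le_trans (@abel_bound R _ _ (fun t => (spin t)%:~R * Lam R (gabs2 t)) gabs2 inv_log X
     (y ^ (69 * g + 26))%:R _ _ _) _.
  - by move=> t; rewrite mem_filter => /andP [/andP [/and3P [_ _ ->]]].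
  - move=> n nX; have := sum_Lam_le y10 g1 gy tauy lny (leq_trans nX Xy).
    rewrite big_filter_cond; congr (`|_| <= _); apply: eq_bigl => t; rewrite /inO.
    case: (leqP (gabs2 t) n) => h; first by rewrite (leq_trans h nX) !andbT.
    by rewrite !andbF.
  - by right=> n _; apply: inv_log_decr.
  have /andP [a1 a2] := inv_log_bounds X; have /andP [b1 b2] := inv_log_bounds 0.
  have h4 : `|inv_log X| + `|inv_log X - inv_log 0| <= 10%:R.
    have : `|inv_log X - inv_log 0| <= 2%:R by rewrite ler_norml; apply/andP; split; lra.
    by rewrite (ger0_norm a1); lra.
  apply: le_trans (ler_wpM2l (P0 _) h4) _; rewrite -natrM ler_nat mulnC.
  by rewrite [(69 * g + 27)%N]addnS; apply: ypow_scale.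
have hB : `|\sum_(t <- s | ~~ prime (gabs2 t)) W t| <= (y ^ (69 * g + 27))%:R.
  apply: le_trans (ler_norm_sum _ _ _) _.
  apply: (@le_trans _ _ (\sum_(t <- gbox X0 |
     [&& inO X t, gpar t, gprim t, ~~ prime (gabs2 t) & Lam R (gabs2 t) != 0]) 1)).
    rewrite big_filter_cond big_mkcond [leRHS]big_mkcond; apply: ler_sum => t _.
    case: ifP => [/andP [/andP [tO pt] npr]|]; last by case: ifP.
    rewrite tO pt npr /=; have [prt|nprt] := boolP (gprim t); last first.
      by rewrite /W (spin_nprim pt nprt) !mul0r normr0.
    have [L0|L0] := eqVneq (Lam R (gabs2 t)) 0; first by rewrite /W L0 mulr0 mul0r normr0.
    have /andP [c1 c2] := Lam_inv_log_le (inO_gabs2_gt0 tO).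
    rewrite /W -mulrA normrM (ger0_norm c1) -[leRHS]mul1r; apply: ler_pM => //.
    exact: spin_norm.
  apply: le_trans (sum_le_count _ (fun t _ => lexx (1 : R))) _; rewrite mulr1 ler_nat.
  apply: leq_trans count_prime_powers _; rewrite -mulnA mulnn /X0 -expnD.
  by apply: ypow_le => //; clear; lia.
have -> : prime_spin_sum = \sum_(t <- s) W t - \sum_(t <- s | ~~ prime (gabs2 t)) W t.
  rewrite [X in X - _](bigID (fun t => prime (gabs2 t))) /= addrK big_filter_cond.
  by apply: eq_bigr => t /andP [_ pt]; rewrite /W -mulrA Lam_inv_log_prime // mulr1.
apply: le_trans (ler_normB _ _) _; apply: le_trans (lerD hA hB) _.
by rewrite -natrD ler_nat [(69 * g + 28)%N]addnS; apply: (ypow_add y10).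
Qed.
End PrimeSum.

(** * From Gaussian integers of prime norm back to the original sum *)

Lemma gabs2_nat r s : gabs2 (r%:Z, s%:Z) = (r ^ 2 + s ^ 2)%N.
Proof. by apply/eqP; rewrite -eqz_nat gabs2E. Qed.

(** For odd [p], an odd [r] forces [s] to be even, so the pairs are exactly the points of norm [p]
    in the positive quadrant that satisfy [gpar]. *)
Lemma spin_at_odd X0 p : odd p -> (p <= X0 ^ 2)%N ->
  spin_at p = \sum_(t <- gbox X0 | (inO p t && gpar t) && (gabs2 t == p)) spin t.
Proof.
move=> op pX; pose J := [seq (r, s) | r <- index_iota 1 p.+1, s <- index_iota 1 p.+1].
pose c (q : nat * nat) : gint := (q.1%:Z, q.2%:Z).
pose K := [seq q <- J | odd q.1 && (q.1 ^ 2 + q.2 ^ 2 == p)%N].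
have -> : spin_at p = \sum_(q <- K) spin (c q).
  rewrite /spin_at /K big_filter big_mkcond [RHS]big_mkcond big_allpairs /=.
  apply: eq_bigr => r _; case: ifP => o /=; last by rewrite big1.
  by rewrite big_mkcond.
have ci : injective c by move=> [r s] [r' s'] [-> ->].
rewrite -(big_map c predT) -[RHS]big_filter; apply: perm_big; apply: uniq_perm.
- by rewrite map_inj_uniq // filter_uniq // allpairs_uniq ?iota_uniq // => -[a b] [a' b'] _ _ [-> ->].
- by rewrite filter_uniq ?gbox_uniq.
move=> t; apply/mapP/idP.
  move=> [[r s]]; rewrite mem_filter => /andP [/andP [or_ /eqP e]].
  move=> /allpairsP [[r' s'] [hr hs [er es]]] ->; subst r' s'.
  rewrite !mem_index_iota /= in hr hs.
  have n : gabs2 (c (r, s)) = p by rewrite gabs2_nat.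
  have os : ~~ odd s by move: op; rewrite -e oddD !oddX /= or_ addTb.
  rewrite mem_filter n eqxx mem_gbox_gabs2 ?n // /inO n leqnn /gpar /= or_ os !andbT.
  by rewrite !ltz_nat; clear -hr hs; lia.
case: t => a b; rewrite mem_filter => /andP [/andP [/andP [/and3P [/= a0 b0 _] /andP [/= oa _]] /eqP n] _].
have [r ea] : exists r : nat, a = r%:Z by exists `|a|%N; rewrite gtz0_abs.
have [s eb] : exists s : nat, b = s%:Z by exists `|b|%N; rewrite gtz0_abs.
subst a b; rewrite gabs2_nat in n; rewrite !ltz_nat in a0 b0.
exists (r, s) => //; rewrite /K mem_filter /= oa n eqxx /=.
apply/allpairsP; exists (r, s); rewrite !mem_index_iota /= a0 b0 !ltnS -n; split=> //.
  by rewrite -mulnn; apply: leq_trans (leq_addr _ _); rewrite leq_pmulr.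
by rewrite -!mulnn; apply: leq_trans (leq_addl _ _); rewrite leq_pmulr.
Qed.

Lemma spin_at_le p : `|spin_at p| <= (p ^ 2)%:Z.
Proof.
rewrite /spin_at -mulnn PoszM big_mkcond.
apply: le_trans (norm_sum_le_size (c := p%:Z) _) _; last by rewrite size_iota subn1 natz.
move=> r _; case: ifP => _; last by rewrite normr0.
rewrite big_mkcond.
apply: le_trans (norm_sum_le_size (c := 1) _) _; last by rewrite size_iota subn1 mulr1 natz.
by move=> s _; case: ifP => _; rewrite ?jacobi_norm ?normr0.
Qed.

Definition spin_sum_nat (N : nat) : int := \sum_(0 <= p < N.+1 | prime p) spin_at p.

Lemma spin_sum_nat_le N : `|spin_sum_nat N| <= (N.+1 ^ 3)%:Z.
Proof.
rewrite /spin_sum_nat big_mkcond expnS PoszM.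
apply: le_trans (norm_sum_le_size (c := (N.+1 ^ 2)%:Z) _) _; last by rewrite size_iota subn0 natz.
move=> p; rewrite mem_index_iota => /andP [_ hp]; case: ifP => _; last by rewrite normr0.
by apply: le_trans (spin_at_le p) _; rewrite lez_nat leq_exp2r // ltnW.
Qed.

(* Through [e < tau (2 ^ e)], a bound for the divisor function bounds the logarithm. *)
Lemma ln_le_of_tau (R : realType) N y : (forall n, (0 < n <= N)%N -> (tau n <= y)%N) ->
  forall n, (n <= N)%N -> ln (n%:R : R) <= y%:R.
Proof.
move=> h n nN; case: (posnP n) => [->|n0]; first by rewrite ln0 // ler0n.
have /andP [l1 l2] := trunc_log_bounds (isT : (1 < 2)%N) n0.
set e := trunc_log 2 n in l1 l2.
have ey : (e.+1 <= y)%N.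
  apply: leq_trans (tau_pfactor_ge e (isT : prime 2)) _; apply: h.
  by rewrite expn_gt0 (leq_trans l1 nN).
apply: (@le_trans _ _ (ln (2 ^ e.+1)%:R)); first by apply: ln_nat_le; rewrite n0 ltnW.
rewrite natrX lnXn ?ltr0n // -[leLHS]mulr_natr; apply: (@le_trans _ _ (e.+1)%:R); last by rewrite ler_nat.
rewrite -[leRHS]mul1r; apply: ler_wpM2r => //.
have h1 : -1 < (1 : R) by lra.
exact: le_ln1Dx h1.
Qed.

Lemma spin_sum_nat_bound (R : realType) g y N : (10 <= y)%N -> (2 <= g)%N -> (70 * g <= y)%N ->
  (forall n, (0 < n <= y ^ (500 * g))%N -> (tau n <= y)%N) -> (N <= y ^ (70 * g + 1))%N ->
  `|(spin_sum_nat N)%:~R : R| <= (y ^ (69 * g + 29))%:R.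
Proof.
move=> y10 g1 gy tauy Ny.
have hle : (y ^ (70 * g + 1) <= y ^ (500 * g))%N by apply: ypow_le => //; clear -g1; lia.
have lny n : (n <= y ^ (70 * g + 1))%N -> ln (n%:R : R) <= y%:R.
  by move=> h; apply: (ln_le_of_tau R tauy); apply: leq_trans h hle.
pose X0 := (y ^ (35 * g + 1))%N.
have NX : (N <= X0 ^ 2)%N := typeI_root_bound y10 Ny.
have odd_part : \sum_(0 <= p < N.+1 | prime p && (p != 2)) (spin_at p)%:~R = prime_spin_sum R g y N.
  rewrite /prime_spin_sum -/X0 -[RHS]big_filter.
  rewrite (@sum_fibres _ _ _ _ [seq p <- index_iota 0 N.+1 | prime p && (p != 2)] gabs2).
  - rewrite -big_filter; apply: eq_big_seq => p; rewrite mem_filter mem_index_iota ltnS.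
    move=> /andP [/andP [pp p2] /andP [_ pN]].
    have op : odd p by case: (even_prime pp) p2 => [->|].
    rewrite [RHS]big_filter_cond (spin_at_odd op (leq_trans pN NX)) rmorph_sum /=.
    apply: eq_bigl => t; case: (eqVneq (gabs2 t) p) => [e|_]; last by rewrite !andbF.
    by rewrite /inO e leqnn pN pp !andbT.
  - by rewrite filter_uniq ?iota_uniq.
  move=> t; rewrite !mem_filter mem_index_iota ltnS => /andP [/andP [/andP [/and3P [_ _ tN] pt] pp] _].
  rewrite pp tN /= andbT; apply/eqP => e; have := gpar_odd pt; by rewrite e.
have -> : (spin_sum_nat N)%:~R = (\sum_(0 <= p < N.+1 | prime p && (p == 2)) spin_at p)%:~R +
    prime_spin_sum R g y N.
  by rewrite -odd_part /spin_sum_nat (bigID (fun p => p == 2)) /= rmorphD /= [X in _ + X]rmorph_sum.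
apply: le_trans (ler_normD _ _) _.
apply: (@le_trans _ _ ((y ^ (69 * g + 28))%:R + (y ^ (69 * g + 28))%:R)); last first.
  by rewrite -natrD ler_nat [(69 * g + 29)%N]addnS; apply: (ypow_add y10).
apply: lerD; last exact: prime_spin_sum_le.
(* The prime 2 is a sum of two odd squares, outside [gpar]; it is bounded separately by
   [spin_at_le]. *)
apply: (@le_trans _ _ 4%:R).
  rewrite -intr_norm (_ : 4%:R = (4%:Z)%:~R) // ler_int.
  rewrite (eq_bigl (fun p => p == 2%N)); last by move=> p; case: eqP => [->|]; rewrite ?andbF.
  rewrite -big_filter; apply: (@le_trans _ _ (\sum_(p <- [seq p <- index_iota 0 N.+1 | p == 2%N]) `|spin_at p|)).
    exact: ler_norm_sum.
  have : (size [seq p <- index_iota 0 N.+1 | p == 2%N] <= 1)%N.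
    rewrite size_filter count_uniq_mem ?iota_uniq //; by case: (_ \in _).
  have : all (fun p => p == 2%N) [seq p <- index_iota 0 N.+1 | p == 2%N] by rewrite filter_all.
  case: [seq _ <- _ | _] => [|p [|//]] /=; first by rewrite big_nil.
  by rewrite andbT => /eqP -> _; rewrite big_seq1; apply: le_trans (spin_at_le 2) _.
rewrite ler_nat; apply: (@leq_trans (y ^ 1)); first by rewrite expn1; clear -y10; lia.
by apply: ypow_le => //; clear; lia.
Qed.

Lemma pow_threshold k N : (0 < k)%N -> (0 < N)%N -> exists y, (y ^ k <= N < y.+1 ^ k)%N.
Proof.
move=> k0 N0; have h0 : exists y, (y ^ k <= N)%N by exists 0%N; rewrite exp0n.
have hb y : (y ^ k <= N)%N -> (y <= N)%N.
  by apply: leq_trans; case: y => // y; rewrite -[leqLHS]expn1 leq_pexp2l.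
case: (ex_maxnP h0 hb) => y hy hm; exists y; rewrite hy /= ltnNge.
by apply/negP => /hm; rewrite ltnn.
Qed.

(** An integer between [y ^ k] and [(y + 1) ^ k] thus stays below [y ^ (k + 1)], the upper bound on
    [N] that the estimates assume. *)
Lemma succ_pow_le y k : (2 ^ k <= y)%N -> (y.+1 ^ k <= y ^ k.+1)%N.
Proof.
move=> h; have y0 : (0 < y)%N by apply: leq_trans h; rewrite expn_gt0.
case: k h => [|k] h; first by rewrite expn0 expn1.
apply: (@leq_trans ((2 * y) ^ k.+1)); first by rewrite leq_exp2r //; clear -y0; lia.
by rewrite expnMn [leqRHS]expnS leq_mul2r h orbT.
Qed.

Theorem theorem2 (R : realType) :
  exists C : R, forall x : R, 2 <= x ->
    `| (spin_sum x)%:~R | <= C * (x `^ (76%:R / 77%:R)).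
Proof.
(* [x ^ (76 / 77) >= y ^ (69 g + g / 11)], and [g = 11 * 29] absorbs the loss [y ^ 29]. *)
have [g gE] : exists g, g = (11 * 29)%N by eexists.
have g1 : (319 <= g)%N by rewrite gE.
have [D [D0 hD]] := divisor_bound (500 * g).+1.
clear gE.
(* [y >= Y] grants [y >= 10], [70 g <= y], [2 ^ k <= y] for [succ_pow_le], and [D <= y], which turns
   [divisor_bound] into [tau n <= y]. *)
pose k := (70 * g)%N; pose Y := (10 + k + 2 ^ k + D)%N.
have k0 : (0 < k)%N by rewrite /k; clear -g1; lia.
(* The constant serves [N < Y ^ k], where the trivial cubic bound suffices; for larger [N] the value
   1 would do. *)
pose C : R := ((Y ^ k).+1 ^ 3)%:R.
have C1 : 1 <= C by rewrite ler1n expn_gt0.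
exists C => x x2; have x1 : 1 <= x by lra.
have x0 : 0 <= x by lra.
set N := Num.truncn x.
have -> : spin_sum x = spin_sum_nat N by [].
have Nx : N%:R <= x by rewrite truncn_le.
have N0 : (0 < N)%N by rewrite truncn_gt0.
pose e : R := 76%:R / 77%:R; have e0 : 0 <= e by rewrite divr_ge0 ?ler0n.
have X1 : 1 <= x `^ e by rewrite -[leLHS](powRr0 x); apply: ler_powR.
rewrite -/e.
case: (ltnP N (Y ^ k)) => hN.
  apply: (@le_trans _ _ C); last by rewrite ler_peMr // (le_trans _ C1).
  rewrite -intr_norm; apply: (@le_trans _ _ ((N.+1 ^ 3)%:Z)%:~R); first by rewrite ler_int spin_sum_nat_le.
  by rewrite -pmulrn ler_nat leq_exp2r // ltnS ltnW.
have [y /andP [y1 y2]] := pow_threshold k0 N0.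
have Yy : (Y <= y)%N.
  by rewrite -ltnS -(ltn_exp2r _ _ k0); apply: leq_ltn_trans y2.
have y10 : (10 <= y)%N by apply: leq_trans Yy; rewrite /Y; clear; lia.
have ky : (k <= y)%N by apply: leq_trans Yy; rewrite /Y; clear; lia.
have k2y : (2 ^ k <= y)%N by apply: leq_trans Yy; rewrite /Y; clear; lia.
have Dy : (D <= y)%N by apply: leq_trans Yy; rewrite /Y; clear; lia.
have tauy n : (0 < n <= y ^ (500 * g))%N -> (tau n <= y)%N.
  case/andP=> n0 hn; rewrite -(leq_exp2r _ _ (ltn0Sn (500 * g))).
  by apply: leq_trans (hD n n0) _; rewrite expnS leq_mul.
have Ny : (N <= y ^ (70 * g + 1))%N.
  by rewrite addn1; apply: leq_trans (ltnW y2) (succ_pow_le k2y).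
have g2 : (2 <= g)%N by clear -g1; lia.
apply: le_trans (spin_sum_nat_bound R y10 g2 ky tauy Ny) _.
rewrite -[leLHS]mul1r; apply: ler_pM => //.
have yR : 1 <= y%:R :> R by rewrite ler1n; clear -y10; lia.
have yR0 : 0 <= y%:R :> R by rewrite ler0n.
apply: (@le_trans _ _ ((y ^ k)%:R `^ e)); last first.
  apply: ge0_ler_powR => //; rewrite ?nnegrE ?ler0n //.
  by apply: le_trans Nx; rewrite ler_nat.
rewrite !natrX -!powR_mulrn // -powRrM; apply: ler_powR => //.
rewrite /e /k natrD !natrM.
have gR : 319%:R <= g%:R :> R by rewrite ler_nat.
lra.
Qed.
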